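(* Let $k\ge0$, $0<\alpha\le1$, and let $x\in\mathbf{R}^2\setminus\overline{C(\pi\alpha/2)}$. Then, as $\tau\to\infty$, $$E^k_\alpha(x;\tau)=\left(\frac{k|x|}{2}\right)^2\frac{\hat J_1(k|x|)}{x_1+ix_2}\,\frac{1}{\Gamma(1-\alpha)}\,\frac{\log\tau}{\tau}+O\left(\frac1\tau\right)$$ and, for $j=1,2$, $$\frac{\partial}{\partial x_j}E^k_\alpha(x;\tau)=\frac{\partial}{\partial x_j}\left\{\left(\frac{k|x|}{2}\right)^2\frac{\hat J_1(k|x|)}{x_1+ix_2}\right\}\frac{1}{\Gamma(1-\alpha)}\,\frac{\log\tau}{\tau}+O\left(\frac1\tau\right).$$ These asymptotics are valid uniformly in the region $\{x\in\mathbf{R}^2\setminus\overline{C(\pi\alpha/2+\epsilon)}: R^{-1}<|x|<R\}$ for given $\epsilon$ with $0<\epsilon<\pi-\pi\alpha/2$ and given $R>0$.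
   Context: For $0<\theta<\pi$, $C(\theta)=\{x=(x_1,x_2)\in\mathbf{R}^2: x_1>|x|\cos\theta\}$. Let $J_m$ be the Bessel function of order $m$ and $\hat J_m(t)=(2/t)^m m!\,J_m(t)$ with $\hat J_m(0)=1$. For $\tau>0$, $$E^k_\alpha(x;\tau)=\sum_{m=0}^\infty\frac{\{\tau(x_1+ix_2)\}^m}{\Gamma(\alpha m+1)}\,\hat J_m(k|x|),\quad x\in\mathbf{R}^2.$$ Convention: $1/\Gamma(1-\alpha)=0$ when $\alpha=1$. *)

(* Defs.v *)
From Stdlib Require Import Reals Factorial.
From Coquelicot Require Import Coquelicot.
Open Scope R_scope.

(* Points of R^2 are pairs [x : R * R]. *)

Definition enorm (x : R * R) : R := sqrt (fst x ^ 2 + snd x ^ 2).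

Definition cplx (x : R * R) : C :=
  (RtoC (fst x) + Ci * RtoC (snd x))%C.

Definition cone (theta : R) (x : R * R) : Prop :=
  fst x > enorm x * cos theta.

Definition closure {T : UniformSpace} (A : T -> Prop) (x : T) : Prop :=
  forall P : T -> Prop, locally x P -> exists y, P y /\ A y.

(* Euler's integral; it converges exactly for [0 < s]. *)
Definition Gamma (s : R) : R :=
  RInt_gen (fun t : R => Rpower t (s - 1) * exp (- t))
    (at_right 0) (Rbar_locally p_infty).

(* The reciprocal of Gamma on [0 <= s], with 1 / Gamma(0) = 0. *)
Definition inv_Gamma (s : R) : R :=
  if Req_EM_T s 0 then 0 else / Gamma s.

Definition BesselJ (m : nat) (t : R) : R :=
  Series (fun l : nat =>
    (-1) ^ l / (INR (fact l) * INR (fact (m + l))) * (t / 2) ^ (2 * l + m)).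

Definition Jhat (m : nat) (t : R) : R :=
  if Req_EM_T t 0 then 1
  else (2 / t) ^ m * INR (fact m) * BesselJ m t.

(* Coquelicot's [Series] is real valued; a complex series is summed
   componentwise. *)
Definition CSeries (a : nat -> C) : C :=
  (Series (fun m => Re (a m)), Series (fun m => Im (a m))).

Definition E (k alpha tau : R) (x : R * R) : C :=
  CSeries (fun m : nat =>
    ((RtoC tau * cplx x) ^ m / RtoC (Gamma (alpha * INR m + 1))
     * RtoC (Jhat m (k * enorm x)))%C).

Definition leading_coef (k : R) (x : R * R) : C :=
  (RtoC ((k * enorm x / 2) ^ 2) * (RtoC (Jhat 1 (k * enorm x)) / cplx x))%C.

(* Coordinates are numbered 1 and 2; [coord x j] and [set_coord x j t] are only
   used for those two values of [j]. *)
Definition coord (x : R * R) (j : nat) : R :=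
  if Nat.eqb j 1 then fst x else snd x.

Definition set_coord (x : R * R) (j : nat) (t : R) : R * R :=
  if Nat.eqb j 1 then (t, snd x) else (fst x, t).

Definition ex_partial (j : nat) (f : R * R -> C) (x : R * R) : Prop :=
  ex_derive (K := R_AbsRing) (V := C_R_NormedModule)
    (fun t : R => f (set_coord x j t)) (coord x j).

(* Real partial derivative of a complex-valued function, componentwise;
   meaningful where [ex_partial j f x]. *)
Definition partial (j : nat) (f : R * R -> C) (x : R * R) : C :=
  (Derive (fun t : R => Re (f (set_coord x j t))) (coord x j),
   Derive (fun t : R => Im (f (set_coord x j t))) (coord x j)).

(* [f tau x = O(g tau)] as tau -> +oo, uniformly for [x] in [D]: both the
   constant and the threshold on tau are independent of [x]. *)
Definition bigO_unif (D : R * R -> Prop) (f : R -> R * R -> C) (g : R -> R)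
  : Prop :=
  exists M : R, Rbar_locally p_infty (fun tau : R =>
    forall x : R * R, D x -> Cmod (f tau x) <= M * Rabs (g tau)).

(* Main.v *)
(** The power series with coefficients [1 / Gamma(alpha m + 1)] is summed by
    Hankel's contour integral: [t^(z-1) / Gamma(z)] is the integral of
    [e^(s t) s^(-z) ds / (2 pi i)] over a contour around the negative axis, which
    is identified by taking Laplace transforms at [1] and computing the residue
    of [s^(-z) / (1 - s)] at [s = 1].  Summing a geometric series under the
    integral and shrinking the contour past no pole (this uses
    [|arg zeta| > pi alpha / 2]) gives, for the Mittag-Leffler function,
    [E_alpha(zeta) = - 1 / (Gamma(1 - alpha) zeta) + O(|zeta|^-2)], and likewise
    for [zeta E_alpha'(zeta)].  All contours are written in the coordinate
    [w = log s], so that only the complex exponential is needed, and they are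
    truncated at [Re w = L], with [L -> oo] taken last.

    The Bessel factors come from
    [Jhat_m = 1 - X int_0^1 w^m Jhat_1(sqrt(1 - w) .) dw], [X = (k|x|/2)^2], hence
    [E^k(x; tau) = E_alpha(tau z) - X int_0^1 E_alpha(w tau z) Jhat_1(k|x| sqrt(1 - w)) dw];
    the [1 / (w tau z)] tail of the integrand on [1 / (tau|z|) <= w <= 1] produces
    the logarithm.  Termwise derivatives are integrals of the same kind. *)

Require Import Defs.
From Stdlib Require Import Reals Factorial Lra Lia.
From Coquelicot Require Import Coquelicot.
Open Scope R_scope.

(** * Complex differentiability and continuity *)

(* Coquelicot's carriers are convertible to [R] and [C], but [ring] only
   recognises the latter two. *)
Ltac eqR := match goal with |- ?l = ?r => change (@eq R l r) end.
Ltac eqC := match goal with |- ?l = ?r => change (@eq C l r) end.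

(** The obstacle is uniformity. With q = zeta e^(-alpha w), the geometric series behind the
    Mittag-Leffler sum converges only for |q| < 1, that is far to the right on the contour, at a
    place that moves with zeta. Hence only finite sums and truncated contours occur: the constants
    of the asymptotics are fixed before the number n of terms and the truncation L, and the
    tolerance [eta] left by the finite sums disappears only in [uniform_asymptotics]. The decay
    |zeta|^-2 survives because, once the sum is replaced by its closed form, the contour is moved
    back to the start Re w = 0, which does not depend on zeta. The case alpha = 1 escapes the
    Laplace argument, as Euler's integral diverges at 0; there the kernel has an explicit primitive,
    which gives the value 0. For the derivatives, write q_m for [q_bessel m] and X = (k|x|/2)^2.
    Differentiation yields two sums, with factors m q_m(X) and q_(m+1)(X) / (m + 1), each with a
    logarithmic term of its own. The two terms add up to the derivative of the leading coefficient
    because (X q_1(X))' = q_0(X). *)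

Definition holo (f : C -> C) (z : C) : Prop :=
  ex_derive (K := C_AbsRing) (V := AbsRing_NormedModule C_AbsRing) f z.

Lemma is_derive_C_intro (f : C -> C) (z l : C) :
  (forall eps : posreal, exists d : posreal, forall h : C, Cmod h < d ->
     Cmod (f (z + h)%C - f z - l * h)%C <= eps * Cmod h) ->
  is_derive (K := C_AbsRing) (V := AbsRing_NormedModule C_AbsRing) f z l.
Proof.
  intros H; split.
  - apply is_linear_scal_l.
  - intros x Hx.
    assert (E0 : z = x) by exact (is_filter_lim_locally_unique (V := AbsRing_NormedModule C_AbsRing) z x Hx).
    subst x.
    intros eps; destruct (H eps) as [d Hd].
    exists d; intros y Hy.
    change C in y; change (Cmod (y - z)%C < d) in Hy.
    specialize (Hd (y - z)%C Hy).
    replace (z + (y - z))%C with y in Hd by ring.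
    change (Cmod (f y - f z - (y - z) * l)%C <= eps * Cmod (y - z)%C).
    replace ((y - z) * l)%C with (l * (y - z))%C by ring; exact Hd.
Qed.

Lemma holo_elim (f : C -> C) (z : C) : holo f z ->
  exists l : C, forall eps : posreal, exists d : posreal,
    forall h : C, Cmod h < d -> Cmod (f (z + h)%C - f z - l * h)%C <= eps * Cmod h.
Proof.
  intros [l [_ H]]; exists l; intros eps.
  destruct (H z (fun P HP => HP) eps) as [d Hd]; exists d; intros h Hh.
  assert (B : Cmod (z + h - z)%C < d) by (replace (z + h - z)%C with h by ring; exact Hh).
  specialize (Hd (z + h)%C B).
  change (Cmod (f (z + h)%C - f z - (z + h - z) * l)%C <= eps * Cmod (z + h - z)%C) in Hd.
  replace (z + h - z)%C with h in Hd by ring.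
  replace (l * h)%C with (h * l)%C by ring; exact Hd.
Qed.

Lemma holo_mult (f g : C -> C) (z : C) :
  holo f z -> holo g z -> holo (fun w => f w * g w)%C z.
Proof.
  intros [l Hl] [m Hm]; eexists.
  apply (is_derive_mult (K := C_AbsRing) f g z l m Hl Hm); intros; apply Cmult_comm.
Qed.

Lemma holo_plus (f g : C -> C) (z : C) :
  holo f z -> holo g z -> holo (fun w => f w + g w)%C z.
Proof.
  intros [l Hl] [m Hm]; eexists.
  apply (is_derive_plus (V := AbsRing_NormedModule C_AbsRing) f g z l m Hl Hm).
Qed.

Lemma holo_const (c z : C) : holo (fun _ => c) z.
Proof. eexists; apply (is_derive_const (K := C_AbsRing) (V := AbsRing_NormedModule C_AbsRing)). Qed.

Lemma holo_id (z : C) : holo (fun w => w) z.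
Proof. eexists; apply (is_derive_id (K := C_AbsRing)). Qed.

Lemma holo_comp (f g : C -> C) (z : C) :
  holo f (g z) -> holo g z -> holo (fun w => f (g w)) z.
Proof.
  intros [l Hl] [m Hm]; eexists.
  apply (is_derive_comp (V := AbsRing_NormedModule C_AbsRing) f g z l m Hl Hm).
Qed.

Lemma is_derive_Cinv (z : C) : z <> 0%C ->
  is_derive (K := C_AbsRing) (V := AbsRing_NormedModule C_AbsRing) Cinv z (- / (z * z))%C.
Proof.
  intros Hz; apply is_derive_C_intro; intros eps.
  assert (P : 0 < Cmod z) by (apply Cmod_gt_0; exact Hz).
  (* The first bound keeps |z + h| at least |z| / 2. The remainder h^2 / (z^2 (z + h)) is then at
     most 2 |h|^2 / |z|^3, which explains the second. *)
  assert (Pd : 0 < Rmin (Cmod z / 2) (eps * Cmod z ^ 3 / 2)).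
  { apply Rmin_pos; [lra|].
    apply Rdiv_lt_0_compat; [apply Rmult_lt_0_compat;
      [apply cond_pos|apply pow_lt; exact P]|lra]. }
  exists (mkposreal _ Pd); intros h Hh; simpl in Hh.
  assert (H1 : Cmod h < Cmod z / 2) by (eapply Rlt_le_trans; [exact Hh|apply Rmin_l]).
  assert (H2 : Cmod h < eps * Cmod z ^ 3 / 2) by (eapply Rlt_le_trans; [exact Hh|apply Rmin_r]).
  assert (H3 : Cmod z / 2 <= Cmod (z + h)%C).
  { generalize (Cmod_triangle (z + h)%C (- h)%C).
    replace (z + h + - h)%C with z by ring; rewrite Cmod_opp; lra. }
  assert (N : (z + h)%C <> 0%C) by (apply Cmod_gt_0; lra).
  replace (/ (z + h) - / z - - / (z * z) * h)%C with (h * h / (z * z * (z + h)))%C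
    by (field; auto).
  assert (N2 : (z * z * (z + h))%C <> 0%C) by (repeat apply Cmult_neq_0; auto).
  rewrite Cmod_div by exact N2.
  rewrite !Cmod_mult.
  assert (Pm : 0 < Cmod z * Cmod z * Cmod (z + h)%C) by (repeat apply Rmult_lt_0_compat; lra).
  apply Rmult_le_reg_r with (Cmod z * Cmod z * Cmod (z + h)%C); [exact Pm|].
  unfold Rdiv; rewrite Rmult_assoc, Rinv_l, Rmult_1_r by lra.
  assert (Q : Cmod z ^ 3 / 2 <= Cmod z * Cmod z * Cmod (z + h)%C).
  { replace (Cmod z ^ 3 / 2) with (Cmod z * Cmod z * (Cmod z / 2)) by field.
    apply Rmult_le_compat_l; [nra|lra]. }
  generalize (Cmod_ge_0 h) (cond_pos eps); intros Hh0 He.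
  rewrite (Rmult_comm eps), Rmult_assoc; apply Rmult_le_compat_l; [exact Hh0|].
  apply Rlt_le, Rlt_le_trans with (1 := H2).
  unfold Rdiv in *; rewrite Rmult_assoc; apply Rmult_le_compat_l; lra.
Qed.

Lemma holo_inv_id (z : C) : z <> 0%C -> holo Cinv z.
Proof. intros Hz; exists (- / (z * z))%C; apply is_derive_Cinv, Hz. Qed.

Lemma holo_inv (f : C -> C) (z : C) :
  f z <> 0%C -> holo f z -> holo (fun w => / f w)%C z.
Proof. intros N H; apply (holo_comp Cinv f); [apply holo_inv_id; exact N|exact H]. Qed.

Lemma ball_C_Cmod (z w : C) (eps : posreal) : Cmod (w - z)%C < eps -> ball z eps w.
Proof. exact (C_NormedModule_mixin_compat1 z w eps). Qed.

(** Balls of the product space [C] are squares of the sup norm; passing to the modulus costs a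
    factor sqrt 2, rounded up to 2. *)
Lemma Cmod_lt_of_ball (z w : C) (eps : posreal) : ball z eps w -> Cmod (w - z)%C < 2 * eps.
Proof.
  intros H; eapply Rlt_le_trans; [exact (C_NormedModule_mixin_compat2 z w eps H)|].
  apply Rmult_le_compat_r; [apply Rlt_le, cond_pos|].
  apply Rsqr_incr_0_var; [rewrite Rsqr_sqrt; unfold Rsqr; lra|lra].
Qed.

Lemma holo_continuous (f : C -> C) (z : C) : holo f z -> continuous (T := C_UniformSpace) (U := C_UniformSpace) f z.
Proof.
  intros H; destruct (holo_elim f z H) as [l Hl].
  destruct (Hl (mkposreal 1 Rlt_0_1)) as [d Hd]; simpl in Hd.
  apply filterlim_locally; intros eps.
  assert (Pl : 0 < Cmod l + 1) by (generalize (Cmod_ge_0 l); lra).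
  assert (Pd : 0 < Rmin d (eps / (Cmod l + 1)) / 2).
  { apply Rdiv_lt_0_compat; [|lra]; apply Rmin_pos; [apply cond_pos|].
    apply Rdiv_lt_0_compat; [apply cond_pos|exact Pl]. }
  exists (mkposreal _ Pd); intros y Hy; apply Cmod_lt_of_ball in Hy; simpl in Hy.
  apply ball_C_Cmod.
  change C in y.
  assert (Hy1 : Cmod (y - z)%C < d) by (generalize (Rmin_l d (eps / (Cmod l + 1))); lra).
  assert (Hy2 : Cmod (y - z)%C < eps / (Cmod l + 1)) by (generalize (Rmin_r d (eps / (Cmod l + 1))); lra).
  specialize (Hd _ Hy1).
  replace (z + (y - z))%C with y in Hd by ring.
  apply Rle_lt_trans with ((Cmod l + 1) * Cmod (y - z)%C).
  - replace (f y - f z)%C with ((f y - f z - l * (y - z)) + l * (y - z))%C by ring.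
    eapply Rle_trans; [apply Cmod_triangle|]; rewrite (Cmod_mult l); lra.
  - apply Rmult_lt_reg_r with (/ (Cmod l + 1)); [apply Rinv_0_lt_compat; exact Pl|].
    rewrite Rmult_comm, <- Rmult_assoc, Rinv_l, Rmult_1_l by lra; exact Hy2.
Qed.

Lemma continuous_C_of_comp {U : UniformSpace} (f : U -> C) (x : U) :
  continuous (fun y => Re (f y)) x -> continuous (fun y => Im (f y)) x -> continuous f x.
Proof.
  intros H1 H2.
  apply filterlim_locally; intros eps.
  generalize (proj1 (filterlim_locally _ _) H1 eps) (proj1 (filterlim_locally _ _) H2 eps).
  intros A B; generalize (filter_and _ _ A B); apply filter_imp.
  intros y [Ya Yb]; split; assumption.
Qed.

Lemma continuous_Re {U : UniformSpace} (f : U -> C) (x : U) :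
  continuous f x -> continuous (fun y => Re (f y)) x.
Proof. intros H; apply (continuous_comp f Re); [exact H|apply continuous_fst]. Qed.

Lemma continuous_Im {U : UniformSpace} (f : U -> C) (x : U) :
  continuous f x -> continuous (fun y => Im (f y)) x.
Proof. intros H; apply (continuous_comp f Im); [exact H|apply continuous_snd]. Qed.

Lemma continuous_Cplus {U : UniformSpace} (f g : U -> C) (x : U) :
  continuous f x -> continuous g x -> continuous (fun y => f y + g y)%C x.
Proof. exact (continuous_plus (V := C_R_NormedModule) f g x). Qed.

Lemma continuous_Cmult {U : UniformSpace} (f g : U -> C) (x : U) :
  continuous f x -> continuous g x -> continuous (fun y => f y * g y)%C x.
Proof.
  intros Hf Hg; apply continuous_C_of_comp.
  - apply (continuous_minus (V := R_NormedModule) (fun y => Re (f y) * Re (g y)) (fun y => Im (f y) * Im (g y)));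
    apply (continuous_mult (K := R_AbsRing)); first [apply continuous_Re | apply continuous_Im]; assumption.
  - apply (continuous_plus (V := R_NormedModule) (fun y => Re (f y) * Im (g y)) (fun y => Im (f y) * Re (g y)));
    apply (continuous_mult (K := R_AbsRing)); first [apply continuous_Re | apply continuous_Im]; assumption.
Qed.

(** * Integrals of complex-valued functions on a real interval *)

Definition CInt (f : R -> C) (a b : R) : C :=
  RInt (V := C_R_CompleteNormedModule) f a b.

Definition CIntegrable (f : R -> C) (a b : R) : Prop :=
  ex_RInt (V := C_R_NormedModule) f a b.

Lemma CIntegrable_continuous (f : R -> C) (a b : R) :
  (forall x, Rmin a b <= x <= Rmax a b -> continuous f x) -> CIntegrable f a b.
Proof. exact (ex_RInt_continuous (V := C_R_CompleteNormedModule) f a b). Qed.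

Lemma CInt_correct (f : R -> C) (a b : R) : CIntegrable f a b ->
  is_RInt (V := C_R_NormedModule) f a b (CInt f a b).
Proof. exact (RInt_correct (V := C_R_CompleteNormedModule) f a b). Qed.

Lemma CInt_unique (f : R -> C) (a b : R) (l : C) :
  is_RInt (V := C_R_NormedModule) f a b l -> CInt f a b = l.
Proof. exact (is_RInt_unique (V := C_R_CompleteNormedModule) f a b l). Qed.

Lemma CIntegrable_of (f : R -> C) (a b : R) (l : C) :
  is_RInt (V := C_R_NormedModule) f a b l -> CIntegrable f a b.
Proof. intros H; exists l; exact H. Qed.

Lemma CInt_ext (f g : R -> C) (a b : R) :
  (forall x, Rmin a b <= x <= Rmax a b -> f x = g x) -> CInt f a b = CInt g a b.
Proof. intros H; apply (RInt_ext (V := C_R_CompleteNormedModule)); intros x Hx; apply H; lra. Qed.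

(** The integral takes values in a normed module over the reals, where linearity covers real
    scalars; a complex factor is moved out through the components. *)
Lemma is_RInt_Cmult (c : C) (f : R -> C) (a b : R) (l : C) :
  is_RInt (V := C_R_NormedModule) f a b l ->
  is_RInt (V := C_R_NormedModule) (fun x => c * f x)%C a b (c * l)%C.
Proof.
  intros H.
  assert (H1 := is_RInt_fct_extend_fst (U := R_NormedModule) (V := R_NormedModule) f a b l H).
  assert (H2 := is_RInt_fct_extend_snd (U := R_NormedModule) (V := R_NormedModule) f a b l H).
  apply (is_RInt_fct_extend_pair (U := R_NormedModule) (V := R_NormedModule)); simpl.
  - apply (is_RInt_minus (V := R_NormedModule)); apply (is_RInt_scal (V := R_NormedModule)); assumption.
  - apply (is_RInt_plus (V := R_NormedModule)); apply (is_RInt_scal (V := R_NormedModule)); assumption.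
Qed.

Lemma CIntegrable_Cmult (c : C) (f : R -> C) (a b : R) :
  CIntegrable f a b -> CIntegrable (fun x => c * f x)%C a b.
Proof. intros [l H]; exists (c * l)%C; apply is_RInt_Cmult, H. Qed.

Lemma CInt_Cmult (c : C) (f : R -> C) (a b : R) : CIntegrable f a b ->
  CInt (fun x => c * f x)%C a b = (c * CInt f a b)%C.
Proof. intros H; apply CInt_unique, is_RInt_Cmult, CInt_correct, H. Qed.

Lemma CIntegrable_plus (f g : R -> C) (a b : R) : CIntegrable f a b -> CIntegrable g a b ->
  CIntegrable (fun x => f x + g x)%C a b.
Proof. exact (ex_RInt_plus (V := C_R_NormedModule) f g a b). Qed.

Lemma CInt_plus (f g : R -> C) (a b : R) : CIntegrable f a b -> CIntegrable g a b ->
  CInt (fun x => f x + g x)%C a b = (CInt f a b + CInt g a b)%C.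
Proof. exact (RInt_plus (V := C_R_CompleteNormedModule) f g a b). Qed.

Lemma CIntegrable_minus (f g : R -> C) (a b : R) : CIntegrable f a b -> CIntegrable g a b ->
  CIntegrable (fun x => f x - g x)%C a b.
Proof. exact (ex_RInt_minus (V := C_R_NormedModule) f g a b). Qed.

Lemma CInt_minus (f g : R -> C) (a b : R) : CIntegrable f a b -> CIntegrable g a b ->
  CInt (fun x => f x - g x)%C a b = (CInt f a b - CInt g a b)%C.
Proof. exact (RInt_minus (V := C_R_CompleteNormedModule) f g a b). Qed.

Lemma CInt_Chasles (f : R -> C) (a b c : R) : CIntegrable f a b -> CIntegrable f b c ->
  (CInt f a b + CInt f b c)%C = CInt f a c.
Proof. exact (RInt_Chasles (V := C_R_CompleteNormedModule) f a b c). Qed.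

Lemma CInt_const (c : C) (a b : R) : CInt (fun _ => c) a b = (RtoC (b - a) * c)%C.
Proof.
  unfold CInt; rewrite (RInt_const (V := C_R_CompleteNormedModule)).
  apply (scal_R_Cmult (b - a) c).
Qed.

Lemma CInt_shift (f : R -> C) (v a b : R) : CIntegrable f (a + v) (b + v) ->
  CInt (fun x => f (x + v)) a b = CInt f (a + v) (b + v).
Proof.
  intros H; apply CInt_unique.
  apply (is_RInt_ext (V := C_R_NormedModule) (fun y => scal 1 (f (1 * y + v)))).
  { intros x _; rewrite (scal_one (V := C_R_NormedModule)), Rmult_1_l; reflexivity. }
  apply (is_RInt_comp_lin (V := C_R_NormedModule)).
  rewrite !Rmult_1_l; apply CInt_correct, H.
Qed.

Lemma Cmod_CInt_le (f : R -> C) (g : R -> R) (a b : R) : a <= b ->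
  (forall x, a <= x <= b -> Cmod (f x) <= g x) -> CIntegrable f a b -> ex_RInt g a b ->
  Cmod (CInt f a b) <= RInt g a b.
Proof.
  intros ab H F G; rewrite Cmod_norm.
  apply (norm_RInt_le (V := C_R_NormedModule) f g a b); [exact ab| |apply CInt_correct, F|apply (RInt_correct (V := R_CompleteNormedModule)), G].
  intros x Hx; generalize (H x Hx); rewrite Cmod_norm; exact (fun h => h).
Qed.

Lemma Cmod_CInt_le_const (f : R -> C) (a b M : R) : a <= b ->
  (forall x, a <= x <= b -> Cmod (f x) <= M) -> CIntegrable f a b ->
  Cmod (CInt f a b) <= (b - a) * M.
Proof.
  intros ab H F.
  replace ((b - a) * M) with (RInt (fun _ => M) a b) by
    (rewrite RInt_const; reflexivity).
  apply Cmod_CInt_le; auto; apply ex_RInt_const.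
Qed.

Lemma is_derive_C_of_comp (f : R -> C) (x : R) (l : C) :
  is_derive (fun t => Re (f t)) x (Re l) -> is_derive (fun t => Im (f t)) x (Im l) ->
  is_derive (K := R_AbsRing) (V := C_R_NormedModule) f x l.
Proof.
  intros [_ H1] [_ H2]; split; [apply is_linear_scal_l|].
  intros y Hy eps.
  assert (E0 : x = y) by exact (is_filter_lim_locally_unique (V := R_NormedModule) x y Hy).
  subst y.
  assert (e2 : 0 < eps / 2) by (generalize (cond_pos eps); lra).
  generalize (filter_and _ _ (H1 x (fun P HP => HP) (mkposreal _ e2))
    (H2 x (fun P HP => HP) (mkposreal _ e2))).
  apply filter_imp; intros y [A B].
  set (d := y - x) in *.
  change (Rabs (Re (f y) - Re (f x) - d * Re l) <= eps / 2 * Rabs d) in A.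
  change (Rabs (Im (f y) - Im (f x) - d * Im l) <= eps / 2 * Rabs d) in B.
  change (sqrt (Rabs (Re (f y) - Re (f x) - d * Re l) ^ 2
     + Rabs (Im (f y) - Im (f x) - d * Im l) ^ 2) <= eps * Rabs d).
  generalize (Rabs_pos (Re (f y) - Re (f x) - d * Re l))
    (Rabs_pos (Im (f y) - Im (f x) - d * Im l)) (Rabs_pos d) (cond_pos eps).
  intros; apply Rsqr_incr_0_var; [|nra].
  rewrite Rsqr_sqrt by nra; unfold Rsqr.
  assert (forall u v : R, 0 <= u -> u <= v -> u ^ 2 <= v * v) by (intros; nra).
  apply Rle_trans with (eps / 2 * Rabs d * (eps / 2 * Rabs d) + eps / 2 * Rabs d * (eps / 2 * Rabs d)); [|nra].
  apply Rplus_le_compat; auto.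
Qed.

Lemma CInt_derive (F f : R -> C) (a b : R) :
  (forall x, Rmin a b <= x <= Rmax a b ->
     is_derive (K := R_AbsRing) (V := C_R_NormedModule) F x (f x)) ->
  (forall x, Rmin a b <= x <= Rmax a b -> continuous f x) ->
  CInt f a b = (F b - F a)%C.
Proof.
  intros H1 H2; apply CInt_unique.
  apply (is_RInt_derive (V := C_R_CompleteNormedModule) F f a b H1 H2).
Qed.

(** * The complex exponential *)

Lemma exp_le (x y : R) : x <= y -> exp x <= exp y.
Proof. intros [H|H]; [left; apply exp_increasing, H|right; rewrite H; reflexivity]. Qed.

Definition Cexp (w : C) : C := (exp (fst w) * cos (snd w), exp (fst w) * sin (snd w)).

Lemma Cexp_plus (z w : C) : Cexp (z + w)%C = (Cexp z * Cexp w)%C.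
Proof.
  destruct z as [a b], w as [c d]; unfold Cexp, Cplus, Cmult; simpl.
  rewrite exp_plus, cos_plus, sin_plus; f_equal; ring.
Qed.

Lemma Cexp_0 : Cexp 0 = 1%C.
Proof. unfold Cexp; simpl; rewrite exp_0, cos_0, sin_0; unfold RtoC; f_equal; ring. Qed.

Lemma Cexp_opp_r (z : C) : (Cexp z * Cexp (- z))%C = 1%C.
Proof. rewrite <- Cexp_plus, Cplus_opp_r; apply Cexp_0. Qed.

Lemma Cexp_neq_0 (z : C) : Cexp z <> 0%C.
Proof.
  intros E; generalize (Cexp_opp_r z); rewrite E, Cmult_0_l.
  intros H; apply C1_nz; symmetry; exact H.
Qed.

Lemma Cmod_Cexp (z : C) : Cmod (Cexp z) = exp (fst z).
Proof.
  unfold Cmod, Cexp; simpl fst; simpl snd.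
  replace ((exp (fst z) * cos (snd z)) ^ 2 + (exp (fst z) * sin (snd z)) ^ 2)
    with (Rsqr (exp (fst z))).
  - apply sqrt_Rsqr, Rlt_le, exp_pos.
  - generalize (sin2_cos2 (snd z)); unfold Rsqr; intros H.
    transitivity (exp (fst z) * exp (fst z) * (sin (snd z) * sin (snd z) + cos (snd z) * cos (snd z)));
    [rewrite H|]; ring.
Qed.

Lemma Cexp_pow (z : C) (n : nat) : (Cexp z ^ n)%C = Cexp (RtoC (INR n) * z)%C.
Proof.
  induction n as [|n IH].
  - simpl Cpow; simpl INR; rewrite Cmult_0_l, Cexp_0; reflexivity.
  - rewrite Cpow_S, IH, <- Cexp_plus, S_INR, RtoC_plus; f_equal; ring.
Qed.

Lemma Re_le_Cmod (z : C) : fst z <= Cmod z.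
Proof. eapply Rle_trans; [apply Rle_abs|exact (re_le_Cmod z)]. Qed.

Lemma is_derive_Cexp_line (z : C) (s : R) :
  is_derive (K := R_AbsRing) (V := C_R_NormedModule)
    (fun t : R => Cexp (RtoC t * z)%C) s (z * Cexp (RtoC s * z))%C.
Proof.
  destruct z as [a b].
  apply is_derive_C_of_comp; unfold Re, Im, Cexp, Cmult, RtoC; simpl; auto_derive; auto; ring_simplify.
  all: unfold Rminus; ring.
Qed.

Lemma continuous_Cexp (w : C) : continuous (T := C_UniformSpace) (U := C_UniformSpace) Cexp w.
Proof.
  apply continuous_C_of_comp; unfold Cexp, Re, Im; simpl.
  - apply (continuous_mult (K := R_AbsRing) (fun y : C => exp (fst y)) (fun y : C => cos (snd y))).
    + apply (continuous_comp (fun y : C => fst y) exp); [apply continuous_fst|apply continuous_exp].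
    + apply (continuous_comp (fun y : C => snd y) cos); [apply continuous_snd|apply continuous_cos].
  - apply (continuous_mult (K := R_AbsRing) (fun y : C => exp (fst y)) (fun y : C => sin (snd y))).
    + apply (continuous_comp (fun y : C => fst y) exp); [apply continuous_fst|apply continuous_exp].
    + apply (continuous_comp (fun y : C => snd y) sin); [apply continuous_snd|apply continuous_sin].
Qed.

Lemma continuous_RtoC {U : UniformSpace} (f : U -> R) (x : U) :
  continuous f x -> continuous (fun y => RtoC (f y)) x.
Proof. intros H; apply continuous_C_of_comp; [exact H|apply continuous_const]. Qed.

Lemma continuous_Cexp_comp {U : UniformSpace} (f : U -> C) (x : U) :
  continuous f x -> continuous (fun y => Cexp (f y)) x.
Proof. intros H; apply (continuous_comp f Cexp); [exact H|apply continuous_Cexp]. Qed.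

Lemma continuous_Cexp_line (z : C) (s : R) : continuous (fun t : R => Cexp (RtoC t * z)%C) s.
Proof.
  apply continuous_Cexp_comp, continuous_Cmult; [|apply continuous_const].
  apply continuous_RtoC, continuous_id.
Qed.

(** The difference is the integral of z e^(tz) over 0 <= t <= 1. *)
Lemma Cmod_Cexp_sub_1 (z : C) : Cmod (Cexp z - 1)%C <= Cmod z * exp (Cmod z).
Proof.
  assert (E : CInt (fun t => z * Cexp (RtoC t * z))%C 0 1 = (Cexp z - 1)%C).
  { rewrite (CInt_derive (fun t => Cexp (RtoC t * z)%C)).
    - rewrite Cmult_1_l, Cmult_0_l, Cexp_0; reflexivity.
    - intros; apply is_derive_Cexp_line.
    - intros; apply continuous_Cmult; [apply continuous_const|apply continuous_Cexp_line]. }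
  rewrite <- E.
  replace (Cmod z * exp (Cmod z)) with ((1 - 0) * (Cmod z * exp (Cmod z))) by ring.
  apply Cmod_CInt_le_const; [lra| |].
  - intros x Hx; rewrite Cmod_mult, Cmod_Cexp.
    apply Rmult_le_compat_l; [apply Cmod_ge_0|].
    apply exp_le; eapply Rle_trans; [apply Re_le_Cmod|].
    rewrite Cmod_mult, Cmod_R, Rabs_pos_eq by lra.
    generalize (Cmod_ge_0 z); nra.
  - apply CIntegrable_continuous; intros.
    apply continuous_Cmult; [apply continuous_const|apply continuous_Cexp_line].
Qed.

(** The same integral with z subtracted from the integrand; the first-order bound then applies under
    the integral. *)
Lemma Cmod_Cexp_sub_1_sub (z : C) : Cmod (Cexp z - 1 - z)%C <= Cmod z ^ 2 * exp (Cmod z).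
Proof.
  assert (K : forall s, continuous (fun t : R => z * Cexp (RtoC t * z))%C s).
  { intros; apply continuous_Cmult; [apply continuous_const|apply continuous_Cexp_line]. }
  assert (E : CInt (fun t => z * Cexp (RtoC t * z) - z)%C 0 1 = (Cexp z - 1 - z)%C).
  { rewrite CInt_minus, CInt_const, (CInt_derive (fun t => Cexp (RtoC t * z)%C)).
    - rewrite Cmult_1_l, Cmult_0_l, Cexp_0, Rminus_0_r; ring.
    - intros; apply is_derive_Cexp_line.
    - intros; apply K.
    - apply CIntegrable_continuous; intros; apply K.
    - apply CIntegrable_continuous; intros; apply continuous_const. }
  rewrite <- E.
  replace (Cmod z ^ 2 * exp (Cmod z)) with ((1 - 0) * (Cmod z ^ 2 * exp (Cmod z))) by ring.
  apply Cmod_CInt_le_const; [lra| |].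
  - intros x Hx.
    replace (z * Cexp (RtoC x * z) - z)%C with (z * (Cexp (RtoC x * z) - 1))%C by ring.
    rewrite Cmod_mult.
    replace (Cmod z ^ 2 * exp (Cmod z)) with (Cmod z * (Cmod z * exp (Cmod z))) by ring.
    apply Rmult_le_compat_l; [apply Cmod_ge_0|].
    eapply Rle_trans; [apply Cmod_Cexp_sub_1|].
    rewrite Cmod_mult, Cmod_R, Rabs_pos_eq by lra.
    assert (x * Cmod z <= Cmod z) by (generalize (Cmod_ge_0 z); nra).
    apply Rmult_le_compat; auto.
    + generalize (Cmod_ge_0 z); nra.
    + apply Rlt_le, exp_pos.
    + apply exp_le; assumption.
  - apply CIntegrable_minus; apply CIntegrable_continuous; intros; [apply K|apply continuous_const].
Qed.

Lemma is_derive_Cexp (z : C) :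
  is_derive (K := C_AbsRing) (V := AbsRing_NormedModule C_AbsRing) Cexp z (Cexp z).
Proof.
  apply is_derive_C_intro; intros eps.
  assert (P : 0 < Cmod (Cexp z) * exp 1) by (rewrite Cmod_Cexp; apply Rmult_lt_0_compat; apply exp_pos).
  assert (Pd : 0 < Rmin 1 (eps / (Cmod (Cexp z) * exp 1))).
  { apply Rmin_pos; [lra|]; apply Rdiv_lt_0_compat; [apply cond_pos|exact P]. }
  exists (mkposreal _ Pd); intros h Hh; simpl in Hh.
  assert (H1 : Cmod h < 1) by (eapply Rlt_le_trans; [exact Hh|apply Rmin_l]).
  assert (H2 : Cmod h < eps / (Cmod (Cexp z) * exp 1)) by (eapply Rlt_le_trans; [exact Hh|apply Rmin_r]).
  rewrite Cexp_plus.
  replace (Cexp z * Cexp h - Cexp z - Cexp z * h)%C with (Cexp z * (Cexp h - 1 - h))%C by ring.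
  rewrite Cmod_mult.
  apply Rle_trans with (Cmod (Cexp z) * (Cmod h ^ 2 * exp 1)).
  - apply Rmult_le_compat_l; [apply Cmod_ge_0|].
    eapply Rle_trans; [apply Cmod_Cexp_sub_1_sub|].
    apply Rmult_le_compat_l; [apply pow2_ge_0|apply exp_le; lra].
  - replace (Cmod (Cexp z) * (Cmod h ^ 2 * exp 1)) with (Cmod h * (Cmod (Cexp z) * exp 1) * Cmod h) by ring.
    apply Rmult_le_compat_r; [apply Cmod_ge_0|].
    apply Rlt_le, Rmult_lt_reg_r with (/ (Cmod (Cexp z) * exp 1)); [apply Rinv_0_lt_compat, P|].
    rewrite Rmult_assoc, Rinv_r, Rmult_1_r by lra; exact H2.
Qed.

Lemma holo_Cexp_id (z : C) : holo Cexp z.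
Proof. exists (Cexp z); apply is_derive_Cexp. Qed.

Lemma holo_Cexp (f : C -> C) (z : C) : holo f z -> holo (fun w => Cexp (f w)) z.
Proof. intros H; apply (holo_comp Cexp f); [apply holo_Cexp_id|exact H]. Qed.

(** * Goursat's theorem on rectangles *)

Lemma Cmod_le_abs (z : C) : Cmod z <= Rabs (fst z) + Rabs (snd z).
Proof.
  generalize (Rabs_pos (fst z)) (Rabs_pos (snd z)); intros P Q.
  apply Rsqr_incr_0_var; [|lra].
  unfold Cmod; rewrite Rsqr_sqrt by nra.
  rewrite <- (pow2_abs (fst z)), <- (pow2_abs (snd z)); unfold Rsqr; nra.
Qed.

(** Both are integrals in the real parameter: the factor i of the line element dw = i dv on vertical
    sides is kept outside [vint]. *)
Definition hint (N : C -> C) (y a b : R) : C := CInt (fun u => N (u, y)) a b.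
Definition vint (N : C -> C) (x c d : R) : C := CInt (fun v => N (x, v)) c d.

(* Minus the integral of [N] along the counterclockwise boundary of the
   rectangle [[a, b] x [c, d]]. *)
Definition rect_int (N : C -> C) (a b c d : R) : C :=
  (hint N d a b - hint N c a b - Ci * (vint N b c d - vint N a c d))%C.

Definition holo_on_rect (N : C -> C) (a b c d : R) : Prop :=
  forall u v, a <= u <= b -> c <= v <= d -> holo N (u, v).

(** Only integrability on the four sides is recorded, so that a pole in the interior is allowed. *)
Definition cont_on_sides (N : C -> C) (a b c d : R) : Prop :=
  CIntegrable (fun u => N (u, c)) a b /\ CIntegrable (fun u => N (u, d)) a b /\
  CIntegrable (fun v => N (a, v)) c d /\ CIntegrable (fun v => N (b, v)) c d.

Lemma continuous_hline (N : C -> C) (x y : R) :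
  continuous (T := C_UniformSpace) (U := C_UniformSpace) N (x, y) ->
  continuous (fun u => N (u, y) : C) x.
Proof.
  intros H; apply (continuous_comp (fun u : R => (u, y) : C) N); [|exact H].
  apply continuous_C_of_comp; [apply continuous_id|apply continuous_const].
Qed.

Lemma continuous_vline (N : C -> C) (x y : R) :
  continuous (T := C_UniformSpace) (U := C_UniformSpace) N (x, y) ->
  continuous (fun v => N (x, v) : C) y.
Proof.
  intros H; apply (continuous_comp (fun v : R => (x, v) : C) N); [|exact H].
  apply continuous_C_of_comp; [apply continuous_const|apply continuous_id].
Qed.

Lemma CIntegrable_hline (N : C -> C) (y a b : R) : a <= b ->
  (forall u, a <= u <= b -> holo N (u, y)) -> CIntegrable (fun u => N (u, y)) a b.
Proof.
  intros ab H; apply CIntegrable_continuous; intros x Hx.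
  rewrite Rmin_left, Rmax_right in Hx by exact ab.
  apply continuous_hline, holo_continuous, H, Hx.
Qed.

Lemma CIntegrable_vline (N : C -> C) (x c d : R) : c <= d ->
  (forall v, c <= v <= d -> holo N (x, v)) -> CIntegrable (fun v => N (x, v)) c d.
Proof.
  intros cd H; apply CIntegrable_continuous; intros y Hy.
  rewrite Rmin_left, Rmax_right in Hy by exact cd.
  apply continuous_vline, holo_continuous, H, Hy.
Qed.

Lemma holo_cont_on_sides (N : C -> C) (a b c d : R) : a <= b -> c <= d ->
  holo_on_rect N a b c d -> cont_on_sides N a b c d.
Proof.
  intros ab cd H; split; [|split; [|split]];
  [apply (CIntegrable_hline N)|apply (CIntegrable_hline N)
  |apply (CIntegrable_vline N)|apply (CIntegrable_vline N)];
  try assumption; intros; apply H; lra.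
Qed.

Lemma rect_int_split_h (N : C -> C) (a m b c d : R) :
  CIntegrable (fun u => N (u, c)) a m -> CIntegrable (fun u => N (u, c)) m b ->
  CIntegrable (fun u => N (u, d)) a m -> CIntegrable (fun u => N (u, d)) m b ->
  rect_int N a b c d = (rect_int N a m c d + rect_int N m b c d)%C.
Proof.
  intros H1 H2 H3 H4; unfold rect_int, hint.
  rewrite <- (CInt_Chasles _ a m b H1 H2), <- (CInt_Chasles _ a m b H3 H4); ring.
Qed.

Lemma rect_int_split_v (N : C -> C) (a b c m d : R) :
  CIntegrable (fun v => N (a, v)) c m -> CIntegrable (fun v => N (a, v)) m d ->
  CIntegrable (fun v => N (b, v)) c m -> CIntegrable (fun v => N (b, v)) m d ->
  rect_int N a b c d = (rect_int N a b c m + rect_int N a b m d)%C.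
Proof.
  intros H1 H2 H3 H4; unfold rect_int, vint.
  rewrite <- (CInt_Chasles _ c m d H1 H2), <- (CInt_Chasles _ c m d H3 H4); ring.
Qed.

Lemma rect_int_plus (N M : C -> C) (a b c d : R) :
  cont_on_sides N a b c d -> cont_on_sides M a b c d ->
  rect_int (fun w => N w + M w)%C a b c d = (rect_int N a b c d + rect_int M a b c d)%C.
Proof.
  intros (N1 & N2 & N3 & N4) (M1 & M2 & M3 & M4); unfold rect_int, hint, vint.
  rewrite !CInt_plus by assumption; ring.
Qed.

Lemma Cmod_rect_int_le (N : C -> C) (a b c d M : R) : a <= b -> c <= d ->
  cont_on_sides N a b c d ->
  (forall u v, a <= u <= b -> c <= v <= d -> (v = c \/ v = d \/ u = a \/ u = b) -> Cmod (N (u, v)) <= M) ->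
  Cmod (rect_int N a b c d) <= 2 * ((b - a) + (d - c)) * M.
Proof.
  intros ab cd (N1 & N2 & N3 & N4) H; unfold rect_int.
  assert (A1 : Cmod (hint N d a b) <= (b - a) * M).
  { apply Cmod_CInt_le_const; auto; intros; apply H; auto; lra. }
  assert (A2 : Cmod (hint N c a b) <= (b - a) * M).
  { apply Cmod_CInt_le_const; auto; intros; apply H; auto; lra. }
  assert (A3 : Cmod (vint N b c d) <= (d - c) * M).
  { apply Cmod_CInt_le_const; auto; intros; apply H; auto; lra. }
  assert (A4 : Cmod (vint N a c d) <= (d - c) * M).
  { apply Cmod_CInt_le_const; auto; intros; apply H; auto; lra. }
  unfold Cminus.
  eapply Rle_trans; [apply Cmod_triangle|].
  rewrite Cmod_opp, Cmod_mult, Cmod_Ci, Rmult_1_l.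
  generalize (Cmod_triangle (hint N d a b) (- hint N c a b)%C)
    (Cmod_triangle (vint N b c d) (- vint N a c d)%C).
  rewrite !Cmod_opp; lra.
Qed.

(** Values on opposite sides differ by the constants q i (d - c) and q (b - a), whose contributions
    cancel. In Goursat's argument this removes the first-order Taylor polynomial. *)
Lemma rect_int_affine (p q : C) (a b c d : R) :
  rect_int (fun w => p + q * w)%C a b c d = 0%C.
Proof.
  assert (K : forall f : R -> C, (forall x, continuous f x) -> forall x y, CIntegrable f x y).
  { intros f Hf x y; apply CIntegrable_continuous; intros; apply Hf. }
  assert (Kh : forall y x, continuous (fun u : R => p + q * (u, y))%C x).
  { intros; apply (continuous_hline (fun w => p + q * w)%C), holo_continuous.
    apply holo_plus; [apply holo_const|apply holo_mult; [apply holo_const|apply holo_id]]. }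
  assert (Kv : forall y x, continuous (fun u : R => p + q * (y, u))%C x).
  { intros; apply (continuous_vline (fun w => p + q * w)%C), holo_continuous.
    apply holo_plus; [apply holo_const|apply holo_mult; [apply holo_const|apply holo_id]]. }
  unfold rect_int, hint, vint.
  rewrite <- !CInt_minus by (apply K; intros; first [apply Kh|apply Kv]).
  rewrite (CInt_ext _ (fun _ => q * (Ci * RtoC (d - c)))%C).
  2: { intros x _; unfold Cminus, Cplus, Copp, Cmult, Ci, RtoC; simpl.
       destruct q, p; simpl; f_equal; ring. }
  rewrite (CInt_ext (fun x => _ - _)%C (fun _ => q * RtoC (b - a))%C).
  2: { intros x _; unfold Cminus, Cplus, Copp, Cmult, Ci, RtoC; simpl.
       destruct q, p; simpl; f_equal; ring. }
  rewrite !CInt_const; ring.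
Qed.

Definition rect : Type := ((R * R) * (R * R))%type.

Definition rect_obs (N : C -> C) (r : rect) : R :=
  Cmod (rect_int N (fst (fst r)) (snd (fst r)) (fst (snd r)) (snd (snd r))).

(** The integral is the sum of those over the two halves: when the left half falls short of half the
    modulus, the right half reaches it. *)
Definition halve_h (N : C -> C) (r : rect) : rect :=
  let a := fst (fst r) in let b := snd (fst r) in let m := (a + b) / 2 in
  if Rle_dec (rect_obs N r / 2) (rect_obs N ((a, m), snd r)) then ((a, m), snd r) else ((m, b), snd r).

Definition halve_v (N : C -> C) (r : rect) : rect :=
  let a := fst (snd r) in let b := snd (snd r) in let m := (a + b) / 2 in
  if Rle_dec (rect_obs N r / 2) (rect_obs N (fst r, (a, m))) then (fst r, (a, m)) else (fst r, (m, b)).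

(** One round cuts in both directions, so both side lengths halve while the modulus of the integral
    loses at most a factor 4. *)
Fixpoint bisect (N : C -> C) (r : rect) (n : nat) : rect :=
  match n with
  | O => r
  | S n => halve_v N (halve_h N (bisect N r n))
  end.

Definition good_rect (N : C -> C) (r : rect) : Prop :=
  fst (fst r) <= snd (fst r) /\ fst (snd r) <= snd (snd r) /\
  holo_on_rect N (fst (fst r)) (snd (fst r)) (fst (snd r)) (snd (snd r)).

Lemma halve_h_spec (N : C -> C) (r : rect) : good_rect N r ->
  let r' := halve_h N r in
  good_rect N r' /\ snd r' = snd r /\ fst (fst r) <= fst (fst r') /\ snd (fst r') <= snd (fst r) /\
  snd (fst r') - fst (fst r') = (snd (fst r) - fst (fst r)) / 2 /\
  rect_obs N r / 2 <= rect_obs N r'.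
Proof.
  destruct r as [[a b] [c d]]; intros (ab & cd & H); simpl in ab, cd, H.
  unfold halve_h; simpl.
  assert (S : rect_obs N ((a, b), (c, d)) <= rect_obs N ((a, (a + b) / 2), (c, d)) + rect_obs N (((a + b) / 2, b), (c, d))).
  { unfold rect_obs; simpl.
    rewrite (rect_int_split_h N a ((a + b) / 2) b c d);
      [apply Cmod_triangle| | | |]; apply (CIntegrable_hline N); try lra; intros; apply H; lra. }
  destruct Rle_dec as [L|L]; simpl;
    (split; [repeat split; simpl; try lra; intros u v Hu Hv; apply H; lra|]);
    repeat split; lra.
Qed.

Lemma halve_v_spec (N : C -> C) (r : rect) : good_rect N r ->
  let r' := halve_v N r in
  good_rect N r' /\ fst r' = fst r /\ fst (snd r) <= fst (snd r') /\ snd (snd r') <= snd (snd r) /\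
  snd (snd r') - fst (snd r') = (snd (snd r) - fst (snd r)) / 2 /\
  rect_obs N r / 2 <= rect_obs N r'.
Proof.
  destruct r as [[a b] [c d]]; intros (ab & cd & H); simpl in ab, cd, H.
  unfold halve_v; simpl.
  assert (S : rect_obs N ((a, b), (c, d)) <= rect_obs N ((a, b), (c, (c + d) / 2)) + rect_obs N ((a, b), ((c + d) / 2, d))).
  { unfold rect_obs; simpl.
    rewrite (rect_int_split_v N a b c ((c + d) / 2) d);
      [apply Cmod_triangle| | | |]; apply (CIntegrable_vline N); try lra; intros; apply H; lra. }
  destruct Rle_dec as [L|L]; simpl;
    (split; [repeat split; simpl; try lra; intros u v Hu Hv; apply H; lra|]);
    repeat split; lra.
Qed.

Lemma nested_intervals (a b : nat -> R) :
  (forall n, a n <= a (S n)) -> (forall n, b (S n) <= b n) -> (forall n, a n <= b n) ->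
  exists x, forall n, a n <= x <= b n.
Proof.
  intros Ha Hb Hab.
  assert (Ma : forall n k, a n <= a (n + k)%nat).
  { intros n k; induction k as [|k IH]; [rewrite Nat.add_0_r; lra|].
    rewrite Nat.add_succ_r; eapply Rle_trans; [exact IH|apply Ha]. }
  assert (Mb : forall n k, b (n + k)%nat <= b n).
  { intros n k; induction k as [|k IH]; [rewrite Nat.add_0_r; lra|].
    rewrite Nat.add_succ_r; eapply Rle_trans; [apply Hb|exact IH]. }
  assert (U : forall n m, a n <= b m).
  { intros n m; apply Rle_trans with (a (n + m)%nat); [apply Ma|].
    apply Rle_trans with (b (n + m)%nat); [apply Hab|].
    rewrite Nat.add_comm; apply Mb. }
  destruct (completeness (fun x => exists n, x = a n)) as [x [X1 X2]].
  - exists (b O); intros y [n ->]; apply U.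
  - exists (a O); exists O; reflexivity.
  - exists x; intros n; split.
    + apply X1; exists n; reflexivity.
    + apply X2; intros y [m ->]; apply U.
Qed.

(* Goursat's bisection argument. *)
Theorem rect_int_holo (N : C -> C) (a b c d : R) : a <= b -> c <= d ->
  holo_on_rect N a b c d -> rect_int N a b c d = 0%C.
Proof.
  intros ab cd H.
  set (r0 := ((a, b), (c, d)) : rect).
  set (r := bisect N r0).
  assert (G : forall n, good_rect N (r n)).
  { intros n; induction n as [|n IH]; [exact (conj ab (conj cd H))|].
    destruct (halve_h_spec N _ IH) as [G1 _]; destruct (halve_v_spec N _ G1) as [G2 _]; exact G2. }
  assert (St : forall n, fst (fst (r n)) <= fst (fst (r (S n))) /\ snd (fst (r (S n))) <= snd (fst (r n)) /\
     fst (snd (r n)) <= fst (snd (r (S n))) /\ snd (snd (r (S n))) <= snd (snd (r n)) /\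
     snd (fst (r (S n))) - fst (fst (r (S n))) = (snd (fst (r n)) - fst (fst (r n))) / 2 /\
     snd (snd (r (S n))) - fst (snd (r (S n))) = (snd (snd (r n)) - fst (snd (r n))) / 2 /\
     rect_obs N (r n) / 4 <= rect_obs N (r (S n))).
  { intros n; change (r (S n)) with (halve_v N (halve_h N (r n))).
    destruct (halve_h_spec N _ (G n)) as (G1 & E1 & A1 & A2 & A3 & A4).
    destruct (halve_v_spec N _ G1) as (G2 & E2 & B1 & B2 & B3 & B4).
    rewrite E2; rewrite E1 in B1, B2, B3; repeat split; try assumption; lra. }
  destruct (nested_intervals (fun n => fst (fst (r n))) (fun n => snd (fst (r n)))) as [x Hx];
    [intros; apply St|intros; apply St|intros; apply G|].
  destruct (nested_intervals (fun n => fst (snd (r n))) (fun n => snd (snd (r n)))) as [y Hy];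
    [intros; apply St|intros; apply St|intros; apply G|].
  set (s := (b - a) + (d - c)).
  assert (Sz : forall n, snd (fst (r n)) - fst (fst (r n)) + (snd (snd (r n)) - fst (snd (r n))) = s * (/ 2) ^ n).
  { induction n as [|n IH]; [simpl; unfold s; ring|].
    destruct (St n) as (_ & _ & _ & _ & E1 & E2 & _); rewrite E1, E2; simpl.
    replace (s * (/ 2 * (/ 2) ^ n)) with (s * (/ 2) ^ n / 2) by field.
    rewrite <- IH; field. }
  assert (Ob : forall n, rect_obs N r0 * (/ 4) ^ n <= rect_obs N (r n)).
  { induction n as [|n IH]; [change (r O) with r0; rewrite pow_O; lra|].
    destruct (St n) as (_ & _ & _ & _ & _ & _ & E); rewrite <- tech_pow_Rmult.
    eapply Rle_trans; [|exact E]; lra. }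
  assert (Z : Cmod (rect_int N a b c d) <= 0).
  2: { apply Cmod_eq_0; generalize (Cmod_ge_0 (rect_int N a b c d)); lra. }
  apply Rnot_lt_le; intros P; change (0 < rect_obs N r0) in P.
  assert (s0 : 0 <= s) by (unfold s; lra).
  destruct (holo_elim N (x, y)) as [l Hl].
  { apply (G O); [apply (Hx O)|apply (Hy O)]. }
  (* Chosen so that the final bound 2 e s^2 stays strictly below [rect_obs N r0]. *)
  set (e := rect_obs N r0 / (4 * (s ^ 2 + 1))).
  assert (Pe : 0 < e) by (apply Rdiv_lt_0_compat; nra).
  destruct (Hl (mkposreal e Pe)) as [dl Hdl]; simpl in Hdl.
  destruct (pow_lt_1_zero (/ 2)) with (y := dl / (s + 1)) as [n Hn].
  { rewrite Rabs_pos_eq; lra. }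
  { apply Rdiv_lt_0_compat; [apply cond_pos|lra]. }
  specialize (Hn n (le_n n)); rewrite Rabs_pos_eq in Hn by (apply pow_le; lra).
  set (sn := s * (/ 2) ^ n).
  assert (p2 : 0 < (/ 2) ^ n) by (apply pow_lt; lra).
  assert (Hsn : sn < dl).
  { apply Rle_lt_trans with ((s + 1) * (/ 2) ^ n); [unfold sn; nra|].
    apply Rmult_lt_compat_l with (r := s + 1) in Hn; [|lra].
    replace ((s + 1) * (dl / (s + 1))) with (dl : R) in Hn by (field; lra); exact Hn. }
  specialize (Ob n); destruct (G n) as (ab' & cd' & H').
  specialize (Sz n); fold sn in Sz; specialize (Hx n); specialize (Hy n).
  unfold rect_obs at 2 in Ob.
  destruct (r n) as [[a' b'] [c' d']]; simpl in *.
  (* p + l w is the first-order Taylor polynomial at the limit point. Subtracting it leaves the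
     integral unchanged and leaves at most e * sn of [N] on the small rectangle. *)
  set (p := (N (x, y) - l * (x, y))%C).
  assert (D : rect_int N a' b' c' d' = rect_int (fun w => N w + - (p + l * w))%C a' b' c' d').
  { rewrite (rect_int_plus N (fun w => - (p + l * w))%C).
    - replace (rect_int (fun w => - (p + l * w))%C a' b' c' d') with (rect_int (fun w => (- p) + (- l) * w)%C a' b' c' d').
      + rewrite rect_int_affine; ring.
      + unfold rect_int, hint, vint; f_equal; [f_equal|f_equal; f_equal]; apply CInt_ext; intros; ring.
    - apply holo_cont_on_sides; auto.
    - apply holo_cont_on_sides; auto; intros u v _ _.
      apply (holo_comp (fun z => - z)%C (fun w => p + l * w)%C).
      + eexists; apply (is_derive_opp (V := AbsRing_NormedModule C_AbsRing)), (is_derive_id (K := C_AbsRing)).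
      + apply holo_plus; [apply holo_const|apply holo_mult; [apply holo_const|apply holo_id]]. }
  rewrite D in Ob.
  assert (B : Cmod (rect_int (fun w => N w + - (p + l * w))%C a' b' c' d') <= 2 * ((b' - a') + (d' - c')) * (e * sn)).
  { apply Cmod_rect_int_le; auto.
    - apply holo_cont_on_sides; auto; intros u v Hu Hv; apply holo_plus; [apply H'; assumption|].
      apply (holo_comp (fun z => - z)%C (fun w => p + l * w)%C).
      + eexists; apply (is_derive_opp (V := AbsRing_NormedModule C_AbsRing)), (is_derive_id (K := C_AbsRing)).
      + apply holo_plus; [apply holo_const|apply holo_mult; [apply holo_const|apply holo_id]].
    - intros u v Hu Hv _.
      assert (Q : Cmod ((u, v) - (x, y))%C <= sn).
      { eapply Rle_trans; [apply Cmod_le_abs|]; simpl.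
        rewrite <- Sz; apply Rplus_le_compat; apply Rabs_le; lra. }
      specialize (Hdl ((u, v) - (x, y))%C (Rle_lt_trans _ _ _ Q Hsn)).
      assert (Zz : forall z z' : C, (z + (z' - z))%C = z') by (intros; ring); rewrite Zz in Hdl.
      replace (N (u, v) + - (p + l * (u, v)))%C with (N (u, v) - N (x, y) - l * ((u, v) - (x, y)))%C
        by (unfold p; ring).
      eapply Rle_trans; [exact Hdl|]; apply Rmult_le_compat_l; lra. }
  rewrite Sz in B.
  assert (E4 : (/ 4) ^ n = (/ 2) ^ n * (/ 2) ^ n)
    by (rewrite <- Rpow_mult_distr; f_equal; field).
  rewrite E4 in Ob.
  assert (F : rect_obs N r0 * ((/ 2) ^ n * (/ 2) ^ n) <= 2 * e * s ^ 2 * ((/ 2) ^ n * (/ 2) ^ n)).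
  { eapply Rle_trans; [exact Ob|]; eapply Rle_trans; [exact B|]; right; unfold sn; ring. }
  apply Rmult_le_reg_r in F; [|nra].
  assert (E5 : e * (4 * (s ^ 2 + 1)) = rect_obs N r0) by (unfold e; field; nra).
  nra.
Qed.

(** * The residue at the simple pole w = 0 *)

Lemma CInt_RtoC (f : R -> R) (a b l : R) : is_RInt f a b l ->
  is_RInt (V := C_R_NormedModule) (fun x => RtoC (f x)) a b (RtoC l).
Proof.
  intros H; apply (is_RInt_fct_extend_pair (U := R_NormedModule) (V := R_NormedModule)); simpl; [exact H|].
  assert (E := is_RInt_const (V := R_NormedModule) a b 0).
  change (scal (b - a) 0) with ((b - a) * 0) in E; rewrite Rmult_0_r in E; exact E.
Qed.

Lemma is_RInt_atan_square (d : R) : 0 < d ->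
  is_RInt (fun u => 2 * d / (u ^ 2 + d ^ 2)) (- d) d PI.
Proof.
  intros Hd.
  assert (P : forall x : R, 0 < x ^ 2 + d ^ 2) by (intros; nra).
  replace PI with (minus (2 * atan (d / d)) (2 * atan (- d / d))).
  2: { replace (d / d) with 1 by (field; lra); replace (- d / d) with (-1) by (field; lra).
       replace (atan (-1)) with (- atan 1) by (rewrite <- atan_opp; f_equal; lra); rewrite atan_1; change (2 * (PI / 4) - 2 * - (PI / 4) = PI); field. }
  apply (is_RInt_derive (V := R_CompleteNormedModule) (fun u => 2 * atan (u / d))).
  - intros x _; auto_derive; [exact I|]; generalize (P x); intros; field; split; nra.
  - intros x _; apply (ex_derive_continuous (V := R_NormedModule)); auto_derive; generalize (P x); lra.
Qed.

Lemma Cinv_rect (u v : R) : u ^ 2 + v ^ 2 <> 0 ->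
  Cinv (u, v) = (u / (u ^ 2 + v ^ 2), - v / (u ^ 2 + v ^ 2)).
Proof. reflexivity. Qed.

(** Combining opposite sides turns the integrand into 2d / (u^2 + d^2), up to a factor i or -1; each
    pair contributes i PI by the arctangent. The sign is positive because [rect_int] runs clockwise
    and the function is -1/w. *)
Lemma rect_int_inv_square (d : R) : 0 < d ->
  rect_int (fun w => - / w)%C (- d) d (- d) d = (RtoC (2 * PI) * Ci)%C.
Proof.
  intros Hd.
  assert (P : forall x : R, 0 < x ^ 2 + d ^ 2) by (intros; nra).
  assert (Nz : forall u v : R, u <> 0 \/ v <> 0 -> ((u, v) : C) <> 0%C).
  { intros u v [H|H] E; injection E; intros; contradiction. }
  assert (Hl : forall u v, u <> 0 \/ v <> 0 -> holo (fun w => - / w)%C (u, v)).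
  { intros u v H; apply (holo_comp (fun z => - z)%C Cinv); [|apply holo_inv_id, Nz, H].
    eexists; apply (is_derive_opp (V := AbsRing_NormedModule C_AbsRing)), (is_derive_id (K := C_AbsRing)). }
  unfold rect_int, hint, vint.
  rewrite <- !CInt_minus.
  2-3: apply (CIntegrable_vline (fun w => - / w)%C); [lra|intros; apply Hl; left; lra].
  2-3: apply (CIntegrable_hline (fun w => - / w)%C); [lra|intros; apply Hl; right; lra].
  assert (E := CInt_RtoC _ _ _ _ (is_RInt_atan_square d Hd)).
  assert (Ex := CIntegrable_of _ _ _ _ E); apply CInt_unique in E.
  rewrite (CInt_ext _ (fun u => Ci * RtoC (2 * d / (u ^ 2 + d ^ 2)))%C).
  2: { intros x _; rewrite !Cinv_rect by (generalize (P x); nra).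
       unfold Ci, RtoC, Cminus, Cplus, Cmult, Copp; simpl; generalize (P x); intros; f_equal; field; repeat split; nra. }
  rewrite (CInt_ext (fun v => _ - _)%C (fun u => -(1) * RtoC (2 * d / (u ^ 2 + d ^ 2)))%C).
  2: { intros x _; rewrite !Cinv_rect by (generalize (P x); nra).
       unfold Ci, RtoC, Cminus, Cplus, Cmult, Copp; simpl; generalize (P x); intros; f_equal; field; repeat split; nra. }
  rewrite !CInt_Cmult by exact Ex; rewrite E, RtoC_mult; ring.
Qed.

(** From cos v = 1 follows sin (v/2) = 0, which is impossible for 0 < |v/2| < PI/2. So the origin is
    the only zero of e^w - 1 in the strip that contains all contours. *)
Lemma Cexp_neq_1 (u v : R) : Rabs v < PI -> u <> 0 \/ v <> 0 -> Cexp (u, v) <> 1%C.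
Proof.
  intros Hv H E.
  assert (E1 : exp u = 1).
  { rewrite <- Cmod_1, <- E, Cmod_Cexp; reflexivity. }
  assert (u0 : u = 0) by (rewrite <- exp_0 in E1; apply exp_inv, E1).
  destruct H as [H|H]; [contradiction|].
  apply (f_equal fst) in E; simpl in E; rewrite E1, Rmult_1_l in E.
  apply Rabs_def2 in Hv; destruct Hv as [V1 V2].
  assert (S : sin (v / 2) = 0).
  { replace v with (2 * (v / 2)) in E by field; rewrite cos_2a_sin in E; nra. }
  destruct (Rlt_or_le 0 v) as [L|L].
  - generalize (sin_gt_0 (v / 2)); lra.
  - generalize (sin_gt_0 (- (v / 2))); rewrite sin_neg; lra.
Qed.

(** With s = e^w and a = 1 - z, [pole_kernel a w] dw is s^(-z) ds / (1 - s). *)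
Definition pole_kernel (a : R) (w : C) : C := (Cexp (RtoC a * w) / (1 - Cexp w))%C.

Lemma holo_Cexp_scal (a : C) (z : C) : holo (fun w => Cexp (a * w)%C) z.
Proof. apply holo_Cexp, holo_mult; [apply holo_const|apply holo_id]. Qed.

Lemma holo_opp (f : C -> C) (z : C) : holo f z -> holo (fun w => - f w)%C z.
Proof.
  intros [l H]; eexists; apply (is_derive_opp (V := AbsRing_NormedModule C_AbsRing)), H.
Qed.

Lemma holo_pole_kernel (a : R) (w : C) : Cexp w <> 1%C -> holo (pole_kernel a) w.
Proof.
  intros H; apply holo_mult; [apply holo_Cexp_scal|].
  apply holo_inv.
  - intros E; apply H; symmetry; apply Ceq_minus; exact E.
  - apply holo_plus; [apply holo_const|apply holo_opp, holo_Cexp_id].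
Qed.

(** Over the common denominator w (1 - e^w) the numerator is w (e^(aw) - 1) - (e^w - 1 - w) =
    O(|w|^2). The radius 1/6 makes |e^w - 1 - w| <= 3 |w|^2 <= |w| / 2, hence |1 - e^w| >= |w| /
    2. *)
Lemma pole_kernel_bound (a : R) (w : C) : 0 < Cmod w <= / 6 ->
  Cexp w <> 1%C ->
  Cmod (pole_kernel a w + / w)%C <= 2 * (Rabs a * exp (Rabs a) + exp 1).
Proof.
  intros [W0 W1] Hw.
  assert (w0 : w <> 0%C) by (apply Cmod_gt_0; exact W0).
  assert (N1 : (1 - Cexp w)%C <> 0%C).
  { intros E; apply Hw; symmetry; apply Ceq_minus; exact E. }
  replace (pole_kernel a w + / w)%C with
    ((w * (Cexp (RtoC a * w) - 1) + - (Cexp w - 1 - w)) / (w * (1 - Cexp w)))%C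
    by (unfold pole_kernel; field; auto).
  rewrite Cmod_div by (apply Cmult_neq_0; assumption); rewrite Cmod_mult.
  assert (exp1 : exp 1 <= 3) by apply exp_le_3.
  assert (L : Cmod w / 2 <= Cmod (1 - Cexp w)%C).
  { assert (T := Cmod_triangle (1 - Cexp w)%C (Cexp w - 1 - w)%C).
    replace (1 - Cexp w + (Cexp w - 1 - w))%C with (- w)%C in T by ring; rewrite Cmod_opp in T.
    generalize (Cmod_Cexp_sub_1_sub w); intros Q.
    assert (exp (Cmod w) <= 3) by (eapply Rle_trans; [apply exp_le with (y := 1); lra|exact exp1]).
    assert (Cmod w ^ 2 * exp (Cmod w) <= Cmod w * / 6 * 3).
    { replace (Cmod w ^ 2 * exp (Cmod w)) with (Cmod w * (Cmod w * exp (Cmod w))) by ring.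
      rewrite Rmult_assoc; apply Rmult_le_compat_l; [lra|].
      apply Rmult_le_compat; try lra; apply Rlt_le, exp_pos. }
    lra. }
  assert (U : Cmod (w * (Cexp (RtoC a * w) - 1) + - (Cexp w - 1 - w))%C <=
     Cmod w ^ 2 * (Rabs a * exp (Rabs a) + exp 1)).
  { eapply Rle_trans; [apply Cmod_triangle|]; rewrite Cmod_opp, Cmod_mult, Rmult_plus_distr_l.
    apply Rplus_le_compat.
    - replace (Cmod w ^ 2 * (Rabs a * exp (Rabs a))) with (Cmod w * (Rabs a * Cmod w * exp (Rabs a))) by ring.
      apply Rmult_le_compat_l; [lra|].
      eapply Rle_trans; [apply Cmod_Cexp_sub_1|].
      rewrite Cmod_mult, Cmod_R; apply Rmult_le_compat_l; [generalize (Rabs_pos a); nra|].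
      apply exp_le; generalize (Rabs_pos a); nra.
    - eapply Rle_trans; [apply Cmod_Cexp_sub_1_sub|].
      apply Rmult_le_compat_l; [apply pow2_ge_0|apply exp_le; lra]. }
  apply Rmult_le_reg_r with (Cmod w * Cmod (1 - Cexp w)%C); [apply Rmult_lt_0_compat; lra|].
  unfold Rdiv; rewrite Rmult_assoc, Rinv_l, Rmult_1_r.
  2: { apply Rgt_not_eq, Rmult_lt_0_compat; lra. }
  eapply Rle_trans; [exact U|].
  assert (K : 0 <= Rabs a * exp (Rabs a) + exp 1).
  { generalize (Rabs_pos a) (exp_pos (Rabs a)) (exp_pos 1); intros; nra. }
  replace (2 * (Rabs a * exp (Rabs a) + exp 1) * (Cmod w * Cmod (1 - Cexp w)%C)) with
    (Cmod w * (2 * Cmod (1 - Cexp w)%C) * (Rabs a * exp (Rabs a) + exp 1)) by ring.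
  apply Rmult_le_compat_r; [exact K|]; replace (Cmod w ^ 2) with (Cmod w * Cmod w) by ring.
  apply Rmult_le_compat_l; lra.
Qed.

(** What surrounds the central square splits into four rectangles without a pole: two of full height
    at the left and right, one above and one below the square. *)
Lemma rect_int_pole_shrink (a A B phi d : R) : A < 0 < B -> 0 < phi < PI ->
  0 < d -> d <= - A -> d <= B -> d <= phi ->
  rect_int (pole_kernel a) A B (- phi) phi = rect_int (pole_kernel a) (- d) d (- d) d.
Proof.
  intros HAB Hphi Hd dA dB dphi.
  assert (Hl : forall u v, - phi <= v <= phi -> u <> 0 \/ v <> 0 -> holo (pole_kernel a) (u, v)).
  { intros u v Hv H; apply holo_pole_kernel, Cexp_neq_1; auto; apply Rabs_def1; lra. }
  rewrite (rect_int_split_h _ A (- d) B).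
  2-5: apply (CIntegrable_hline (pole_kernel a)); [lra|intros; apply Hl; [lra|right; lra]].
  rewrite (rect_int_split_h _ (- d) d B).
  2-5: apply (CIntegrable_hline (pole_kernel a)); [lra|intros; apply Hl; [lra|right; lra]].
  rewrite (rect_int_split_v _ (- d) d (- phi) (- d) phi).
  2-5: apply (CIntegrable_vline (pole_kernel a)); [lra|intros; apply Hl; [lra|left; lra]].
  rewrite (rect_int_split_v _ (- d) d (- d) d phi).
  2-5: apply (CIntegrable_vline (pole_kernel a)); [lra|intros; apply Hl; [lra|left; lra]].
  rewrite (rect_int_holo _ A (- d)), (rect_int_holo _ d B), (rect_int_holo _ (- d) d d phi),
    (rect_int_holo _ (- d) d (- phi) (- d)); try lra.
  - ring.
  - intros u v Hu Hv; apply Hl; [lra|right; lra].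
  - intros u v Hu Hv; apply Hl; [lra|right; lra].
  - intros u v Hu Hv; apply Hl; [lra|left; lra].
  - intros u v Hu Hv; apply Hl; [lra|left; lra].
Qed.

Lemma Rle_of_forall_scale (x K d0 : R) : 0 < d0 -> (forall d, 0 < d <= d0 -> x <= K * d) -> x <= 0.
Proof.
  intros Hd H; apply Rnot_lt_le; intros P.
  assert (K0 : 0 < K) by (specialize (H d0); nra).
  specialize (H (Rmin d0 (x / (2 * K)))).
  assert (Q : 0 < x / (2 * K)) by (apply Rdiv_lt_0_compat; lra).
  assert (H' : x <= K * Rmin d0 (x / (2 * K))).
  { apply H; split; [apply Rmin_pos; lra|apply Rmin_l]. }
  assert (K * Rmin d0 (x / (2 * K)) <= K * (x / (2 * K))) by (apply Rmult_le_compat_l; [lra|apply Rmin_r]).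
  replace (K * (x / (2 * K))) with (x / 2) in * by (field; lra); lra.
Qed.

(** The integral equals that over the square of half-side d, where the kernel is -1/w up to a
    bounded function; the error is O(d), and d is free. *)
Lemma rect_int_pole_kernel (a A B phi : R) : A < 0 < B -> 0 < phi < PI ->
  rect_int (pole_kernel a) A B (- phi) phi = (RtoC (2 * PI) * Ci)%C.
Proof.
  intros HAB Hphi.
  apply Ceq_minus, Cmod_eq_0, Rle_antisym; [|apply Cmod_ge_0].
  set (K := 2 * (Rabs a * exp (Rabs a) + exp 1)).
  (* With d <= 1/12 the boundary of the square satisfies |w| <= 2d <= 1/6, as [pole_kernel_bound]
     requires; 8 d is its perimeter. *)
  apply (Rle_of_forall_scale _ (8 * K) (Rmin (/ 12) (Rmin (- A) (Rmin B phi)))).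
  { repeat apply Rmin_pos; lra. }
  intros d [d0 Hd].
  generalize (Rmin_l (/ 12) (Rmin (- A) (Rmin B phi))) (Rmin_r (/ 12) (Rmin (- A) (Rmin B phi)))
    (Rmin_l (- A) (Rmin B phi)) (Rmin_r (- A) (Rmin B phi)) (Rmin_l B phi) (Rmin_r B phi); intros.
  rewrite (rect_int_pole_shrink a A B phi d) by lra.
  assert (Hl : forall u v, - phi <= v <= phi -> u <> 0 \/ v <> 0 -> holo (pole_kernel a) (u, v)).
  { intros u v Hv H'; apply holo_pole_kernel, Cexp_neq_1; auto; apply Rabs_def1; lra. }
  assert (Nz : forall u v : R, u <> 0 \/ v <> 0 -> ((u, v) : C) <> 0%C).
  { intros u v [H'|H'] E; injection E; intros; contradiction. }
  assert (C1 : cont_on_sides (pole_kernel a) (- d) d (- d) d).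
  { split; [|split; [|split]].
    1-2: apply (CIntegrable_hline (pole_kernel a)); [lra|intros; apply Hl; [lra|right; lra]].
    1-2: apply (CIntegrable_vline (pole_kernel a)); [lra|intros; apply Hl; [lra|left; lra]]. }
  assert (C2 : cont_on_sides Cinv (- d) d (- d) d).
  { split; [|split; [|split]].
    1-2: apply (CIntegrable_hline Cinv); [lra|intros; apply holo_inv_id, Nz; right; lra].
    1-2: apply (CIntegrable_vline Cinv); [lra|intros; apply holo_inv_id, Nz; left; lra]. }
  rewrite <- (rect_int_inv_square d d0).
  replace (rect_int (fun w => - / w)%C (- d) d (- d) d) with (- rect_int Cinv (- d) d (- d) d)%C.
  2: { destruct C2 as (N1 & N2 & N3 & N4); unfold rect_int, hint, vint.
       assert (E : forall (f : R -> C) x y, CIntegrable f x y -> CInt (fun u => - f u)%C x y = (- CInt f x y)%C).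
       { intros f x y Hf; rewrite (CInt_ext _ (fun u => (-(1)) * f u)%C) by (intros; ring).
         rewrite CInt_Cmult by exact Hf; ring. }
       rewrite (E (fun u => / (u, d))%C), (E (fun u => / (u, (- d)%R))%C),
         (E (fun u => / (d, u))%C), (E (fun u => / ((- d)%R, u))%C) by assumption; ring. }
  replace (rect_int (pole_kernel a) (- d) d (- d) d - - rect_int Cinv (- d) d (- d) d)%C with
    (rect_int (fun w => pole_kernel a w + / w)%C (- d) d (- d) d)
    by (rewrite (rect_int_plus _ Cinv _ _ _ _ C1 C2); ring).
  replace (8 * K * d) with (2 * ((d - - d) + (d - - d)) * K) by ring.
  apply Cmod_rect_int_le; try lra.
  - destruct C1 as (N1 & N2 & N3 & N4), C2 as (M1 & M2 & M3 & M4);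
    split; [|split; [|split]];
    first [exact (CIntegrable_plus _ _ _ _ N1 M1)|exact (CIntegrable_plus _ _ _ _ N2 M2)
          |exact (CIntegrable_plus _ _ _ _ N3 M3)|exact (CIntegrable_plus _ _ _ _ N4 M4)].
  - intros u v Hu Hv Hs.
    assert (NZ : u <> 0 \/ v <> 0) by (destruct Hs as [S|[S|[S|S]]]; [right|right|left|left]; lra).
    apply pole_kernel_bound.
    + split; [apply Cmod_gt_0, Nz, NZ|].
      eapply Rle_trans; [apply Cmod_le_abs|]; simpl.
      assert (Rabs u <= d /\ Rabs v <= d) by (split; apply Rabs_le; lra); lra.
    + apply Cexp_neq_1; [apply Rabs_def1; lra|exact NZ].
Qed.

(** * Euler's integral for Gamma *)

Lemma ln_le_sub_1 (x : R) : 0 < x -> ln x <= x - 1.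
Proof. intros H; generalize (exp_ineq1_le (ln x)); rewrite exp_ln by exact H; lra. Qed.

(** The constant is (kappa / (e c))^kappa, obtained from ln x <= x - 1 at x = c e^u / kappa. With c
    = - cos phi this turns the double exponential on the half-lines of the contour into any
    prescribed exponential decay. *)
Lemma exp_neg_exp_le (c kappa : R) : 0 < c -> 0 < kappa ->
  exists K, 0 < K /\ forall u, exp (- (c * exp u)) <= K * exp (- (kappa * u)).
Proof.
  intros Hc Hk; exists (exp (- kappa - kappa * ln (c / kappa))); split; [apply exp_pos|].
  intros u; rewrite <- exp_plus; apply exp_le.
  assert (P : 0 < c / kappa) by (apply Rdiv_lt_0_compat; assumption).
  assert (Q := ln_le_sub_1 (c / kappa * exp u) (Rmult_lt_0_compat _ _ P (exp_pos u))).
  rewrite ln_mult, ln_exp in Q by (auto; apply exp_pos).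
  apply Rmult_le_compat_l with (r := kappa) in Q; [|lra].
  replace (kappa * (c / kappa * exp u - 1)) with (c * exp u - kappa) in Q by (field; lra).
  lra.
Qed.

Definition gamma_integrand (s t : R) : R := Rpower t (s - 1) * exp (- t).

Lemma gamma_integrand_pos (s t : R) : 0 < gamma_integrand s t.
Proof. apply Rmult_lt_0_compat; apply exp_pos. Qed.

Lemma continuous_Rpower_l (p t : R) : 0 < t -> continuous (fun x => Rpower x p) t.
Proof.
  intros Ht; apply (ex_derive_continuous (V := R_NormedModule)).
  unfold Rpower; auto_derive; exact Ht.
Qed.

Lemma continuous_gamma_integrand (s t : R) : 0 < t -> continuous (gamma_integrand s) t.
Proof.
  intros Ht; apply (continuous_mult (K := R_AbsRing)); [apply continuous_Rpower_l, Ht|].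
  apply (ex_derive_continuous (V := R_NormedModule)); auto_derive; exact I.
Qed.

Lemma ex_RInt_gamma_integrand (s a b : R) : 0 < a -> 0 < b -> ex_RInt (gamma_integrand s) a b.
Proof.
  intros Ha Hb; apply (ex_RInt_continuous (V := R_CompleteNormedModule)); intros t Ht.
  apply continuous_gamma_integrand; generalize (Rmin_pos a b Ha Hb); lra.
Qed.

(* The integrand is dominated by a multiple of the derivative of [t^s / (1 + t^s)]. *)
Lemma RInt_gamma_integrand_bounded (s : R) : 0 < s ->
  exists K, forall a b, 0 < a <= b -> RInt (gamma_integrand s) a b <= K.
Proof.
  intros Hs.
  destruct (exp_neg_exp_le (/ 2) s) as (K & K0 & HK); [lra|exact Hs|].
  (* e^(-t) is the square of e^(-t/2), and each factor is at most (1 + K) / (1 + t^s); 1/s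
     compensates the factor s of the derivative. *)
  set (M := (1 + K) * (1 + K) / s).
  assert (M0 : 0 < M) by (apply Rdiv_lt_0_compat; nra).
  exists M; intros a b Hab.
  assert (Pp : forall t, 0 < Rpower t s) by (intros; apply exp_pos).
  assert (I : is_RInt (fun t => s * Rpower t (s - 1) / ((1 + Rpower t s) * (1 + Rpower t s))) a b
     (minus (- / (1 + Rpower b s)) (- / (1 + Rpower a s)))).
  { apply (is_RInt_derive (V := R_CompleteNormedModule) (fun t => - / (1 + Rpower t s))).
    - intros t Ht; rewrite Rmin_left, Rmax_right in Ht by lra.
      assert (E : Rpower t (s - 1) = Rpower t s / t).
      { unfold Rminus; rewrite Rpower_plus, Rpower_Ropp, Rpower_1 by lra; reflexivity. }
      rewrite E; unfold Rpower; auto_derive.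
      + generalize (exp_pos (s * ln t)); intros; repeat split; lra.
      + generalize (exp_pos (s * ln t)); intros; field; split; lra.
    - intros t Ht; rewrite Rmin_left, Rmax_right in Ht by lra.
      apply (ex_derive_continuous (V := R_NormedModule)).
      unfold Rpower; auto_derive; generalize (exp_pos (s * ln t)); intros; repeat split; nra. }
  apply Rle_trans with (RInt (fun t => M * (s * Rpower t (s - 1) / ((1 + Rpower t s) * (1 + Rpower t s)))) a b).
  - apply RInt_le; [lra|apply ex_RInt_gamma_integrand; lra| |].
    + eexists; apply (is_RInt_scal (V := R_NormedModule) _ a b M), I.
    + intros t Ht; unfold gamma_integrand, M.
      replace ((1 + K) * (1 + K) / s * (s * Rpower t (s - 1) / ((1 + Rpower t s) * (1 + Rpower t s))))
        with (Rpower t (s - 1) * ((1 + K) / (1 + Rpower t s) * ((1 + K) / (1 + Rpower t s))))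
        by (generalize (Pp t); intros; field; split; lra).
      apply Rmult_le_compat_l; [apply Rlt_le, exp_pos|].
      assert (B : exp (- (t / 2)) <= (1 + K) / (1 + Rpower t s)).
      { specialize (HK (ln t)); rewrite exp_ln in HK by lra.
        assert (E1 : exp (- (s * ln t)) * Rpower t s = 1).
        { unfold Rpower; rewrite <- exp_plus, Rplus_opp_l; apply exp_0. }
        assert (E2 : exp (- (t / 2)) <= 1) by (rewrite <- exp_0; apply exp_le; lra).
        replace (- (/ 2 * t)) with (- (t / 2)) in HK by field.
        apply Rmult_le_reg_r with (1 + Rpower t s); [generalize (Pp t); lra|].
        unfold Rdiv at 2; rewrite Rmult_assoc, Rinv_l by (generalize (Pp t); lra).
        apply Rmult_le_compat_r with (r := Rpower t s) in HK; [|apply Rlt_le, Pp].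
        rewrite Rmult_assoc, E1 in HK; lra. }
      replace (exp (- t)) with (exp (- (t / 2)) * exp (- (t / 2))) by (rewrite <- exp_plus; f_equal; field).
      generalize (exp_pos (- (t / 2))); intros; apply Rmult_le_compat; lra.
  - eapply Rle_trans; [right; exact (is_RInt_unique _ _ _ _ (is_RInt_scal (V := R_NormedModule) _ a b M _ I))|].
    change (M * (- / (1 + Rpower b s) - - / (1 + Rpower a s)) <= M).
    rewrite <- (Rmult_1_r M) at 2; apply Rmult_le_compat_l; [lra|].
    assert (0 < / (1 + Rpower b s)) by (apply Rinv_0_lt_compat; generalize (Pp b); lra).
    assert (/ (1 + Rpower a s) <= / 1) by (apply Rinv_le_contravar; generalize (Pp a); lra).
    rewrite Rinv_1 in *; lra.
Qed.

Lemma RInt_gamma_integrand_mono (s a a' b b' : R) : 0 < a' <= a -> a <= b -> b <= b' ->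
  RInt (gamma_integrand s) a b <= RInt (gamma_integrand s) a' b'.
Proof.
  intros Ha Hab Hb.
  assert (P : forall x y, 0 < x <= y -> 0 <= RInt (gamma_integrand s) x y).
  { intros x y H; apply RInt_ge_0; [lra|apply ex_RInt_gamma_integrand; lra|].
    intros; apply Rlt_le, gamma_integrand_pos. }
  rewrite <- (RInt_Chasles (V := R_CompleteNormedModule) _ a' a b'),
    <- (RInt_Chasles (V := R_CompleteNormedModule) _ a b b')
    by (apply ex_RInt_gamma_integrand; lra).
  change (RInt (gamma_integrand s) a b <= RInt (gamma_integrand s) a' a +
    (RInt (gamma_integrand s) a b + RInt (gamma_integrand s) b b')).
  generalize (P a' a) (P b b'); intros; lra.
Qed.

(** The integrand is positive, so the proper integrals increase with the interval and the improper
    one is their supremum. Later arguments use only these two inequalities. *)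
Lemma Gamma_lub (s : R) : 0 < s ->
  (forall a b, 0 < a <= b -> RInt (gamma_integrand s) a b <= Gamma s) /\
  (forall eta, 0 < eta -> exists a0 b0, 0 < a0 <= b0 /\
     forall a b, 0 < a <= a0 -> b0 <= b -> Gamma s - eta <= RInt (gamma_integrand s) a b).
Proof.
  intros Hs; destruct (RInt_gamma_integrand_bounded s Hs) as [K HK].
  destruct (completeness (fun x => exists a b, 0 < a <= b /\ x = RInt (gamma_integrand s) a b)) as [l [L1 L2]].
  - exists K; intros x (a & b & H & ->); apply HK, H.
  - exists (RInt (gamma_integrand s) 1 1), 1, 1; split; [lra|reflexivity].
  - assert (U : forall a b, 0 < a <= b -> RInt (gamma_integrand s) a b <= l).
    { intros a b H; apply L1; exists a, b; auto. }
    assert (V : forall eta, 0 < eta -> exists a0 b0, 0 < a0 <= b0 /\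
       forall a b, 0 < a <= a0 -> b0 <= b -> l - eta <= RInt (gamma_integrand s) a b).
    { intros eta He.
      destruct (Classical_Prop.classic (exists a0 b0, 0 < a0 <= b0 /\ l - eta <= RInt (gamma_integrand s) a0 b0))
        as [(a0 & b0 & H0 & H1)|N].
      - exists a0, b0; split; [exact H0|]; intros a b Ha Hb.
        eapply Rle_trans; [exact H1|apply RInt_gamma_integrand_mono; lra].
      - exfalso; assert (l <= l - eta); [|lra].
        apply L2; intros x (a & b & H & ->); apply Rnot_lt_le; intros C.
        apply N; exists a, b; split; [exact H|lra]. }
    assert (E : Gamma s = l).
    { apply (is_RInt_gen_unique (V := R_CompleteNormedModule) (Fa := at_right 0)
        (Fb := Rbar_locally p_infty) (gamma_integrand s) l).
      intros Q [eps HQ].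
      destruct (V (eps / 2)) as (a0 & b0 & H0 & H1); [generalize (cond_pos eps); lra|].
      apply (Filter_prod _ _ _ (fun a => 0 < a <= a0) (fun b => b0 <= b)).
      - exists (mkposreal a0 (proj1 H0)); intros a Ba Pa.
        change (Rabs (a - 0) < a0) in Ba; rewrite Rminus_0_r, Rabs_pos_eq in Ba; lra.
      - exists b0; intros; lra.
      - intros a b Ha Hb; exists (RInt (gamma_integrand s) a b); split.
        + apply (RInt_correct (V := R_CompleteNormedModule)), ex_RInt_gamma_integrand; lra.
        + apply HQ; apply Rabs_def1; unfold minus, plus, opp; simpl;
          generalize (H1 a b Ha Hb) (U a b) (cond_pos eps); intros; lra. }
    rewrite E; split; assumption.
Qed.

Lemma Gamma_pos (s : R) : 0 < s -> 0 < Gamma s.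
Proof.
  intros Hs; eapply Rlt_le_trans; [|apply (proj1 (Gamma_lub s Hs) 1 2); lra].
  apply RInt_gt_0; [lra|intros; apply gamma_integrand_pos|].
  intros; apply continuous_gamma_integrand; lra.
Qed.

(** Only the part of the integral over [c, 2c] is kept. The freedom in c makes 1 / Gamma(alpha m +
    1) decay faster than any geometric sequence. *)
Lemma Gamma_ge (s c : R) : 1 <= s -> 0 < c ->
  c * (Rpower c (s - 1) * exp (- (2 * c))) <= Gamma s.
Proof.
  intros Hs Hc; eapply Rle_trans; [|apply (proj1 (Gamma_lub s ltac:(lra)) c (2 * c)); lra].
  replace (c * (Rpower c (s - 1) * exp (- (2 * c)))) with
    (RInt (fun _ => Rpower c (s - 1) * exp (- (2 * c))) c (2 * c)).
  - apply RInt_le; [lra|apply ex_RInt_const|apply ex_RInt_gamma_integrand; lra|].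
    intros t Ht; apply Rmult_le_compat; try (apply Rlt_le, exp_pos).
    + apply Rle_Rpower_l; lra.
    + apply exp_le; lra.
  - rewrite RInt_const; change ((2 * c - c) * (Rpower c (s - 1) * exp (- (2 * c))) = c * (Rpower c (s - 1) * exp (- (2 * c)))); ring.
Qed.

(** * Hankel's formula for 1/Gamma *)

(* Hankel's contour in the logarithmic coordinate [w = log s]: up the segment
   [Re w = a], and along the half-lines [Im w = phi], [Im w = - phi], truncated
   at [Re w = L]. *)
Definition contour (phi : R) (N : C -> C) (a L : R) : C :=
  (hint N phi a L - hint N (- phi) a L + Ci * vint N a (- phi) phi)%C.

(** Closing the contour by its right side gives the rectangle, through which the residue enters. *)
Lemma contour_rect_int (phi : R) (N : C -> C) (a L : R) :
  contour phi N a L = (rect_int N a L (- phi) phi + Ci * vint N L (- phi) phi)%C.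
Proof. unfold contour, rect_int; ring. Qed.

Definition on_lines (phi : R) (N : C -> C) : Prop :=
  forall u, holo N (u, phi) /\ holo N (u, - phi).

Lemma CIntegrable_on_line (N : C -> C) (y a b : R) : (forall u, holo N (u, y)) ->
  CIntegrable (fun u => N (u, y)) a b.
Proof.
  intros H; apply CIntegrable_continuous; intros.
  apply (continuous_hline N), holo_continuous, H.
Qed.

(** The two contours differ by the boundary of the rectangle between Re w = a and Re w = b. Nothing
    is asked to the right of b except on the two half-lines. *)
Lemma contour_shift (phi : R) (N : C -> C) (a b L : R) : 0 <= phi -> a <= b ->
  on_lines phi N -> holo_on_rect N a b (- phi) phi ->
  contour phi N a L = contour phi N b L.
Proof.
  intros Hp ab Hl Hr; unfold contour, hint.
  assert (E := rect_int_holo N a b (- phi) phi ab ltac:(lra) Hr); unfold rect_int, hint in E.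
  assert (I1 : forall x y, CIntegrable (fun u => N (u, phi)) x y)
    by (intros; apply (CIntegrable_on_line N); intros u; exact (proj1 (Hl u))).
  assert (I2 : forall x y, CIntegrable (fun u => N (u, - phi)) x y)
    by (intros; apply (CIntegrable_on_line N); intros u; exact (proj2 (Hl u))).
  rewrite <- (CInt_Chasles _ a b L (I1 _ _) (I1 _ _)), <- (CInt_Chasles _ a b L (I2 _ _) (I2 _ _)).
  apply Ceq_minus; rewrite <- E; ring.
Qed.

Lemma contour_entire (phi : R) (N : C -> C) (a b L : R) : 0 <= phi ->
  (forall w, holo N w) -> contour phi N a L = contour phi N b L.
Proof.
  intros Hp H; destruct (Rle_or_lt a b) as [ab|ab].
  - apply contour_shift; auto; [intros u; split; apply H|intros u v _ _; apply H].
  - symmetry; apply contour_shift; auto; [lra|intros u; split; apply H|intros u v _ _; apply H].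
Qed.

Lemma bounded_on_segment (f : R -> C) (a b : R) : (forall x, a <= x <= b -> continuous f x) ->
  exists M, 0 < M /\ forall x, a <= x <= b -> Cmod (f x) <= M.
Proof.
  intros H; destruct (bounded_continuity (V := C_R_NormedModule) f a b H) as [M HM].
  exists (Rmax M 1); split; [apply Rlt_le_trans with 1; [lra|apply Rmax_r]|].
  intros x Hx; specialize (HM x Hx); rewrite Cmod_norm.
  apply Rle_trans with M; [left; exact HM|apply Rmax_l].
Qed.

Lemma is_derive_of_quadratic (F : R -> C) (t : R) (l : C) (K : R) :
  (forall h, Rabs h <= 1 -> Cmod (F (t + h)%R - F t - RtoC h * l)%C <= K * h ^ 2) ->
  is_derive (K := R_AbsRing) (V := C_R_NormedModule) F t l.
Proof.
  intros H; split; [apply is_linear_scal_l|].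
  intros y Hy eps.
  assert (E0 : t = y) by exact (is_filter_lim_locally_unique (V := R_NormedModule) t y Hy).
  subst y.
  assert (K0 : 0 <= K).
  { specialize (H 1 ltac:(rewrite Rabs_R1; lra)).
    generalize (Cmod_ge_0 (F (t + 1)%R - F t - RtoC 1 * l)%C); lra. }
  assert (Pd : 0 < Rmin 1 (eps / (K + 1))).
  { apply Rmin_pos; [lra|apply Rdiv_lt_0_compat; [apply cond_pos|lra]]. }
  exists (mkposreal _ Pd); intros y Hy'; change R in y.
  change (Rabs (y - t) < Rmin 1 (eps / (K + 1))) in Hy'.
  assert (H1 : Rabs (y - t) <= 1) by (generalize (Rmin_l 1 (eps / (K + 1))); lra).
  assert (H2 : Rabs (y - t) <= eps / (K + 1)) by (generalize (Rmin_r 1 (eps / (K + 1))); lra).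
  specialize (H _ H1); replace (t + (y - t))%R with y in H by ring.
  change (norm (V := prod_NormedModule R_AbsRing R_NormedModule R_NormedModule)
    (F y - F t - scal (V := C_R_ModuleSpace) (y - t)%R l)%C <= eps * Rabs (y - t)).
  rewrite scal_R_Cmult, <- Cmod_norm.
  eapply Rle_trans; [exact H|].
  rewrite <- (pow2_abs (y - t)); replace (K * Rabs (y - t) ^ 2) with (K * Rabs (y - t) * Rabs (y - t)) by ring.
  apply Rmult_le_compat_r; [apply Rabs_pos|].
  apply Rle_trans with ((K + 1) * (eps / (K + 1))); [|right; field; lra].
  apply Rmult_le_compat; try lra; apply Rabs_pos.
Qed.

(** [A] and [B] are bounded on the segment, so the second-order remainder of the exponential is
    O(h^2) uniformly under the integral. *)
Lemma is_derive_CInt_Cexp (A B : R -> C) (a b t : R) : a <= b ->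
  (forall x, a <= x <= b -> continuous A x) -> (forall x, a <= x <= b -> continuous B x) ->
  is_derive (K := R_AbsRing) (V := C_R_NormedModule)
    (fun t => CInt (fun x => Cexp (RtoC t * B x) * A x)%C a b) t
    (CInt (fun x => Cexp (RtoC t * B x) * (B x * A x))%C a b).
Proof.
  intros ab HA HB.
  destruct (bounded_on_segment A a b HA) as (MA & MA0 & HMA).
  destruct (bounded_on_segment B a b HB) as (MB & MB0 & HMB).
  assert (CE : forall s x, a <= x <= b -> continuous (fun x => Cexp (RtoC s * B x)%C) x).
  { intros s x Hx; apply continuous_Cexp_comp, continuous_Cmult; [apply continuous_const|apply HB, Hx]. }
  assert (I1 : forall s, CIntegrable (fun x => Cexp (RtoC s * B x) * A x)%C a b).
  { intros s; apply CIntegrable_continuous; intros x Hx; rewrite Rmin_left, Rmax_right in Hx by exact ab.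
    apply continuous_Cmult; [apply CE, Hx|apply HA, Hx]. }
  assert (I2 : CIntegrable (fun x => Cexp (RtoC t * B x) * (B x * A x))%C a b).
  { apply CIntegrable_continuous; intros x Hx; rewrite Rmin_left, Rmax_right in Hx by exact ab.
    apply continuous_Cmult; [apply CE, Hx|apply continuous_Cmult; [apply HB, Hx|apply HA, Hx]]. }
  apply is_derive_of_quadratic with ((b - a) * (exp (Rabs t * MB) * MB ^ 2 * exp MB * MA)).
  intros h Hh.
  rewrite <- CInt_Cmult by exact I2.
  assert (I3 := CIntegrable_minus _ _ _ _ (I1 (t + h)) (I1 t)).
  assert (I4 := CIntegrable_Cmult (RtoC h) _ _ _ I2).
  rewrite <- (CInt_minus _ _ _ _ (I1 (t + h)) (I1 t)), <- (CInt_minus _ _ _ _ I3 I4).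
  rewrite Rmult_assoc; apply Cmod_CInt_le_const; [exact ab| |exact (CIntegrable_minus _ _ _ _ I3 I4)].
  intros x Hx.
  replace (Cexp (RtoC (t + h) * B x) * A x - Cexp (RtoC t * B x) * A x -
    RtoC h * (Cexp (RtoC t * B x) * (B x * A x)))%C with
    (Cexp (RtoC t * B x) * (Cexp (RtoC h * B x) - 1 - RtoC h * B x) * A x)%C.
  2: { rewrite RtoC_plus, Cmult_plus_distr_r, Cexp_plus; ring. }
  specialize (HMA x Hx); specialize (HMB x Hx).
  rewrite !Cmod_mult, Cmod_Cexp.
  assert (Q : Cmod (RtoC h * B x)%C <= Rabs h * MB).
  { rewrite Cmod_mult, Cmod_R; apply Rmult_le_compat_l; [apply Rabs_pos|exact HMB]. }
  assert (Q1 : Cmod (RtoC h * B x)%C <= MB) by (generalize (Rabs_pos h); nra).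
  replace (exp (Rabs t * MB) * MB ^ 2 * exp MB * MA * h ^ 2) with
    (exp (Rabs t * MB) * ((Rabs h * MB) ^ 2 * exp MB) * MA)
    by (rewrite Rpow_mult_distr, pow2_abs; ring).
  apply Rmult_le_compat; auto; try apply Cmod_ge_0.
  { apply Rmult_le_pos; [apply Rlt_le, exp_pos|apply Cmod_ge_0]. }
  apply Rmult_le_compat; auto; try apply Cmod_ge_0.
  { apply Rlt_le, exp_pos. }
  - apply exp_le; eapply Rle_trans; [apply Re_le_Cmod|].
    rewrite Cmod_mult, Cmod_R; apply Rmult_le_compat_l; [apply Rabs_pos|exact HMB].
  - eapply Rle_trans; [apply Cmod_Cexp_sub_1_sub|].
    apply Rmult_le_compat.
    + apply pow2_ge_0.
    + apply Rlt_le, exp_pos.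
    + apply pow_incr; split; [apply Cmod_ge_0|exact Q].
    + apply exp_le, Q1.
Qed.

(** With s = e^w, [hankel_kernel z t w] dw is e^(ts) s^(-z) ds. *)
Definition hankel_kernel (z t : R) (w : C) : C :=
  (Cexp (RtoC t * Cexp w) * Cexp (RtoC (1 - z) * w))%C.

Lemma holo_hankel_kernel (z t : R) (w : C) : holo (hankel_kernel z t) w.
Proof.
  apply holo_mult; [|apply holo_Cexp_scal].
  apply holo_Cexp, holo_mult; [apply holo_const|apply holo_Cexp_id].
Qed.

Lemma hankel_kernel_scale (z t u v : R) : 0 < t ->
  hankel_kernel z t (u, v) = (RtoC (Rpower t (z - 1)) * hankel_kernel z 1 ((u + ln t)%R, v))%C.
Proof.
  intros Ht; unfold hankel_kernel.
  assert (E : (((u + ln t)%R, v) : C) = ((u, v) + RtoC (ln t))%C).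
  { unfold Cplus, RtoC; simpl; f_equal; ring. }
  assert (R1 : forall x : R, Cexp (RtoC x) = RtoC (exp x)).
  { intros x; unfold Cexp, RtoC; simpl; rewrite cos_0, sin_0; f_equal; ring. }
  rewrite E, Cexp_plus, R1, exp_ln by exact Ht.
  rewrite Cmult_plus_distr_l, Cexp_plus, <- RtoC_mult, R1.
  assert (E2 : (RtoC (Rpower t (z - 1)) * RtoC (exp ((1 - z) * ln t)))%C = 1%C).
  { unfold Rpower; rewrite <- RtoC_mult, <- exp_plus.
    replace ((z - 1) * ln t + (1 - z) * ln t) with 0 by ring; rewrite exp_0; reflexivity. }
  rewrite Cmult_1_l, (Cmult_comm (Cexp (u, v))).
  transitivity (Cexp (RtoC t * Cexp (u, v)) * Cexp (RtoC (1 - z) * (u, v)) *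
    (RtoC (Rpower t (z - 1)) * RtoC (exp ((1 - z) * ln t))))%C; [rewrite E2|]; ring.
Qed.

(** The substitution s -> s / t is a horizontal shift by ln t in the coordinate w. The kernel being
    entire, the start returns to 0, but the truncation point moves to L + ln t; the dependence on t
    must then be controlled through it. *)
Lemma contour_hankel_scale (phi z t a L : R) : 0 <= phi -> 0 < t ->
  contour phi (hankel_kernel z t) a L =
  (RtoC (Rpower t (z - 1)) * contour phi (hankel_kernel z 1) 0 (L + ln t))%C.
Proof.
  intros Hp Ht.
  rewrite (contour_entire phi (hankel_kernel z 1) 0 (a + ln t)) by (auto; intros; apply holo_hankel_kernel).
  assert (Hh : forall y, hint (hankel_kernel z t) y a L =
    (RtoC (Rpower t (z - 1)) * hint (hankel_kernel z 1) y (a + ln t) (L + ln t))%C).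
  { intros y; unfold hint.
    rewrite (CInt_ext _ (fun u => RtoC (Rpower t (z - 1)) * hankel_kernel z 1 ((u + ln t)%R, y))%C)
      by (intros; apply hankel_kernel_scale, Ht).
    rewrite CInt_Cmult.
    - f_equal; apply (CInt_shift (fun u => hankel_kernel z 1 (u, y))).
      apply (CIntegrable_on_line (hankel_kernel z 1)); intros; apply holo_hankel_kernel.
    - apply CIntegrable_continuous; intros x _.
      apply (continuous_comp (fun u : R => u + ln t) (fun u => hankel_kernel z 1 (u, y))).
      + apply (continuous_plus (V := R_NormedModule)); [apply continuous_id|apply continuous_const].
      + apply (continuous_hline (hankel_kernel z 1)), holo_continuous, holo_hankel_kernel. }
  unfold contour; rewrite !Hh; unfold vint.
  rewrite (CInt_ext _ (fun v => RtoC (Rpower t (z - 1)) * hankel_kernel z 1 ((a + ln t)%R, v))%C)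
    by (intros; apply hankel_kernel_scale, Ht).
  rewrite CInt_Cmult.
  - ring.
  - apply CIntegrable_continuous; intros x _.
    apply (continuous_vline (hankel_kernel z 1)), holo_continuous, holo_hankel_kernel.
Qed.

Lemma cos_neg_of (phi : R) : PI / 2 < phi < PI -> cos phi < 0.
Proof. intros H; apply cos_lt_0; lra. Qed.

Lemma Cmod_hankel_kernel_line (z u phi : R) :
  Cmod (hankel_kernel z 1 (u, phi)) = exp (exp u * cos phi) * exp ((1 - z) * u).
Proof.
  unfold hankel_kernel; rewrite Cmod_mult, !Cmod_Cexp, Cmult_1_l; simpl; f_equal; f_equal; ring.
Qed.

Lemma is_RInt_exp_lin (d x y : R) : d <> 0 ->
  is_RInt (fun u => exp (- (d * u))) x y ((exp (- (d * x)) - exp (- (d * y))) / d).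
Proof.
  intros Hd.
  replace ((exp (- (d * x)) - exp (- (d * y))) / d) with
    (minus (- exp (- (d * y)) / d) (- exp (- (d * x)) / d))
    by (unfold minus, plus, opp; simpl; field; exact Hd).
  apply (is_RInt_derive (V := R_CompleteNormedModule) (fun u => - exp (- (d * u)) / d)).
  - intros t _; auto_derive; [exact I|field; exact Hd].
  - intros t _; apply (ex_derive_continuous (V := R_NormedModule)); auto_derive; exact I.
Qed.

(** Two truncations differ by pieces of the half-lines, where the kernel has modulus exp(e^u cos
    phi) e^((1-z)u) <= K e^(-(kappa+z-1)u). Negative x and y are included, because L + ln t tends to
    minus infinity as t -> 0. *)
Lemma contour_hankel_cauchy (phi z kappa : R) : PI / 2 < phi < PI -> 0 < kappa -> 0 < kappa + z - 1 ->
  exists K, 0 < K /\ forall x y,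
    Cmod (contour phi (hankel_kernel z 1) 0 x - contour phi (hankel_kernel z 1) 0 y)%C <=
    K * (exp (- ((kappa + z - 1) * x)) + exp (- ((kappa + z - 1) * y))).
Proof.
  intros Hphi Hk Hd; set (d := kappa + z - 1) in *.
  assert (Hc := cos_neg_of phi Hphi).
  destruct (exp_neg_exp_le (- cos phi) kappa) as (K & K0 & HK); [lra|exact Hk|].
  exists (2 * K / d); split; [apply Rdiv_lt_0_compat; lra|].
  assert (I : forall s a b, CIntegrable (fun u => hankel_kernel z 1 (u, s)) a b).
  { intros; apply (CIntegrable_on_line (hankel_kernel z 1)); intros; apply holo_hankel_kernel. }
  assert (W : forall x y, x <= y ->
    Cmod (contour phi (hankel_kernel z 1) 0 x - contour phi (hankel_kernel z 1) 0 y)%C <=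
    2 * K / d * (exp (- (d * x)) + exp (- (d * y)))).
  { intros x y xy.
    assert (B : forall s, cos s = cos phi -> Cmod (CInt (fun u => hankel_kernel z 1 (u, s)) x y) <= K / d * exp (- (d * x))).
    { intros s Hs.
      apply Rle_trans with (RInt (fun u => K * exp (- (d * u))) x y).
      - apply Cmod_CInt_le; auto.
        + intros u Hu; rewrite Cmod_hankel_kernel_line, Hs.
          specialize (HK u); replace (- (- cos phi * exp u)) with (exp u * cos phi) in HK by ring.
          apply Rmult_le_compat_r with (r := exp ((1 - z) * u)) in HK; [|apply Rlt_le, exp_pos].
          eapply Rle_trans; [exact HK|]; right; rewrite Rmult_assoc, <- exp_plus.
          f_equal; f_equal; unfold d; ring.
        + eexists; apply (is_RInt_scal (V := R_NormedModule) _ x y K), is_RInt_exp_lin; lra.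
      - eapply Rle_trans; [right; exact (is_RInt_unique _ _ _ _ (is_RInt_scal (V := R_NormedModule) _ x y K _ (is_RInt_exp_lin d x y ltac:(lra))))|].
        change (K * ((exp (- (d * x)) - exp (- (d * y))) / d) <= K / d * exp (- (d * x))).
        replace (K * ((exp (- (d * x)) - exp (- (d * y))) / d)) with (K / d * (exp (- (d * x)) - exp (- (d * y)))) by (field; lra).
        apply Rmult_le_compat_l; [apply Rlt_le, Rdiv_lt_0_compat; lra|].
        generalize (exp_pos (- (d * y))); lra. }
    assert (E : (contour phi (hankel_kernel z 1) 0 x - contour phi (hankel_kernel z 1) 0 y)%C =
      (CInt (fun u => hankel_kernel z 1 (u, (- phi)%R)) x y - CInt (fun u => hankel_kernel z 1 (u, phi)) x y)%C).
    { unfold contour, hint.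
      rewrite <- (CInt_Chasles (fun u => hankel_kernel z 1 (u, phi)) 0 x y),
        <- (CInt_Chasles (fun u => hankel_kernel z 1 (u, - phi)) 0 x y) by apply I; ring. }
    rewrite E; unfold Cminus; eapply Rle_trans; [apply Cmod_triangle|]; rewrite Cmod_opp.
    generalize (B phi eq_refl) (B (- phi) (cos_neg phi)) (exp_pos (- (d * y))); intros B1 B2 B3.
    assert (0 < K / d) by (apply Rdiv_lt_0_compat; lra).
    replace (2 * K / d) with (2 * (K / d)) by (field; lra); nra. }
  intros x y; destruct (Rle_or_lt x y) as [xy|xy]; [apply W, xy|].
  replace (contour phi (hankel_kernel z 1) 0 x - contour phi (hankel_kernel z 1) 0 y)%C with
    (- (contour phi (hankel_kernel z 1) 0 y - contour phi (hankel_kernel z 1) 0 x))%C by ring.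
  rewrite Cmod_opp, Rplus_comm; apply W; lra.
Qed.

Lemma ex_derive_continuous_C (f : R -> C) (x : R) (l : C) :
  is_derive (K := R_AbsRing) (V := C_R_NormedModule) f x l -> continuous f x.
Proof.
  intros H; apply (ex_derive_continuous (V := C_R_NormedModule)); exists l; exact H.
Qed.

Lemma Cmod_CInt_Cexp_le (A B : R -> C) (a b q : R) : a <= b ->
  (forall x, a <= x <= b -> continuous A x) -> (forall x, a <= x <= b -> continuous B x) ->
  (forall x, a <= x <= b -> Re (B x) <= - q) ->
  exists M, forall t, 0 <= t ->
    Cmod (CInt (fun x => Cexp (RtoC t * B x) * A x)%C a b) <= M * exp (- (q * t)).
Proof.
  intros ab HA HB Hq.
  destruct (bounded_on_segment A a b HA) as (M & M0 & HM).
  exists ((b - a) * M); intros t Ht.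
  replace ((b - a) * M * exp (- (q * t))) with ((b - a) * (exp (- (q * t)) * M)) by ring.
  apply Cmod_CInt_le_const; [exact ab| |].
  - intros x Hx; rewrite Cmod_mult, Cmod_Cexp.
    apply Rmult_le_compat; [apply Rlt_le, exp_pos|apply Cmod_ge_0| |apply HM, Hx].
    apply exp_le; specialize (Hq x Hx); unfold Re in Hq; simpl.
    rewrite Rmult_0_l, Rminus_0_r; nra.
  - apply CIntegrable_continuous; intros x Hx; rewrite Rmin_left, Rmax_right in Hx by exact ab.
    apply continuous_Cmult; [|apply HA, Hx].
    apply continuous_Cexp_comp, continuous_Cmult; [apply continuous_const|apply HB, Hx].
Qed.

(* Fubini for the Laplace transform at [1] of the truncated Hankel integral
   [t^(z-1) / Gamma(z)], in primitive form. *)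
Lemma hankel_laplace (phi z L : R) : PI / 2 < phi < PI -> 0 < L ->
  exists Psi : R -> C,
    (forall e T, 0 < e <= T -> is_RInt (V := C_R_NormedModule)
       (fun t => RtoC (gamma_integrand z t) * contour phi (hankel_kernel z 1) 0 (L + ln t))%C
       e T (Psi e - Psi T)%C) /\
    continuous Psi 0 /\
    Psi 0 = (RtoC (2 * PI) * Ci + Ci * vint (pole_kernel (1 - z)) L (- phi) phi)%C /\
    exists M q, 0 < q /\ forall T, 0 <= T -> Cmod (Psi T) <= M * exp (- (q * T)).
Proof.
  intros Hphi HL; set (pk := pole_kernel (1 - z)).
  (* Since the t-derivative of e^(t(s-1)) / (1 - s) is - e^(t(s-1)), the contour integral [Psi] of
     e^(t(s-1)) times [pole_kernel] is minus a primitive of the Laplace integrand. *)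
  set (Bw := fun w : C => (Cexp w - 1)%C).
  assert (PIp := PI_RGT_0).
  assert (Hpk : forall u v, Rabs v < PI -> u <> 0 \/ v <> 0 -> holo pk (u, v)).
  { intros u v Hv Huv; apply holo_pole_kernel, Cexp_neq_1; assumption. }
  assert (HBw : forall w, holo Bw w).
  { intros w; apply holo_plus; [apply holo_Cexp_id|apply holo_opp, holo_const]. }
  assert (Ap : Rabs phi < PI) by (apply Rabs_def1; lra).
  assert (Am : Rabs (- phi) < PI) by (apply Rabs_def1; lra).
  set (A1 := fun u => pk (u, phi)); set (A2 := fun u => (- pk (u, (- phi)%R))%C).
  set (A3 := fun v => (Ci * pk ((-1)%R, v))%C).
  set (B1 := fun u : R => Bw (u, phi)); set (B2 := fun u : R => Bw (u, (- phi)%R)).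
  set (B3 := fun v : R => Bw ((-1)%R, v)).
  assert (CA1 : forall x, -1 <= x <= L -> continuous A1 x).
  { intros; apply (continuous_hline pk), holo_continuous, Hpk; [exact Ap|right; lra]. }
  assert (CA2 : forall x, -1 <= x <= L -> continuous A2 x).
  { intros; apply (continuous_hline (fun w => - pk w)%C), holo_continuous, holo_opp, Hpk; [exact Am|right; lra]. }
  assert (CA3 : forall x, - phi <= x <= phi -> continuous A3 x).
  { intros; apply (continuous_vline (fun w => Ci * pk w)%C), holo_continuous, holo_mult; [apply holo_const|].
    apply Hpk; [apply Rabs_def1; lra|left; lra]. }
  assert (CB1 : forall x, -1 <= x <= L -> continuous B1 x).
  { intros; apply (continuous_hline Bw), holo_continuous, HBw. }
  assert (CB2 : forall x, -1 <= x <= L -> continuous B2 x).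
  { intros; apply (continuous_hline Bw), holo_continuous, HBw. }
  assert (CB3 : forall x, - phi <= x <= phi -> continuous B3 x).
  { intros; apply (continuous_vline Bw), holo_continuous, HBw. }
  set (P1 := fun t => CInt (fun x => Cexp (RtoC t * B1 x) * A1 x)%C (-1) L).
  set (P2 := fun t => CInt (fun x => Cexp (RtoC t * B2 x) * A2 x)%C (-1) L).
  set (P3 := fun t => CInt (fun x => Cexp (RtoC t * B3 x) * A3 x)%C (- phi) phi).
  set (Q1 := fun t => CInt (fun x => Cexp (RtoC t * B1 x) * (B1 x * A1 x))%C (-1) L).
  set (Q2 := fun t => CInt (fun x => Cexp (RtoC t * B2 x) * (B2 x * A2 x))%C (-1) L).
  set (Q3 := fun t => CInt (fun x => Cexp (RtoC t * B3 x) * (B3 x * A3 x))%C (- phi) phi).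
  set (Psi := fun t => (P1 t + P2 t + P3 t)%C).
  assert (ab : -1 <= L) by lra.
  assert (cd : - phi <= phi) by lra.
  assert (D : forall t, is_derive (K := R_AbsRing) (V := C_R_NormedModule) Psi t (Q1 t + Q2 t + Q3 t)%C).
  { intros t.
    assert (D1 := is_derive_CInt_Cexp A1 B1 (-1) L t ab CA1 CB1).
    assert (D2 := is_derive_CInt_Cexp A2 B2 (-1) L t ab CA2 CB2).
    assert (D3 := is_derive_CInt_Cexp A3 B3 (- phi) phi t cd CA3 CB3).
    exact (is_derive_plus (V := C_R_NormedModule) _ _ _ _ _
      (is_derive_plus (V := C_R_NormedModule) _ _ _ _ _ D1 D2) D3). }
  assert (CQ : forall t, continuous (fun t => - (Q1 t + Q2 t + Q3 t))%C t).
  { intros t; apply (continuous_opp (V := C_R_NormedModule) (fun t => Q1 t + Q2 t + Q3 t)%C).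
    assert (C1 : forall x, -1 <= x <= L -> continuous (fun x => B1 x * A1 x)%C x)
      by (intros; apply continuous_Cmult; auto).
    assert (C2 : forall x, -1 <= x <= L -> continuous (fun x => B2 x * A2 x)%C x)
      by (intros; apply continuous_Cmult; auto).
    assert (C3 : forall x, - phi <= x <= phi -> continuous (fun x => B3 x * A3 x)%C x)
      by (intros; apply continuous_Cmult; auto).
    apply continuous_Cplus; [apply continuous_Cplus|].
    - exact (ex_derive_continuous_C _ _ _ (is_derive_CInt_Cexp _ B1 (-1) L t ab C1 CB1)).
    - exact (ex_derive_continuous_C _ _ _ (is_derive_CInt_Cexp _ B2 (-1) L t ab C2 CB2)).
    - exact (ex_derive_continuous_C _ _ _ (is_derive_CInt_Cexp _ B3 (- phi) phi t cd C3 CB3)). }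
  assert (EQ : forall t, (- (Q1 t + Q2 t + Q3 t))%C = (RtoC (exp (- t)) * contour phi (hankel_kernel z t) (-1) L)%C).
  { intros t.
    assert (K : forall w, Cexp w <> 1%C ->
      (Cexp (RtoC t * Bw w) * (Bw w * pk w))%C = (- RtoC (exp (- t)) * hankel_kernel z t w)%C).
    { intros w Hw; unfold Bw, pk, pole_kernel, hankel_kernel.
      assert (N1 : (1 - Cexp w)%C <> 0%C) by (intros E; apply Hw; symmetry; apply Ceq_minus; exact E).
      replace (RtoC t * (Cexp w - 1))%C with (RtoC (- t) + RtoC t * Cexp w)%C by (rewrite RtoC_opp; ring).
      rewrite Cexp_plus.
      replace (Cexp (RtoC (- t))) with (RtoC (exp (- t)))
        by (unfold Cexp, RtoC; simpl; rewrite cos_0, sin_0; f_equal; ring).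
      field; exact N1. }
    assert (I : forall y a b, CIntegrable (fun u => hankel_kernel z t (u, y)) a b).
    { intros; apply (CIntegrable_on_line (hankel_kernel z t)); intros; apply holo_hankel_kernel. }
    assert (E1 : Q1 t = (- RtoC (exp (- t)) * hint (hankel_kernel z t) phi (-1) L)%C).
    { unfold Q1, hint; rewrite <- CInt_Cmult by apply I.
      apply CInt_ext; intros x _; unfold B1, A1; apply K, Cexp_neq_1; [exact Ap|right; lra]. }
    assert (E2 : Q2 t = (RtoC (exp (- t)) * hint (hankel_kernel z t) (- phi) (-1) L)%C).
    { unfold Q2, hint; rewrite <- CInt_Cmult by apply I.
      apply CInt_ext; intros x _; unfold B2, A2.
      transitivity (- (Cexp (RtoC t * Bw (x, (- phi)%R)) * (Bw (x, (- phi)%R) * pk (x, (- phi)%R))))%C; [ring|].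
      rewrite K; [ring|apply Cexp_neq_1; [exact Am|right; lra]]. }
    assert (E3 : Q3 t = (Ci * (- RtoC (exp (- t)) * vint (hankel_kernel z t) (-1) (- phi) phi))%C).
    { unfold Q3, vint.
      assert (I3 : CIntegrable (fun v => hankel_kernel z t ((-1)%R, v)) (- phi) phi).
      { apply CIntegrable_continuous; intros; apply (continuous_vline (hankel_kernel z t)), holo_continuous, holo_hankel_kernel. }
      rewrite <- (CInt_Cmult _ _ _ _ I3), <- (CInt_Cmult _ _ _ _ (CIntegrable_Cmult _ _ _ _ I3)).
      apply CInt_ext; intros x Hx; rewrite Rmin_left, Rmax_right in Hx by lra; unfold B3, A3.
      transitivity (Ci * (Cexp (RtoC t * Bw ((-1)%R, x)) * (Bw ((-1)%R, x) * pk ((-1)%R, x))))%C; [ring|].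
      rewrite K; [reflexivity|apply Cexp_neq_1; [apply Rabs_def1; lra|left; lra]]. }
    rewrite E1, E2, E3; unfold contour; ring. }
  exists Psi; split; [|split; [|split]].
  - intros e T He.
    replace (Psi e - Psi T)%C with (minus (G := C_AbelianGroup) (- Psi T)%C (- Psi e)%C)
      by (change (- Psi T + - - Psi e = Psi e - Psi T)%C; ring).
    apply (is_RInt_ext (V := C_R_NormedModule) (fun t => - (Q1 t + Q2 t + Q3 t))%C).
    { intros t Ht; rewrite Rmin_left, Rmax_right in Ht by lra.
      rewrite EQ, contour_hankel_scale by lra.
      unfold gamma_integrand; rewrite RtoC_mult.
      eqC; ring. }
    apply (is_RInt_derive (V := C_R_CompleteNormedModule) (fun t => - Psi t)%C).
    + intros t _; apply (is_derive_opp (V := C_R_NormedModule) Psi), D.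
    + intros t _; apply CQ.
  - eapply ex_derive_continuous_C, D.
  (* At t = 0 the exponential is 1, and what remains is the contour integral of [pole_kernel], a
     rectangle around the pole plus its right side. *)
  - rewrite <- (rect_int_pole_kernel (1 - z) (-1) L phi) by lra; fold pk.
    rewrite <- contour_rect_int; unfold Psi, P1, P2, P3, contour, hint, vint.
    assert (E0 : forall w, Cexp (RtoC 0 * w) = 1%C) by (intros; rewrite Cmult_0_l; apply Cexp_0).
    rewrite (CInt_ext _ A1 (-1) L) by (intros; rewrite E0; ring).
    rewrite (CInt_ext (fun x => Cexp (RtoC 0 * B2 x) * A2 x)%C (fun u => -(1) * pk (u, (- phi)%R))%C (-1) L)
      by (intros; rewrite E0; unfold A2; ring).
    rewrite (CInt_ext (fun x => Cexp (RtoC 0 * B3 x) * A3 x)%C A3 (- phi) phi) by (intros; rewrite E0; ring).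
    assert (J2 : CIntegrable (fun u => pk (u, (- phi)%R)) (-1) L).
    { apply (CIntegrable_hline pk); [lra|intros v Hv; apply Hpk; [exact Am|right; lra]]. }
    assert (J3 : CIntegrable (fun v => pk ((-1)%R, v)) (- phi) phi).
    { apply (CIntegrable_vline pk); [lra|intros v Hv; apply Hpk; [apply Rabs_def1; lra|left; lra]]. }
    unfold A1, A3; rewrite (CInt_Cmult _ _ _ _ J2), (CInt_Cmult _ _ _ _ J3); ring.
  (* The contour starts at Re w = -1 to pass to the left of the pole s = 1: Re s <= e^(-1) on the
     segment and Re s < 0 on the half-lines, so Re (s - 1) <= -q throughout. *)
  - set (q := 1 - exp (-1)).
    assert (q0 : 0 < q).
    { unfold q; assert (exp (-1) < exp 0) by (apply exp_increasing; lra); rewrite exp_0 in *; lra. }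
    assert (Hc := cos_neg_of phi Hphi); generalize (exp_pos (-1)); intros em1.
    destruct (Cmod_CInt_Cexp_le A1 B1 (-1) L q ab CA1 CB1) as [M1 HM1].
    { intros x _; change (exp x * cos phi + - 1 <= - q).
      assert (exp x * cos phi < 0) by (generalize (exp_pos x); intros; nra); unfold q; lra. }
    destruct (Cmod_CInt_Cexp_le A2 B2 (-1) L q ab CA2 CB2) as [M2 HM2].
    { intros x _; change (exp x * cos (- phi) + - 1 <= - q); rewrite cos_neg.
      assert (exp x * cos phi < 0) by (generalize (exp_pos x); intros; nra); unfold q; lra. }
    destruct (Cmod_CInt_Cexp_le A3 B3 (- phi) phi q cd CA3 CB3) as [M3 HM3].
    { intros x _; change (exp (-1) * cos x + - 1 <= - q).
      assert (exp (-1) * cos x <= exp (-1) * 1) by (apply Rmult_le_compat_l; [lra|apply COS_bound]).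
      unfold q; lra. }
    exists (M1 + M2 + M3), q; split; [exact q0|]; intros T HT.
    unfold Psi; eapply Rle_trans; [apply Cmod_triangle|].
    generalize (Cmod_triangle (P1 T) (P2 T)) (HM1 T HT) (HM2 T HT) (HM3 T HT); unfold P1, P2, P3; lra.
Qed.

Lemma exp_decay_small (K d eta : R) : 0 < d -> 0 < eta ->
  exists L0, 0 < L0 /\ forall L, L0 <= L -> K * exp (- (d * L)) <= eta.
Proof.
  intros Hd He.
  destruct (Rle_or_lt K 0) as [HK|HK].
  { exists 1; split; [lra|]; intros L _; generalize (exp_pos (- (d * L))); nra. }
  exists (Rmax 1 (- ln (eta / K) / d)); split; [generalize (Rmax_l 1 (- ln (eta / K) / d)); lra|].
  intros L HL.
  assert (P : 0 < eta / K) by (apply Rdiv_lt_0_compat; assumption).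
  assert (Q : - ln (eta / K) <= d * L).
  { assert (H : - ln (eta / K) / d <= L) by (generalize (Rmax_r 1 (- ln (eta / K) / d)); lra).
    apply Rmult_le_compat_l with (r := d) in H; [|lra].
    replace (d * (- ln (eta / K) / d)) with (- ln (eta / K)) in H by (field; lra); exact H. }
  apply Rle_trans with (K * (eta / K)); [|right; field; lra].
  apply Rmult_le_compat_l; [lra|].
  rewrite <- (exp_ln (eta / K)) by exact P; apply exp_le; lra.
Qed.

(** For L >= 1 one has e^L >= 2, hence |1 - e^w| >= e^L / 2 on the side. The closing side of the
    rectangle thus disappears as L grows. *)
Lemma vint_pole_kernel_le (phi z L : R) : 0 < phi -> 1 <= L ->
  Cmod (vint (pole_kernel (1 - z)) L (- phi) phi) <= 4 * phi * exp (- (z * L)).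
Proof.
  intros Hp HL.
  assert (E2 : 2 <= exp L).
  { generalize (exp_ineq1_le L); lra. }
  assert (Nz : forall v, exp L / 2 <= Cmod (1 - Cexp (L, v))%C).
  { intros v; generalize (Cmod_triangle (1 - Cexp (L, v))%C (-(1))%C).
    replace (1 - Cexp (L, v) + - (1))%C with (- Cexp (L, v))%C by ring.
    rewrite !Cmod_opp, Cmod_Cexp, Cmod_1; simpl; lra. }
  assert (Nz1 : forall v, (1 - Cexp (L, v))%C <> 0%C) by (intros v; apply Cmod_gt_0; generalize (Nz v); lra).
  replace (4 * phi * exp (- (z * L))) with ((phi - - phi) * (2 * exp (- (z * L)))) by ring.
  apply Cmod_CInt_le_const; [lra| |].
  - intros v _; unfold pole_kernel; rewrite Cmod_div by apply Nz1; rewrite Cmod_Cexp; simpl.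
    rewrite Rmult_0_l, Rminus_0_r.
    apply Rmult_le_reg_r with (Cmod (1 - Cexp (L, v))%C); [generalize (Nz v); lra|].
    unfold Rdiv; rewrite Rmult_assoc, Rinv_l, Rmult_1_r by (generalize (Nz v); lra).
    apply Rle_trans with (2 * exp (- (z * L)) * (exp L / 2)).
    + right; replace ((1 - z) * L) with (- (z * L) + L) by ring; rewrite exp_plus; field.
    + apply Rmult_le_compat_l; [generalize (exp_pos (- (z * L))); lra|apply Nz].
  - apply (CIntegrable_vline (pole_kernel (1 - z))); [lra|]; intros v _; apply holo_pole_kernel.
    intros E; apply (Nz1 v); rewrite E; ring.
Qed.

Lemma gamma_integrand_shift (z d t : R) :
  exp (- (d * ln t)) * gamma_integrand z t = gamma_integrand (z - d) t.
Proof.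
  unfold gamma_integrand, Rpower; rewrite <- Rmult_assoc, <- exp_plus; f_equal; f_equal; ring.
Qed.

Lemma Rle_of_forall_eta (x y C : R) : 0 < C -> (forall eta, 0 < eta -> x <= y + C * eta) -> x <= y.
Proof.
  intros HC H; apply Rnot_lt_le; intros P.
  specialize (H ((x - y) / (2 * C)) ltac:(apply Rdiv_lt_0_compat; lra)).
  replace (C * ((x - y) / (2 * C))) with ((x - y) / 2) in H by (field; lra); lra.
Qed.

(** Let C(L) be the contour integral at t = 1. The product Gamma(z) C(L) is compared with the
    integral of t^(z-1) e^(-t) C(L' + ln t), which is close to 2 PI i by [hankel_laplace]. The
    Cauchy estimate bounds the difference by K (e^(-dL) Gamma(z) + e^(-dL') Gamma(z - d)), and L' ->
    oo leaves the stated rate. *)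
Theorem hankel_bound (phi z : R) : PI / 2 < phi < PI -> 0 < z ->
  exists K d, 0 < d /\ forall L,
    Cmod (contour phi (hankel_kernel z 1) 0 L * RtoC (Gamma z) - RtoC (2 * PI) * Ci)%C <= K * exp (- (d * L)).
Proof.
  intros Hphi Hz.
  (* With kappa = 1 - mz > 0 the rate is d = z - mz > 0, and z - d = mz is still positive, so that
     Gamma(z - d) is finite. *)
  set (mz := Rmin z 1 / 2).
  assert (Hm : 0 < mz /\ mz < z /\ mz < 1).
  { unfold mz; generalize (Rmin_l z 1) (Rmin_r z 1) (Rmin_pos z 1 Hz Rlt_0_1); lra. }
  destruct (contour_hankel_cauchy phi z (1 - mz) Hphi) as (K & K0 & HK); [lra|lra|].
  set (d := 1 - mz + z - 1) in HK.
  assert (Hd : 0 < d) by (unfold d; lra).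
  set (C0 := contour phi (hankel_kernel z 1) 0) in *.
  exists (K * Gamma z), d; split; [exact Hd|]; intros L.
  (* Five errors of size eta: the truncation of Euler's integral, the comparison with L', [Psi] near
     0, [Psi] at T, and the closing side of the rectangle. *)
  apply (Rle_of_forall_eta _ _ 5); [lra|]; intros eta He.
  assert (Gz := Gamma_pos z Hz).
  assert (Gd := Gamma_pos (z - d) ltac:(unfold d; lra)).
  destruct (exp_decay_small (K * Gamma (z - d)) d eta Hd He) as (L1 & L10 & HL1).
  destruct (exp_decay_small (4 * phi) z eta Hz He) as (L2 & L20 & HL2).
  set (L' := Rmax 1 (Rmax L1 L2)).
  assert (M1 : 1 <= L') by apply Rmax_l.
  assert (M2 : L1 <= L') by (eapply Rle_trans; [apply Rmax_l|apply Rmax_r]).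
  assert (M3 : L2 <= L') by (eapply Rle_trans; [apply Rmax_r|apply Rmax_r]).
  specialize (HL1 L' M2); specialize (HL2 L' M3).
  assert (V := vint_pole_kernel_le phi z L' ltac:(generalize PI_RGT_0; lra) M1).
  destruct (hankel_laplace phi z L' Hphi ltac:(lra)) as (Psi & PI1 & PC & P0 & M & q & Hq & PT).
  fold C0 in PI1.
  set (c := C0 L).
  assert (Cc : 0 < Cmod c + 1) by (generalize (Cmod_ge_0 c); lra).
  destruct (proj2 (Gamma_lub z Hz) (eta / (Cmod c + 1))) as (a0 & b0 & Hab0 & HG);
    [apply Rdiv_lt_0_compat; assumption|].
  assert (He2 : 0 < eta / 2) by lra.
  destruct (proj1 (filterlim_locally _ _) PC (mkposreal _ He2)) as [e0 He0].
  destruct (exp_decay_small M q eta Hq He) as (T0 & T00 & HT0).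
  set (e := Rmin a0 (e0 / 2)); set (T := Rmax b0 T0).
  assert (e_pos : 0 < e) by (apply Rmin_pos; [lra|generalize (cond_pos e0); lra]).
  assert (e1 : e <= a0) by apply Rmin_l.
  assert (e2 : e <= e0 / 2) by apply Rmin_r.
  assert (T1 : b0 <= T) by apply Rmax_l.
  assert (T2 : T0 <= T) by apply Rmax_r.
  assert (eT : 0 < e <= T) by lra.
  specialize (HG e T (conj e_pos e1) T1).
  assert (GU := proj1 (Gamma_lub z Hz) e T eT).
  assert (GUd := proj1 (Gamma_lub (z - d) ltac:(unfold d; lra)) e T eT).
  specialize (PI1 e T eT); specialize (PT T ltac:(lra)); specialize (HT0 T T2).
  set (X := RInt (gamma_integrand z) e T : R) in *.
  assert (IX : is_RInt (gamma_integrand z) e T X)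
    by (apply (RInt_correct (V := R_CompleteNormedModule)), ex_RInt_gamma_integrand; lra).
  assert (IXd : is_RInt (gamma_integrand (z - d)) e T (RInt (gamma_integrand (z - d)) e T))
    by (apply (RInt_correct (V := R_CompleteNormedModule)), ex_RInt_gamma_integrand; lra).
  assert (S1 : Cmod (c * RtoC X - (Psi e - Psi T))%C <= K * exp (- (d * L)) * Gamma z + eta).
  { assert (I1 := is_RInt_minus (V := C_R_NormedModule) _ _ _ _ _ _
      (is_RInt_Cmult c _ _ _ _ (CInt_RtoC _ _ _ _ IX)) PI1).
    assert (I2 := is_RInt_plus (V := R_NormedModule) _ _ _ _ _ _
      (is_RInt_scal (V := R_NormedModule) _ _ _ (K * exp (- (d * L))) _ IX)
      (is_RInt_scal (V := R_NormedModule) _ _ _ (K * exp (- (d * L'))) _ IXd)).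
    rewrite Cmod_norm.
    eapply Rle_trans; [refine (norm_RInt_le (V := C_R_NormedModule) _ _ e T _ _ _ _ I1 I2); [lra|]|].
    - intros t Ht.
      change (norm (V := prod_NormedModule R_AbsRing R_NormedModule R_NormedModule)
        (c * RtoC (gamma_integrand z t) - RtoC (gamma_integrand z t) * C0 (L' + ln t)%R)%C <=
        K * exp (- (d * L)) * gamma_integrand z t + K * exp (- (d * L')) * gamma_integrand (z - d) t).
      rewrite <- Cmod_norm.
      replace (c * RtoC (gamma_integrand z t) - RtoC (gamma_integrand z t) * C0 (L' + ln t)%R)%C with
        (RtoC (gamma_integrand z t) * (C0 L - C0 (L' + ln t)%R))%C by (unfold c; ring).
      assert (gp := gamma_integrand_pos z t).
      rewrite Cmod_mult, Cmod_R, Rabs_pos_eq by lra.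
      eapply Rle_trans; [apply Rmult_le_compat_l; [lra|apply HK]|].
      rewrite <- gamma_integrand_shift.
      replace (- (d * (L' + ln t))) with (- (d * L') + - (d * ln t)) by ring.
      rewrite exp_plus; right; ring.
    - change (K * exp (- (d * L)) * X + K * exp (- (d * L')) * RInt (gamma_integrand (z - d)) e T <=
        K * exp (- (d * L)) * Gamma z + eta).
      apply Rplus_le_compat.
      + apply Rmult_le_compat_l; [generalize (exp_pos (- (d * L))); nra|exact GU].
      + eapply Rle_trans; [|exact HL1].
        replace (K * Gamma (z - d) * exp (- (d * L'))) with (K * exp (- (d * L')) * Gamma (z - d)) by ring.
        apply Rmult_le_compat_l; [generalize (exp_pos (- (d * L'))); nra|exact GUd]. }
  assert (S2 : Cmod (c * RtoC (Gamma z - X))%C <= eta).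
  { rewrite Cmod_mult, Cmod_R, Rabs_pos_eq by lra.
    apply Rle_trans with ((Cmod c + 1) * (eta / (Cmod c + 1))); [|right; field; lra].
    generalize (Cmod_ge_0 c); intros; apply Rmult_le_compat; lra. }
  assert (S3 : Cmod (Psi e - Psi 0)%C <= eta).
  { apply Rlt_le; replace eta with (2 * (eta / 2)) by field.
    apply (Cmod_lt_of_ball (Psi 0) (Psi e) (mkposreal _ He2)), He0.
    change (Rabs (e - 0) < e0); rewrite Rminus_0_r, Rabs_pos_eq by lra; generalize (cond_pos e0); lra. }
  assert (S4 : Cmod (Psi 0%R - RtoC (2 * PI) * Ci)%C <= eta).
  { rewrite P0.
    replace (RtoC (2 * PI) * Ci + Ci * vint (pole_kernel (1 - z)) L' (- phi) phi - RtoC (2 * PI) * Ci)%C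
      with (Ci * vint (pole_kernel (1 - z)) L' (- phi) phi)%C by ring.
    rewrite Cmod_mult, Cmod_Ci; lra. }
  replace (c * RtoC (Gamma z) - RtoC (2 * PI) * Ci)%C with
    (c * RtoC (Gamma z - X) + (c * RtoC X - (Psi e - Psi T)) + (Psi e - Psi 0%R) + - Psi T
     + (Psi 0%R - RtoC (2 * PI) * Ci))%C by (rewrite RtoC_minus; ring).
  generalize (Cmod_triangle (c * RtoC (Gamma z - X) + (c * RtoC X - (Psi e - Psi T)) + (Psi e - Psi 0%R) + - Psi T)%C
     (Psi 0%R - RtoC (2 * PI) * Ci)%C)
    (Cmod_triangle (c * RtoC (Gamma z - X) + (c * RtoC X - (Psi e - Psi T)) + (Psi e - Psi 0%R))%C (- Psi T)%C)
    (Cmod_triangle (c * RtoC (Gamma z - X) + (c * RtoC X - (Psi e - Psi T)))%C (Psi e - Psi 0%R)%C)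
    (Cmod_triangle (c * RtoC (Gamma z - X))%C (c * RtoC X - (Psi e - Psi T))%C).
  rewrite Cmod_opp; lra.
Qed.

(** * Mittag-Leffler sums *)

(** The sum runs over m < n, whereas [sum_n u n] includes the term of index n. *)
Fixpoint Csum (f : nat -> C) (n : nat) : C :=
  match n with O => 0%C | S n => (Csum f n + f n)%C end.

Lemma Csum_ext (f g : nat -> C) (n : nat) : (forall m, (m < n)%nat -> f m = g m) -> Csum f n = Csum g n.
Proof.
  induction n as [|n IH]; intros H; [reflexivity|]; simpl.
  rewrite IH, H; auto.
Qed.

Lemma Csum_Cmult (c : C) (f : nat -> C) (n : nat) : (c * Csum f n)%C = Csum (fun m => c * f m)%C n.
Proof. induction n as [|n IH]; simpl; [ring|rewrite <- IH; ring]. Qed.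

Lemma Csum_minus (f g : nat -> C) (n : nat) : (Csum f n - Csum g n)%C = Csum (fun m => f m - g m)%C n.
Proof. induction n as [|n IH]; simpl; [ring|rewrite <- IH; ring]. Qed.

Definition on_contour (phi : R) (N : C -> C) (a : R) : Prop :=
  on_lines phi N /\ forall v, - phi <= v <= phi -> holo N (a, v).

Lemma entire_on_contour (phi : R) (N : C -> C) (a : R) : (forall w, holo N w) -> on_contour phi N a.
Proof. intros H; split; [intros u; split; apply H|intros; apply H]. Qed.

Lemma contour_plus (phi : R) (N M : C -> C) (a L : R) : 0 <= phi ->
  on_contour phi N a -> on_contour phi M a ->
  contour phi (fun w => N w + M w)%C a L = (contour phi N a L + contour phi M a L)%C.
Proof.
  intros Hp HN HM.
  assert (I1 : forall F : C -> C, on_contour phi F a -> forall x x', CIntegrable (fun u => F (u, phi)) x x').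
  { intros F HF x x'; apply (CIntegrable_on_line F); intros u; exact (proj1 (proj1 HF u)). }
  assert (I2 : forall F : C -> C, on_contour phi F a -> forall x x', CIntegrable (fun u => F (u, - phi)) x x').
  { intros F HF x x'; apply (CIntegrable_on_line F); intros u; exact (proj2 (proj1 HF u)). }
  assert (J : forall F : C -> C, on_contour phi F a -> CIntegrable (fun u => F (a, u)) (- phi) phi).
  { intros F HF; apply (CIntegrable_vline F); [lra|apply HF]. }
  unfold contour, hint, vint.
  rewrite (CInt_plus _ _ _ _ (I1 N HN a L) (I1 M HM a L)).
  rewrite (CInt_plus _ _ _ _ (I2 N HN a L) (I2 M HM a L)).
  rewrite (CInt_plus _ _ _ _ (J N HN) (J M HM)); ring.
Qed.

Lemma contour_ext (phi : R) (N M : C -> C) (a L : R) : (forall w, N w = M w) ->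
  contour phi N a L = contour phi M a L.
Proof.
  intros H; unfold contour, hint, vint; f_equal; [f_equal|f_equal]; apply CInt_ext; intros; apply H.
Qed.

Lemma contour_Cmult (phi : R) (c : C) (N : C -> C) (a L : R) : 0 <= phi -> on_contour phi N a ->
  contour phi (fun w => c * N w)%C a L = (c * contour phi N a L)%C.
Proof.
  intros Hp HN.
  assert (I1 : CIntegrable (fun u => N (u, phi)) a L).
  { apply (CIntegrable_on_line N); intros u; exact (proj1 (proj1 HN u)). }
  assert (I2 : CIntegrable (fun u => N (u, - phi)) a L).
  { apply (CIntegrable_on_line N); intros u; exact (proj2 (proj1 HN u)). }
  assert (J : CIntegrable (fun u => N (a, u)) (- phi) phi).
  { apply (CIntegrable_vline N); [lra|apply HN]. }
  unfold contour, hint, vint.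
  rewrite (CInt_Cmult _ _ _ _ I1), (CInt_Cmult _ _ _ _ I2), (CInt_Cmult _ _ _ _ J); ring.
Qed.

Lemma holo_Csum (f : nat -> C -> C) (n : nat) (w : C) : (forall m, holo (f m) w) ->
  holo (fun w => Csum (fun m => f m w) n) w.
Proof.
  intros H; induction n as [|n IH]; cbn [Csum]; [apply holo_const|].
  exact (holo_plus (fun w => Csum (fun m => f m w) n) (f n) w IH (H n)).
Qed.

Lemma contour_Csum (phi : R) (c : nat -> C) (f : nat -> C -> C) (n : nat) (a L : R) : 0 <= phi ->
  (forall m w, holo (f m) w) ->
  contour phi (fun w => Csum (fun m => c m * f m w)%C n) a L = Csum (fun m => c m * contour phi (f m) a L)%C n.
Proof.
  intros Hp H.
  assert (Hm : forall m w, holo (fun w => c m * f m w)%C w).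
  { intros m w; apply holo_mult; [apply holo_const|apply H]. }
  induction n as [|n IH]; simpl.
  - unfold contour, hint, vint; rewrite !CInt_const; ring.
  - rewrite (contour_plus phi (fun w => Csum (fun m => c m * f m w)%C n) (fun w => c n * f n w)%C); [|exact Hp| |].
    + rewrite IH, contour_Cmult; [reflexivity|exact Hp|apply entire_on_contour, H].
    + apply entire_on_contour; intros w; apply (holo_Csum (fun m w => c m * f m w)%C); intros; apply Hm.
    + apply entire_on_contour, Hm.
Qed.

Lemma Cmod_contour_le (phi : R) (N : C -> C) (a L : R) (g : R -> R) (G M : R) : 0 <= phi -> a <= L ->
  on_lines phi N -> (forall v, - phi <= v <= phi -> holo N (a, v)) ->
  (forall u, a <= u <= L -> Cmod (N (u, phi)) <= g u) ->
  (forall u, a <= u <= L -> Cmod (N (u, - phi)) <= g u) ->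
  is_RInt g a L G ->
  (forall v, - phi <= v <= phi -> Cmod (N (a, v)) <= M) ->
  Cmod (contour phi N a L) <= 2 * G + 2 * phi * M.
Proof.
  intros Hp aL Hl Ha H1 H2 HG HM.
  assert (EG : ex_RInt g a L) by (exists G; exact HG).
  assert (UG := is_RInt_unique _ _ _ _ HG).
  assert (B1 : Cmod (hint N phi a L) <= G).
  { rewrite <- UG; apply Cmod_CInt_le; auto; apply (CIntegrable_on_line N); intros u; exact (proj1 (Hl u)). }
  assert (B2 : Cmod (hint N (- phi) a L) <= G).
  { rewrite <- UG; apply Cmod_CInt_le; auto; apply (CIntegrable_on_line N); intros u; exact (proj2 (Hl u)). }
  assert (B3 : Cmod (vint N a (- phi) phi) <= (phi - - phi) * M).
  { apply Cmod_CInt_le_const; [lra|exact HM|apply (CIntegrable_vline N); [lra|exact Ha]]. }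
  unfold contour, Cminus; eapply Rle_trans; [apply Cmod_triangle|].
  rewrite Cmod_mult, Cmod_Ci, Rmult_1_l.
  generalize (Cmod_triangle (hint N phi a L) (- hint N (- phi) a L)%C); rewrite Cmod_opp; lra.
Qed.

Lemma is_derive_line (P : C -> C) (x y : R) (l : C) :
  is_derive (K := C_AbsRing) (V := AbsRing_NormedModule C_AbsRing) P (x, y) l ->
  is_derive (K := R_AbsRing) (V := C_R_NormedModule) (fun u => P (u, y)) x l /\
  is_derive (K := R_AbsRing) (V := C_R_NormedModule) (fun v => P (x, v)) y (Ci * l)%C.
Proof.
  intros [_ H].
  assert (E : forall eps : posreal, exists d : posreal, forall h : C, Cmod h < d ->
    Cmod (P ((x, y) + h)%C - P (x, y) - h * l)%C <= eps * Cmod h).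
  { intros eps; destruct (H (x, y) (fun Q HQ => HQ) eps) as [d Hd]; exists d; intros h Hh.
    assert (Z : (((x, y) + h) - (x, y))%C = h) by (change (@eq C (((x, y) + h) - (x, y))%C h); ring).
    assert (Bh : Cmod (((x, y) + h) - (x, y))%C < d) by (rewrite Z; exact Hh).
    specialize (Hd ((x, y) + h)%C Bh).
    change (Cmod (P ((x, y) + h)%C - P (x, y) - (((x, y) + h) - (x, y)) * l)%C <=
      eps * Cmod (((x, y) + h) - (x, y))%C) in Hd.
    rewrite Z in Hd; exact Hd. }
  split; (split; [apply is_linear_scal_l|]); intros t Ht eps.
  - assert (E0 : x = t) by exact (is_filter_lim_locally_unique (V := R_NormedModule) x t Ht); subst t.
    destruct (E eps) as [d Hd]; exists d; intros u Hu; change R in u; change (Rabs (u - x) < d) in Hu.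
    change (norm (V := prod_NormedModule R_AbsRing R_NormedModule R_NormedModule)
      (P (u, y) - P (x, y) - scal (V := C_R_ModuleSpace) (u - x)%R l)%C <= eps * Rabs (u - x)).
    rewrite scal_R_Cmult, <- Cmod_norm.
    specialize (Hd (RtoC (u - x))); rewrite Cmod_R in Hd; specialize (Hd Hu).
    replace ((x, y) + RtoC (u - x))%C with ((u, y) : C) in Hd
      by (unfold Cplus, RtoC; simpl; f_equal; ring).
    exact Hd.
  - assert (E0 : y = t) by exact (is_filter_lim_locally_unique (V := R_NormedModule) y t Ht); subst t.
    destruct (E eps) as [d Hd]; exists d; intros u Hu; change R in u; change (Rabs (u - y) < d) in Hu.
    change (norm (V := prod_NormedModule R_AbsRing R_NormedModule R_NormedModule)
      (P (x, u) - P (x, y) - scal (V := C_R_ModuleSpace) (u - y)%R (Ci * l))%C <= eps * Rabs (u - y)).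
    rewrite scal_R_Cmult, <- Cmod_norm.
    specialize (Hd (Ci * RtoC (u - y))%C); rewrite Cmod_mult, Cmod_Ci, Rmult_1_l, Cmod_R in Hd; specialize (Hd Hu).
    replace ((x, y) + Ci * RtoC (u - y))%C with ((x, u) : C) in Hd
      by (unfold Cplus, Cmult, Ci, RtoC; simpl; f_equal; ring).
    replace (RtoC (u - y) * (Ci * l))%C with (Ci * RtoC (u - y) * l)%C by ring.
    exact Hd.
Qed.

(** The fundamental theorem holds on each of the three pieces, and the values at the two left
    corners cancel. *)
Lemma contour_of_derivative (phi : R) (P p : C -> C) (a L : R) :
  (forall w, is_derive (K := C_AbsRing) (V := AbsRing_NormedModule C_AbsRing) P w (p w)) ->
  (forall w, holo p w) ->
  contour phi p a L = (P (L, phi) - P (L, (- phi)%R))%C.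
Proof.
  intros HP Hp; unfold contour, hint, vint.
  rewrite (CInt_derive (fun u => P (u, phi)) (fun u => p (u, phi))).
  2: intros; apply is_derive_line, HP.
  2: intros; apply (continuous_hline p), holo_continuous, Hp.
  rewrite (CInt_derive (fun u => P (u, (- phi)%R)) (fun u => p (u, (- phi)%R))).
  2: intros; apply is_derive_line, HP.
  2: intros; apply (continuous_hline p), holo_continuous, Hp.
  rewrite <- CInt_Cmult.
  2: apply CIntegrable_continuous; intros; apply (continuous_vline p), holo_continuous, Hp.
  rewrite (CInt_derive (fun v => P (a, v)) (fun v => Ci * p (a, v))%C).
  2: intros; apply (is_derive_line P), HP.
  2: intros; apply (continuous_vline (fun w => Ci * p w)%C), holo_continuous, holo_mult; [apply holo_const|apply Hp].
  ring.
Qed.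


(** For alpha < 1 this is [hankel_bound] divided by Gamma(1 - alpha). For alpha = 1 the kernel e^w
    e^(e^w) is the derivative of e^(e^w), which tends to 0 along both half-lines; this is the value
    that the convention 1 / Gamma(0) = 0 prescribes. *)
Lemma hankel_limit (phi alpha eta : R) : PI / 2 < phi < PI -> alpha <= 1 -> 0 < eta ->
  exists L0, 0 < L0 /\ forall L, L0 <= L ->
    Cmod (contour phi (hankel_kernel (1 - alpha) 1) 0 L
          - RtoC (2 * PI) * Ci * RtoC (inv_Gamma (1 - alpha)))%C <= eta.
Proof.
  intros Hphi Ha He; unfold inv_Gamma; destruct Req_EM_T as [E|E].
  - rewrite E.
    assert (Hc := cos_neg_of phi Hphi).
    destruct (exp_neg_exp_le (- cos phi) 1) as (K & K0 & HK); [lra|lra|].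
    destruct (exp_decay_small (2 * K) 1 eta Rlt_0_1 He) as (L0 & L00 & HL0).
    exists L0; split; [exact L00|]; intros L HL; specialize (HL0 L HL).
    rewrite (contour_of_derivative phi (fun w => Cexp (Cexp w))).
    + replace (Cexp (Cexp (L, phi)) - Cexp (Cexp (L, (- phi)%R)) - RtoC (2 * PI) * Ci * RtoC 0)%C
        with (Cexp (Cexp (L, phi)) + - Cexp (Cexp (L, (- phi)%R)))%C by ring.
      eapply Rle_trans; [apply Cmod_triangle|]; rewrite Cmod_opp, !Cmod_Cexp; simpl; rewrite cos_neg.
      specialize (HK L); replace (- (- cos phi * exp L)) with (exp L * cos phi) in HK by ring; lra.
    + intros w.
      replace (hankel_kernel 0 1 w) with (Cexp w * Cexp (Cexp w))%C.
      2: { unfold hankel_kernel; rewrite Rminus_0_r, !Cmult_1_l; ring. }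
      apply (is_derive_comp (V := AbsRing_NormedModule C_AbsRing) Cexp Cexp); apply is_derive_Cexp.
    + intros; apply holo_hankel_kernel.
  - assert (Hz : 0 < 1 - alpha) by lra.
    assert (G := Gamma_pos _ Hz).
    destruct (hankel_bound phi (1 - alpha) Hphi Hz) as (K & d & Hd & HK).
    destruct (exp_decay_small (K / Gamma (1 - alpha)) d eta Hd He) as (L0 & L00 & HL0).
    exists L0; split; [exact L00|]; intros L HL; specialize (HL0 L HL); specialize (HK L).
    eapply Rle_trans; [|exact HL0].
    apply Rmult_le_reg_r with (Gamma (1 - alpha)); [exact G|].
    replace (K / Gamma (1 - alpha) * exp (- (d * L)) * Gamma (1 - alpha)) with (K * exp (- (d * L))) by (field; lra).
    eapply Rle_trans; [|exact HK]; right.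
    transitivity (Cmod (contour phi (hankel_kernel (1 - alpha) 1) 0 L
          - RtoC (2 * PI) * Ci * RtoC (/ Gamma (1 - alpha)))%C * Cmod (RtoC (Gamma (1 - alpha)))).
    { f_equal; rewrite Cmod_R, Rabs_pos_eq; lra. }
    rewrite <- Cmod_mult; f_equal.
    rewrite RtoC_inv by lra; field; intros Z; apply (f_equal fst) in Z; simpl in Z; lra.
Qed.

(** With psi = arccos (Re z / |z|) the hypothesis says psi >= theta. The left side is Re (z e^(-i
    beta)), and a rotation by beta leaves the argument at least psi - |beta| in absolute value. *)
Lemma cos_arg_le (theta beta : R) (z : C) : 0 < theta <= PI -> Rabs beta < theta ->
  fst z <= Cmod z * cos theta ->
  fst z * cos beta + snd z * sin beta <= Cmod z * cos (theta - Rabs beta).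
Proof.
  intros Ht Hb Hz.
  destruct (Req_dec (Cmod z) 0) as [Z|Z].
  { apply Cmod_eq_0 in Z; subst z; rewrite Cmod_0; simpl; lra. }
  assert (P : 0 < Cmod z) by (generalize (Cmod_ge_0 z); lra).
  set (r := Cmod z) in *; set (c := fst z / r).
  assert (Ec : fst z = r * c) by (unfold c; field; lra).
  assert (Sq : fst z * fst z + snd z * snd z = r * r).
  { generalize (Cmod2_alt z); fold r; unfold Re, Im; intros H; simpl in H; nra. }
  assert (C1 : -1 <= c <= 1).
  { assert (r * r * (c * c) <= r * r * 1) by (rewrite Ec in Sq; nra).
    assert (c * c <= 1) by (apply Rmult_le_reg_l with (r * r); nra); nra. }
  assert (Hpsi := acos_bound c); assert (Epsi := cos_acos c C1).
  set (psi := acos c) in *.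
  assert (Tp : theta <= psi).
  { apply Rnot_lt_le; intros L.
    assert (cos theta < cos psi) by (apply cos_decreasing_1; lra).
    rewrite Ec, <- Epsi in Hz; apply Rmult_le_reg_l in Hz; lra. }
  assert (Hs : Rabs (snd z) = r * sin psi).
  { assert (S0 : 0 <= sin psi) by (apply sin_ge_0; lra).
    apply Rsqr_inj; [apply Rabs_pos|nra|].
    rewrite <- Rsqr_abs; generalize (sin2_cos2 psi); rewrite Epsi; unfold Rsqr; rewrite Ec in Sq; nra. }
  apply Rle_trans with (fst z * cos (Rabs beta) + Rabs (snd z) * sin (Rabs beta)).
  - assert (B0 := Rabs_pos beta).
    assert (S0 : 0 <= sin (Rabs beta)) by (apply sin_ge_0; lra).
    unfold Rabs at 1 3; destruct (Rcase_abs beta) as [N|N]; rewrite ?cos_neg, ?sin_neg;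
    unfold Rabs in S0; destruct (Rcase_abs beta); try lra; rewrite ?sin_neg in S0;
    generalize (Rle_abs (snd z)) (Rle_abs (- snd z)); rewrite Rabs_Ropp; nra.
  - rewrite Hs, Ec, <- Epsi.
    replace (r * cos psi * cos (Rabs beta) + r * sin psi * sin (Rabs beta)) with (r * cos (psi - Rabs beta))
      by (rewrite cos_minus; ring).
    apply Rmult_le_compat_l; [lra|].
    generalize (Rabs_pos beta); intros B0.
    destruct (Req_dec theta psi) as [->|Ne]; [lra|].
    left; apply cos_decreasing_1; lra.
Qed.

(* With [q = zeta * e^(- alpha w)], this keeps the pole [q = 1] away from the
   sector swept by the contour. *)
Lemma Cmod_1_sub_ge (theta delta : R) : 0 < delta <= theta -> theta <= PI ->
  exists kappa, 0 < kappa /\ forall (z : C) (s beta : R),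
    fst z <= Cmod z * cos theta -> Rabs beta <= theta - delta ->
    let q := (z * Cexp (s, (- beta)%R))%C in
    kappa * Rmax 1 (Cmod q) <= Cmod (1 - q)%C.
Proof.
  intros Hd Ht.
  set (c1 := Rmax (cos delta) 0).
  assert (Hc1 : 0 <= c1 < 1 /\ cos delta <= c1).
  { unfold c1; assert (cos delta < 1) by (rewrite <- cos_0; apply cos_decreasing_1; lra).
    split; [split; [apply Rmax_r|apply Rmax_lub_lt; lra]|apply Rmax_l]. }
  (* From Re q <= c1 r with r = |q| follows |1 - q|^2 >= 1 - 2 c1 r + r^2 = (1 - c1)(1 + r^2) + c1
     (1 - r)^2. The maximum with 0 in [c1] makes the last term non-negative. *)
  exists (sqrt (1 - c1)); split; [apply sqrt_lt_R0; lra|].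
  intros z s beta Hz Hb q.
  set (r := Cmod q).
  assert (r0 : 0 <= r) by apply Cmod_ge_0.
  assert (Er : r = Cmod z * exp s) by (unfold r, q; rewrite Cmod_mult, Cmod_Cexp; reflexivity).
  assert (Rq : fst q <= r * c1).
  { assert (H := cos_arg_le theta beta z ltac:(lra) ltac:(lra) Hz).
    assert (H2 : cos (theta - Rabs beta) <= cos delta).
    { destruct (Req_dec delta (theta - Rabs beta)) as [<-|Ne]; [lra|].
      left; generalize (Rabs_pos beta); intros; apply cos_decreasing_1; lra. }
    replace (fst q) with (exp s * (fst z * cos beta + snd z * sin beta))
      by (unfold q, Cexp, Cmult; simpl; rewrite cos_neg, sin_neg; ring).
    rewrite Er; generalize (exp_pos s) (Cmod_ge_0 z); intros E0 Z0.
    replace (Cmod z * exp s * c1) with (exp s * (Cmod z * c1)) by ring.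
    apply Rmult_le_compat_l; [lra|]; eapply Rle_trans; [exact H|].
    apply Rmult_le_compat_l; lra. }
  assert (S1 : Cmod (1 - q)%C ^ 2 = 1 - 2 * fst q + r ^ 2).
  { unfold r; rewrite !Cmod2_alt; unfold Re, Im, Cminus, Cplus, Copp, RtoC; simpl; ring. }
  apply Rsqr_incr_0_var; [|apply Cmod_ge_0].
  rewrite Rsqr_mult, Rsqr_sqrt by lra; unfold Rsqr.
  replace (Cmod (1 - q)%C * Cmod (1 - q)%C) with (1 - 2 * fst q + r ^ 2) by (rewrite <- S1; ring).
  apply Rle_trans with ((1 - c1) * (1 + r * r)).
  2: { assert (0 <= c1 * ((1 - r) * (1 - r))) by (apply Rmult_le_pos; [lra|apply Rle_0_sqr]).
       replace (r ^ 2) with (r * r) by ring; lra. }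
  apply Rmult_le_compat_l; [lra|].
  fold r; unfold Rmax; destruct Rle_dec; nra.
Qed.

(* Partial sums of [sum a_m zeta^m / Gamma(alpha m + 1)]; [a_m = 1] gives the
   Mittag-Leffler function and [a_m = m] its Euler derivative. *)
Definition ml_sum (alpha : R) (a : nat -> R) (n : nat) (z : C) : C :=
  Csum (fun m => RtoC (a m / Gamma (alpha * INR m + 1)) * z ^ m)%C n.

(* [k] is the sum of [sum a_m q^m], continued to [q <> 1]. *)
Record generating (a : nat -> R) (sigma : R) (k : C -> C) : Prop := {
  gen_holo : forall q : C, q <> 1%C -> holo k q;
  gen_infty : forall kappa, 0 < kappa -> exists K, 0 <= K /\ forall q : C, q <> 0%C ->
    kappa * Rmax 1 (Cmod q) <= Cmod (1 - q)%C -> Cmod (k q + RtoC sigma / q)%C <= K / Cmod q ^ 2;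
  gen_sum : forall eta, 0 < eta -> exists n0, forall (n : nat) (q : C), (n0 <= n)%nat -> Cmod q <= / 2 ->
    Cmod (Csum (fun m => RtoC (a m) * q ^ m)%C n - k q)%C <= eta }.

Lemma hankel_kernel_pow (alpha : R) (m : nat) (w : C) :
  hankel_kernel (alpha * INR m + 1) 1 w = (Cexp (Cexp w) * Cexp (- (RtoC alpha * w)) ^ m)%C.
Proof.
  unfold hankel_kernel; rewrite Cmult_1_l, Cexp_pow; f_equal; f_equal.
  replace (1 - (alpha * INR m + 1)) with (- (alpha * INR m)) by ring.
  rewrite RtoC_opp, RtoC_mult; ring.
Qed.

Lemma INR_alpha_pos (alpha : R) (m : nat) : 0 < alpha -> 1 <= alpha * INR m + 1.
Proof. intros H; generalize (pos_INR m); nra. Qed.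

(** Each of the n terms is an instance of [hankel_bound]. The threshold depends on n and z, so L
    grows with n and z held fixed. *)
Lemma ml_sum_hankel (phi alpha : R) (a : nat -> R) (z : C) (n : nat) (eta : R) :
  PI / 2 < phi < PI -> 0 < alpha -> 0 < eta -> exists L0, forall L, L0 <= L ->
  Cmod (RtoC (2 * PI) * Ci * ml_sum alpha a n z
    - Csum (fun m => (RtoC (a m) * z ^ m) * contour phi (hankel_kernel (alpha * INR m + 1) 1) 0 L)%C n)%C <= eta.
Proof.
  intros Hphi Ha; revert eta; induction n as [|n IH]; intros eta He.
  - exists 0; intros L _; unfold ml_sum; simpl Csum.
    replace (RtoC (2 * PI) * Ci * 0 - 0)%C with (0 : C) by ring; rewrite Cmod_0; lra.
  - destruct (IH (eta / 2)) as [L1 HL1]; [lra|].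
    assert (Hz := INR_alpha_pos alpha n Ha); set (s := alpha * INR n + 1) in *.
    assert (G := Gamma_pos s ltac:(lra)).
    destruct (hankel_bound phi s Hphi ltac:(lra)) as (K & d & Hd & HK).
    set (A := Cmod (RtoC (a n / Gamma s) * z ^ n)%C).
    destruct (exp_decay_small (A * K) d (eta / 2) Hd ltac:(lra)) as (L2 & L20 & HL2).
    exists (Rmax L1 L2); intros L HL.
    specialize (HL1 L ltac:(generalize (Rmax_l L1 L2); lra)).
    specialize (HL2 L ltac:(generalize (Rmax_r L1 L2); lra)); specialize (HK L).
    unfold ml_sum in *; simpl Csum; fold s.
    set (c := contour phi (hankel_kernel s 1) 0 L) in *.
    set (S := Csum (fun m => RtoC (a m / Gamma (alpha * INR m + 1)) * z ^ m)%C n) in *.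
    set (S' := Csum (fun m => (RtoC (a m) * z ^ m) * contour phi (hankel_kernel (alpha * INR m + 1) 1) 0 L)%C n) in *.
    replace (RtoC (2 * PI) * Ci * (S + RtoC (a n / Gamma s) * z ^ n) - (S' + RtoC (a n) * z ^ n * c))%C with
      ((RtoC (2 * PI) * Ci * S - S') + - ((RtoC (a n / Gamma s) * z ^ n) * (c * RtoC (Gamma s) - RtoC (2 * PI) * Ci)))%C.
    2: { rewrite RtoC_div by lra; field.
         intros Z; apply (f_equal fst) in Z; simpl in Z; lra. }
    eapply Rle_trans; [apply Cmod_triangle|]; rewrite Cmod_opp, Cmod_mult; fold A.
    assert (A * Cmod (c * RtoC (Gamma s) - RtoC (2 * PI) * Ci)%C <= A * (K * exp (- (d * L))))
      by (apply Rmult_le_compat_l; [apply Cmod_ge_0|exact HK]).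
    lra.
Qed.

(** The finite sum is a contour integral of entire kernels, so the contour may start at Re w = U,
    beyond which |q| <= 1/2. There the partial sums are replaced by k(q). Since k(q) is holomorphic
    in the swept strip, the start moves back to 0, and k(q) + sigma/q = O(|q|^-2) with |q| = |z|
    e^(-alpha u) gives K / |z|^2 with K free of z. The term sigma/q is sigma/z times the Hankel
    kernel of parameter 1 - alpha, whence 1 / Gamma(1 - alpha). *)
Theorem ml_sum_asymptotic (alpha theta sigma : R) (a : nat -> R) (k : C -> C) :
  0 < alpha <= 1 -> PI * alpha / 2 < theta <= PI -> generating a sigma k ->
  exists K, 0 <= K /\ forall z : C, fst z <= Cmod z * cos theta -> 1 <= Cmod z ->
    forall eta, 0 < eta -> exists n0, forall n, (n0 <= n)%nat ->
    Cmod (ml_sum alpha a n z + RtoC (sigma * inv_Gamma (1 - alpha)) / z)%C <= K / Cmod z ^ 2 + eta.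
Proof.
  intros Ha Ht [Hk1 Hk2 Hk3].
  assert (Pi0 := PI_RGT_0).
  (* phi must exceed PI/2 for decay along the half-lines, while alpha phi <= theta - delta keeps the
     argument of q at distance delta from 0; half of the available gap serves each purpose. *)
  set (delta := (theta - PI * alpha / 2) / 2).
  set (phi := PI / 2 + delta).
  assert (Hphi : PI / 2 < phi < PI) by (unfold phi, delta; nra).
  assert (Hd : 0 < delta <= theta) by (unfold delta; nra).
  assert (Hap : alpha * phi <= theta - delta) by (unfold phi, delta; nra).
  assert (Hc := cos_neg_of phi Hphi); set (c := - cos phi).
  assert (c0 : 0 < c) by (unfold c; lra).
  destruct (Cmod_1_sub_ge theta delta Hd (proj2 Ht)) as (kappa & Kp & Hkap).
  destruct (Hk2 kappa Kp) as (K2 & K20 & HK2).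
  (* |q|^-2 brings a growth e^(2 alpha u); the additional 1 leaves the integrable factor e^(-u). *)
  destruct (exp_neg_exp_le c (2 * alpha + 1) c0) as (K & K0 & HK); [lra|].
  destruct (exp_neg_exp_le c 1 c0 Rlt_0_1) as (K' & K'0 & HK').
  set (C1 := 2 * (K2 * K) + 2 * phi * (K2 * exp 1)).
  assert (C10 : 0 <= C1).
  { assert (0 <= K2 * K) by (apply Rmult_le_pos; lra).
    assert (0 <= phi * (K2 * exp 1)).
    { apply Rmult_le_pos; [lra|apply Rmult_le_pos; [lra|apply Rlt_le, exp_pos]]. }
    unfold C1; lra. }
  exists C1; split; [exact C10|]; intros z Hz z1 eta0 He0.
  assert (sg := Rabs_pos sigma).
  (* Two errors have size eta; the third, from the limit of the Hankel integral, is multiplied by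
     |sigma| / |z| <= |sigma|. *)
  set (eta := eta0 / (2 + Rabs sigma)).
  assert (He : 0 < eta) by (apply Rdiv_lt_0_compat; lra).
  assert (Eeta : eta0 = 2 * eta + Rabs sigma * eta) by (unfold eta; field; lra).
  assert (Nz : z <> 0%C) by (apply Cmod_gt_0; lra).
  set (q := fun w : C => (z * Cexp (- (RtoC alpha * w)))%C).
  set (N := fun w : C => (Cexp (Cexp w) * k (q w))%C).
  assert (Eaw : forall u v : R, (- (RtoC alpha * (u, v)))%C = ((- (alpha * u))%R, (- (alpha * v))%R)).
  { intros u v; unfold Copp, Cmult, RtoC; simpl; f_equal; ring. }
  assert (Cq : forall u v, Cmod (q (u, v)) = Cmod z * exp (- (alpha * u))).
  { intros u v; unfold q; rewrite Cmod_mult, Eaw, Cmod_Cexp; reflexivity. }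
  assert (Q0 : forall w, q w <> 0%C) by (intros; apply Cmult_neq_0; [exact Nz|apply Cexp_neq_0]).
  assert (Q1 : forall u v, - phi <= v <= phi -> kappa * Rmax 1 (Cmod (q (u, v))) <= Cmod (1 - q (u, v))%C).
  { intros u v Hv; unfold q; rewrite Eaw; apply Hkap; [exact Hz|].
    eapply Rle_trans; [|exact Hap]; rewrite Rabs_mult, (Rabs_pos_eq alpha) by lra.
    apply Rmult_le_compat_l; [lra|apply Rabs_le; lra]. }
  assert (Q2 : forall u v, - phi <= v <= phi -> q (u, v) <> 1%C).
  { intros u v Hv E; generalize (Q1 u v Hv); rewrite E.
    replace (1 - 1)%C with (0 : C) by ring; rewrite Cmod_0.
    generalize (Rmax_l 1 (Cmod 1)); nra. }
  assert (Hq : forall w, holo q w).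
  { intros w; apply holo_mult; [apply holo_const|apply holo_Cexp, holo_opp, holo_mult; [apply holo_const|apply holo_id]]. }
  assert (HN : forall u v, - phi <= v <= phi -> holo N (u, v)).
  { intros u v Hv; apply holo_mult; [apply holo_Cexp, holo_Cexp_id|].
    exact (holo_comp k q (u, v) (Hk1 _ (Q2 u v Hv)) (Hq (u, v))). }
  assert (CE : forall u v, Cmod (Cexp (Cexp (u, v))) = exp (exp u * cos v)).
  { intros; rewrite Cmod_Cexp; reflexivity. }
  set (hk := hankel_kernel (1 - alpha) 1).
  assert (Ehk : forall w, (RtoC sigma / z * hk w)%C = (Cexp (Cexp w) * (RtoC sigma / q w))%C).
  { intros w; unfold hk, hankel_kernel, q.
    replace (1 - (1 - alpha)) with alpha by ring.
    assert (E := Cexp_opp_r (RtoC alpha * w)%C); rewrite Cmult_1_l.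
    assert (E1 := Cexp_neq_0 (- (RtoC alpha * w))%C).
    replace (Cexp (RtoC alpha * w)) with (/ Cexp (- (RtoC alpha * w)))%C; [field; auto|].
    transitivity (/ Cexp (- (RtoC alpha * w)) * (Cexp (RtoC alpha * w) * Cexp (- (RtoC alpha * w))))%C;
      [rewrite E; ring|field; exact E1]. }
  set (hs := fun w => (RtoC sigma / z * hk w)%C).
  assert (Hhs : forall w, holo hs w).
  { intros w; apply holo_mult; [apply holo_const|apply holo_hankel_kernel]. }
  assert (R1 : forall L, 0 <= L -> Cmod (contour phi (fun w => N w + hs w)%C 0 L) <= C1 / Cmod z ^ 2).
  { intros L HL.
    assert (PW : forall u v, - phi <= v <= phi ->
      Cmod (N (u, v) + hs (u, v))%C <= exp (exp u * cos v) * (K2 / Cmod z ^ 2 * exp (2 * alpha * u))).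
    { intros u v Hv; unfold N, hs; rewrite Ehk.
      replace (Cexp (Cexp (u, v)) * k (q (u, v)) + Cexp (Cexp (u, v)) * (RtoC sigma / q (u, v)))%C
        with (Cexp (Cexp (u, v)) * (k (q (u, v)) + RtoC sigma / q (u, v)))%C by ring.
      rewrite Cmod_mult, CE; apply Rmult_le_compat_l; [apply Rlt_le, exp_pos|].
      eapply Rle_trans; [apply HK2; [apply Q0|apply Q1, Hv]|].
      rewrite Cq; right.
      assert (E : exp (- (alpha * u)) ^ 2 * exp (2 * alpha * u) = 1).
      { simpl; rewrite Rmult_1_r, <- !exp_plus.
        replace (- (alpha * u) + - (alpha * u) + 2 * alpha * u) with 0 by ring; apply exp_0. }
      generalize (exp_pos (- (alpha * u))); intros.
      transitivity (K2 / (Cmod z * exp (- (alpha * u))) ^ 2 * (exp (- (alpha * u)) ^ 2 * exp (2 * alpha * u))).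
      - rewrite E; ring.
      - field; split; lra. }
    assert (PL : forall u v, cos v = cos phi -> - phi <= v <= phi ->
      Cmod (N (u, v) + hs (u, v))%C <= K2 * K / Cmod z ^ 2 * exp (- (1 * u))).
    { intros u v Ev Hv; eapply Rle_trans; [apply PW, Hv|]; rewrite Ev.
      specialize (HK u); replace (- (c * exp u)) with (exp u * cos phi) in HK by (unfold c; ring).
      apply Rle_trans with (K * exp (- ((2 * alpha + 1) * u)) * (K2 / Cmod z ^ 2 * exp (2 * alpha * u))).
      - apply Rmult_le_compat_r; [|exact HK].
        apply Rmult_le_pos; [apply Rdiv_le_0_compat; [exact K20|apply pow_lt; lra]|apply Rlt_le, exp_pos].
      - right; replace (- (1 * u)) with (- ((2 * alpha + 1) * u) + 2 * alpha * u) by ring.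
        rewrite exp_plus; field; lra. }
    eapply Rle_trans; [refine (Cmod_contour_le phi _ 0 L (fun u => K2 * K / Cmod z ^ 2 * exp (- (1 * u))) _
      (K2 * exp 1 / Cmod z ^ 2) _ HL _ _ _ _ (is_RInt_scal (V := R_NormedModule) _ _ _ (K2 * K / Cmod z ^ 2) _ (is_RInt_exp_lin 1 0 L R1_neq_R0)) _)|].
    - lra.
    - intros u; split; apply holo_plus; try apply Hhs; apply HN; lra.
    - intros v Hv; apply holo_plus; [apply HN, Hv|apply Hhs].
    - intros u _; apply PL; [reflexivity|lra].
    - intros u _; apply PL; [apply cos_neg|lra].
    - intros v Hv; eapply Rle_trans; [apply PW, Hv|].
      rewrite Rmult_0_r, exp_0, Rmult_1_r, Rmult_1_l.
      replace (K2 * exp 1 / Cmod z ^ 2) with (exp 1 * (K2 / Cmod z ^ 2)) by (field; lra).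
      apply Rmult_le_compat_r; [apply Rdiv_le_0_compat; [exact K20|apply pow_lt; lra]|].
      apply exp_le, COS_bound.
    - change (2 * (K2 * K / Cmod z ^ 2 * ((exp (- (1 * 0)) - exp (- (1 * L))) / 1)) +
        2 * phi * (K2 * exp 1 / Cmod z ^ 2) <= C1 / Cmod z ^ 2).
      rewrite Rmult_0_r, Ropp_0, exp_0.
      assert (X : 0 <= K2 * K / Cmod z ^ 2) by (apply Rdiv_le_0_compat; [nra|apply pow_lt; lra]).
      assert (Y : K2 * K / Cmod z ^ 2 * ((1 - exp (- (1 * L))) / 1) <= K2 * K / Cmod z ^ 2 * 1).
      { apply Rmult_le_compat_l; [exact X|]; generalize (exp_pos (- (1 * L))); lra. }
      unfold C1; replace ((2 * (K2 * K) + 2 * phi * (K2 * exp 1)) / Cmod z ^ 2) with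
        (2 * (K2 * K / Cmod z ^ 2) + 2 * phi * (K2 * exp 1 / Cmod z ^ 2)) by (field; lra).
      lra. }
  (* The value of u at which |q| = |z| e^(-alpha u) has dropped to 1/2. *)
  set (U := ln (2 * Cmod z) / alpha).
  assert (U0 : 0 <= U).
  { apply Rdiv_le_0_compat; [|lra]; rewrite <- ln_1; apply Rcomplements.ln_le; lra. }
  assert (QU : forall u v, U <= u -> Cmod (q (u, v)) <= / 2).
  { intros u v Hu; rewrite Cq.
    apply Rle_trans with (Cmod z * exp (- ln (2 * Cmod z))).
    - apply Rmult_le_compat_l; [lra|]; apply exp_le, Ropp_le_contravar.
      replace (ln (2 * Cmod z)) with (alpha * U) by (unfold U; field; lra).
      apply Rmult_le_compat_l; lra.
    - rewrite exp_Ropp, exp_ln by lra; right; field; lra. }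
  (* A bound for the integral of |e^(e^w)| over the contour from U, so that an error eta / BU in the
     generating function contributes at most eta. *)
  set (BU := 2 * K' + 2 * phi * exp (exp U)).
  assert (BU0 : 0 < BU) by (unfold BU; assert (0 < phi * exp (exp U)) by (apply Rmult_lt_0_compat; [lra|apply exp_pos]); lra).
  destruct (Hk3 (eta / BU)) as [n0 Hn0]; [apply Rdiv_lt_0_compat; assumption|].
  exists n0; intros n Hn.
  set (SN := fun w => Csum (fun m => (RtoC (a m) * z ^ m) * hankel_kernel (alpha * INR m + 1) 1 w)%C n).
  assert (ESN : forall w, SN w = (Cexp (Cexp w) * Csum (fun m => RtoC (a m) * q w ^ m) n)%C).
  { intros w; rewrite Csum_Cmult; apply Csum_ext; intros m _.
    rewrite hankel_kernel_pow; unfold q; rewrite Cpow_mult_l; ring. }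
  assert (HSN : forall w, holo SN w).
  { intros w; apply (holo_Csum (fun m w => (RtoC (a m) * z ^ m) * hankel_kernel (alpha * INR m + 1) 1 w)%C).
    intros m; apply holo_mult; [apply holo_const|apply holo_hankel_kernel]. }
  assert (R2 : forall L, U <= L -> Cmod (contour phi (fun w => SN w + - N w)%C U L) <= eta).
  { intros L HL.
    assert (PW : forall u v, U <= u -> - phi <= v <= phi ->
      Cmod (SN (u, v) + - N (u, v))%C <= exp (exp u * cos v) * (eta / BU)).
    { intros u v Hu Hv; rewrite ESN; unfold N.
      replace (Cexp (Cexp (u, v)) * Csum (fun m => RtoC (a m) * q (u, v) ^ m) n + - (Cexp (Cexp (u, v)) * k (q (u, v))))%C
        with (Cexp (Cexp (u, v)) * (Csum (fun m => RtoC (a m) * q (u, v) ^ m) n - k (q (u, v))))%C by ring.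
      rewrite Cmod_mult, CE; apply Rmult_le_compat_l; [apply Rlt_le, exp_pos|].
      apply Hn0; [exact Hn|apply QU, Hu]. }
    assert (eb : 0 < eta / BU) by (apply Rdiv_lt_0_compat; assumption).
    assert (PL : forall u v, U <= u -> cos v = cos phi -> - phi <= v <= phi ->
      Cmod (SN (u, v) + - N (u, v))%C <= eta / BU * K' * exp (- (1 * u))).
    { intros u v Hu Ev Hv; eapply Rle_trans; [apply PW; assumption|]; rewrite Ev.
      specialize (HK' u); replace (- (c * exp u)) with (exp u * cos phi) in HK' by (unfold c; ring).
      rewrite Rmult_comm, Rmult_assoc; apply Rmult_le_compat_l; lra. }
    eapply Rle_trans; [refine (Cmod_contour_le phi _ U L (fun u => eta / BU * K' * exp (- (1 * u))) _
      (exp (exp U) * (eta / BU)) _ HL _ _ _ _ (is_RInt_scal (V := R_NormedModule) _ _ _ (eta / BU * K') _ (is_RInt_exp_lin 1 U L R1_neq_R0)) _)|].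
    - lra.
    - intros u; split; (apply holo_plus; [apply HSN|apply holo_opp, HN; lra]).
    - intros v Hv; apply holo_plus; [apply HSN|apply holo_opp, HN, Hv].
    - intros u Hu; apply PL; [lra|reflexivity|lra].
    - intros u Hu; apply PL; [lra|apply cos_neg|lra].
    - intros v Hv; eapply Rle_trans; [apply PW; [lra|exact Hv]|].
      apply Rmult_le_compat_r; [lra|]; apply exp_le.
      rewrite <- (Rmult_1_r (exp U)) at 2; apply Rmult_le_compat_l; [apply Rlt_le, exp_pos|apply COS_bound].
    - change (2 * (eta / BU * K' * ((exp (- (1 * U)) - exp (- (1 * L))) / 1)) +
        2 * phi * (exp (exp U) * (eta / BU)) <= eta).
      assert (Y : exp (- (1 * U)) <= 1) by (apply Rle_trans with (exp 0); [apply exp_le; lra|rewrite exp_0; lra]).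
      assert (X : eta / BU * K' * ((exp (- (1 * U)) - exp (- (1 * L))) / 1) <= eta / BU * K' * 1).
      { apply Rmult_le_compat_l; [apply Rmult_le_pos; lra|]; generalize (exp_pos (- (1 * L))); lra. }
      apply Rle_trans with (eta / BU * BU); [|right; field; lra].
      replace (eta / BU * BU) with (2 * (eta / BU * K' * 1) + 2 * phi * (exp (exp U) * (eta / BU)))
        by (set (y := eta / BU); unfold BU; ring).
      lra. }
  destruct (ml_sum_hankel phi alpha a z n eta Hphi (proj1 Ha) He) as [L1 HL1].
  destruct (hankel_limit phi alpha eta Hphi (proj2 Ha) He) as (L2 & L20 & HL2).
  set (L := Rmax U (Rmax L1 L2)).
  assert (M1 : U <= L) by apply Rmax_l.
  assert (M2 : L1 <= L) by (eapply Rle_trans; [apply Rmax_l|apply Rmax_r]).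
  assert (M3 : L2 <= L) by (eapply Rle_trans; [apply Rmax_r|apply Rmax_r]).
  specialize (HL1 L M2); specialize (HL2 L M3); specialize (R1 L ltac:(lra)); specialize (R2 L M1).
  assert (phi0 : 0 <= phi) by lra.
  assert (OL : on_lines phi N) by (intros u; split; apply HN; lra).
  assert (ON : forall x, on_contour phi N x) by (intros x; split; [exact OL|intros; apply HN; assumption]).
  assert (ON' : on_contour phi (fun w => -(1) * N w)%C U).
  { split; [intros u; split|intros v Hv]; refine (holo_mult _ N _ (holo_const _ _) _); apply HN; lra. }
  rewrite (contour_plus phi N hs 0 L phi0 (ON 0) (entire_on_contour phi hs 0 Hhs)) in R1.
  assert (Chk : on_contour phi hk 0) by (apply entire_on_contour; intros; apply holo_hankel_kernel).
  rewrite (contour_Cmult phi (RtoC sigma / z) hk 0 L phi0 Chk : contour phi hs 0 L = _) in R1.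
  assert (Hr : holo_on_rect N 0 U (- phi) phi) by (intros u v _ Hv; apply HN, Hv).
  rewrite (contour_ext phi _ (fun w => SN w + -(1) * N w)%C U L) in R2 by (intros; ring).
  rewrite (contour_plus phi SN _ U L phi0 (entire_on_contour phi SN U HSN) ON'),
    (contour_Cmult phi _ N U L phi0 (ON U)), <- (contour_shift phi N 0 U L phi0 U0 OL Hr),
    <- (contour_entire phi SN 0 U L phi0 HSN) in R2.
  assert (Hhm : forall m w, holo (hankel_kernel (alpha * INR m + 1) 1) w) by (intros; apply holo_hankel_kernel).
  rewrite (contour_Csum phi (fun m => RtoC (a m) * z ^ m)%C
    (fun m => hankel_kernel (alpha * INR m + 1) 1) n 0 L phi0 Hhm : contour phi SN 0 L = _) in R2.
  set (S := ml_sum alpha a n z) in *; set (SC := Csum _ n) in *.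
  set (cN := contour phi N 0 L) in *; set (ch := contour phi hk 0 L) in *.
  set (ig := inv_Gamma (1 - alpha)) in *.
  assert (P2 : 1 <= 2 * PI) by (generalize PI2_1; lra).
  set (X := (S + RtoC (sigma * ig) / z)%C).
  (* In order: Hankel's formula for the finite sum, the exchange of partial sums for k, the
     remainder of k at infinity, and the limit of the Hankel integral. *)
  assert (E : (RtoC (2 * PI) * Ci * X)%C =
    ((RtoC (2 * PI) * Ci * S - SC) + (SC + -(1) * cN) + (cN + RtoC sigma / z * ch)
     + - (RtoC sigma / z * (ch - RtoC (2 * PI) * Ci * RtoC ig)))%C).
  { unfold X; rewrite (RtoC_mult sigma ig); field; exact Nz. }
  assert (B4 : Cmod (RtoC sigma / z * (ch - RtoC (2 * PI) * Ci * RtoC ig))%C <= Rabs sigma * eta).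
  { rewrite Cmod_mult, Cmod_div, Cmod_R by exact Nz.
    apply Rmult_le_compat; auto using Cmod_ge_0.
    - apply Rdiv_le_0_compat; [apply Rabs_pos|lra].
    - apply Rmult_le_reg_r with (Cmod z); [lra|]; unfold Rdiv; rewrite Rmult_assoc, Rinv_l by lra.
      apply Rmult_le_compat_l; [apply Rabs_pos|lra]. }
  assert (EX : Cmod (RtoC (2 * PI) * Ci * X)%C = 2 * PI * Cmod X).
  { rewrite !Cmod_mult, Cmod_Ci, Cmod_R, Rabs_pos_eq by lra; ring. }
  assert (X0 := Cmod_ge_0 X).
  apply Rle_trans with (2 * PI * Cmod X); [nra|].
  rewrite <- EX, E.
  eapply Rle_trans; [apply Cmod_triangle|]; rewrite Cmod_opp.
  generalize (Cmod_triangle (RtoC (2 * PI) * Ci * S - SC + (SC + - (1) * cN)) (cN + RtoC sigma / z * ch))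
    (Cmod_triangle (RtoC (2 * PI) * Ci * S - SC) (SC + - (1) * cN)); lra.
Qed.

(** * The generating functions of the Mittag-Leffler function and of its Euler derivative *)

Lemma Csum_geom (q : C) (n : nat) : (Csum (fun m => q ^ m) n * (1 - q) = 1 - q ^ n)%C.
Proof.
  induction n as [|n IH]; [simpl; ring|].
  simpl Csum; rewrite Cmult_plus_distr_r, IH, Cpow_S; ring.
Qed.

Lemma Csum_arith_geom (q : C) (n : nat) :
  (Csum (fun m => RtoC (INR m) * q ^ m) n * (1 - q) * (1 - q) =
   q - q ^ n * (RtoC (INR n) * (1 - q) + q))%C.
Proof.
  induction n as [|n IH]; [simpl; ring|].
  simpl Csum; rewrite !Cmult_plus_distr_r, IH, Cpow_S, S_INR, RtoC_plus; ring.
Qed.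

Lemma Cmod_1_sub_half (q : C) : Cmod q <= / 2 -> / 2 <= Cmod (1 - q)%C.
Proof.
  intros H; generalize (Cmod_triangle (1 - q)%C q).
  replace (1 - q + q)%C with (1 : C) by ring; rewrite Cmod_1; lra.
Qed.

Lemma INR_le_pow2 (n : nat) : INR n + 1 <= 2 ^ n.
Proof.
  induction n as [|n IH]; [simpl; lra|].
  rewrite S_INR; simpl; generalize (pos_INR n); lra.
Qed.

Lemma pow_small (x eta : R) : 0 <= x < 1 -> 0 < eta -> exists n0, forall n, (n0 <= n)%nat -> x ^ n <= eta.
Proof.
  intros Hx He; destruct (pow_lt_1_zero x ltac:(rewrite Rabs_pos_eq; lra) eta He) as [n0 Hn].
  exists n0; intros n H; specialize (Hn n H); rewrite Rabs_pos_eq in Hn by (apply pow_le; lra); lra.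
Qed.

Lemma INR_pow_half_le (n : nat) : (INR n + 1) * (/ 2) ^ n <= 2 * (3 / 4) ^ n.
Proof.
  induction n as [|n IH]; [simpl; lra|].
  rewrite S_INR; simpl; assert (0 <= (/ 2) ^ n) by (apply pow_le; lra).
  destruct n as [|n]; [simpl; lra|].
  rewrite S_INR in *.
  replace ((INR n + 1 + 1 + 1) * (/ 2 * (/ 2) ^ S n)) with ((INR n + 1 + 1 + 1) / 2 * (/ 2) ^ S n) by field.
  replace (2 * (3 / 4 * (3 / 4) ^ S n)) with (3 / 4 * (2 * (3 / 4) ^ S n)) by ring.
  apply Rle_trans with (3 / 4 * ((INR n + 1 + 1) * (/ 2) ^ S n)); [|lra].
  replace (3 / 4 * ((INR n + 1 + 1) * (/ 2) ^ S n)) with (3 / 4 * (INR n + 1 + 1) * (/ 2) ^ S n) by ring.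
  apply Rmult_le_compat_r; [assumption|]; generalize (pos_INR n); lra.
Qed.

Lemma ne_1_of_away (kappa : R) (q : C) : 0 < kappa -> kappa * Rmax 1 (Cmod q) <= Cmod (1 - q)%C ->
  (1 - q)%C <> 0%C /\ 0 < Cmod (1 - q)%C.
Proof.
  intros Hk H; assert (P : 0 < Cmod (1 - q)%C).
  { apply Rlt_le_trans with (2 := H), Rmult_lt_0_compat; [exact Hk|].
    generalize (Rmax_l 1 (Cmod q)); lra. }
  split; [apply Cmod_gt_0|]; exact P.
Qed.

Lemma one_sub_nz (q : C) : q <> 1%C -> (1 - q)%C <> 0%C.
Proof. intros H E; apply H; symmetry; apply Ceq_minus; exact E. Qed.

Lemma holo_one_sub (q : C) : holo (fun w => 1 - w)%C q.
Proof. apply holo_plus; [apply holo_const|apply holo_opp, holo_id]. Qed.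

(** 1/(1 - q) + 1/q = 1/(q (1 - q)), and away from the pole |1 - q| >= kappa |q|. *)
Lemma generating_geom : generating (fun _ => 1) 1 (fun q => / (1 - q))%C.
Proof.
  split.
  - intros q Hq; apply holo_inv; [apply one_sub_nz, Hq|apply holo_one_sub].
  - intros kappa Hk; exists (/ kappa); split; [apply Rlt_le, Rinv_0_lt_compat, Hk|].
    intros q Nq Hq; destruct (ne_1_of_away kappa q Hk Hq) as [N P].
    assert (Pq : 0 < Cmod q) by (apply Cmod_gt_0, Nq).
    replace (/ (1 - q) + RtoC 1 / q)%C with (/ (q * (1 - q)))%C by (field; auto).
    rewrite Cmod_inv, Cmod_mult by (apply Cmult_neq_0; auto).
    replace (/ kappa / Cmod q ^ 2) with (/ (Cmod q * (kappa * Cmod q))) by (field; lra).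
    apply Rinv_le_contravar; [apply Rmult_lt_0_compat; [lra|apply Rmult_lt_0_compat; lra]|].
    apply Rmult_le_compat_l; [lra|]; eapply Rle_trans; [|exact Hq].
    apply Rmult_le_compat_l; [lra|apply Rmax_r].
  - intros eta He; destruct (pow_small (/ 2) (eta / 2)) as [n0 Hn0]; [lra|lra|].
    exists n0; intros n q Hn Hq; specialize (Hn0 n Hn).
    assert (L := Cmod_1_sub_half q Hq).
    assert (N : (1 - q)%C <> 0%C) by (apply Cmod_gt_0; lra).
    rewrite (Csum_ext _ (fun m => q ^ m)%C) by (intros; ring).
    replace (Csum (fun m => q ^ m)%C n - / (1 - q))%C with (- q ^ n / (1 - q))%C.
    2: { assert (E := Csum_geom q n).
         transitivity ((Csum (fun m => q ^ m) n * (1 - q) - 1) / (1 - q))%C; [rewrite E; field; auto|field; auto]. }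
    rewrite Cmod_div, Cmod_opp, Cmod_pow by exact N.
    apply Rmult_le_reg_r with (Cmod (1 - q)%C); [lra|].
    unfold Rdiv; rewrite Rmult_assoc, Rinv_l, Rmult_1_r by lra.
    assert (Cmod q ^ n <= (/ 2) ^ n) by (apply pow_incr; split; [apply Cmod_ge_0|exact Hq]).
    nra.
Qed.

(** The function is q d/dq of 1/(1 - q), which behaves as + 1/q at infinity, whence sigma = -1. The
    remainder is (2q - 1) / (q (1 - q)^2), and |1 - q| >= kappa max(1, |q|) absorbs the growth of
    the numerator. *)
Lemma generating_arith_geom : generating INR (-1) (fun q => q / ((1 - q) * (1 - q)))%C.
Proof.
  split.
  - intros q Hq; apply holo_mult; [apply holo_id|apply holo_inv].
    + apply Cmult_neq_0; apply one_sub_nz, Hq.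
    + apply holo_mult; apply holo_one_sub.
  - intros kappa Hk; exists (3 / (kappa * kappa)); split; [apply Rdiv_le_0_compat; nra|].
    intros q Nq Hq; destruct (ne_1_of_away kappa q Hk Hq) as [N P].
    assert (Pq : 0 < Cmod q) by (apply Cmod_gt_0, Nq).
    replace (q / ((1 - q) * (1 - q)) + RtoC (-1) / q)%C with ((2 * q - 1) / (q * ((1 - q) * (1 - q))))%C
      by (field; auto).
    rewrite Cmod_div, !Cmod_mult by (repeat apply Cmult_neq_0; auto).
    set (r := Cmod q) in *; set (d := Cmod (1 - q)%C) in *; set (mx := Rmax 1 r) in *.
    assert (m1 : 1 <= mx) by apply Rmax_l; assert (m2 : r <= mx) by apply Rmax_r.
    assert (Nu : Cmod (2 * q - 1)%C <= 3 * mx).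
    { unfold Cminus; eapply Rle_trans; [apply Cmod_triangle|].
      rewrite Cmod_opp, Cmod_1, Cmod_mult, Cmod_R, Rabs_pos_eq by lra; fold r; lra. }
    assert (D2 : kappa * kappa * mx * r <= d * d).
    { apply Rle_trans with (kappa * mx * (kappa * mx)); [|apply Rmult_le_compat; nra].
      replace (kappa * mx * (kappa * mx)) with (kappa * kappa * mx * mx) by ring.
      apply Rmult_le_compat_l; nra. }
    assert (kk : 0 < kappa * kappa) by nra.
    assert (dd : 0 < r * (d * d)) by (apply Rmult_lt_0_compat; nra).
    apply Rmult_le_reg_r with (r * (d * d)); [exact dd|].
    unfold Rdiv at 1; rewrite Rmult_assoc, Rinv_l, Rmult_1_r by lra.
    eapply Rle_trans; [exact Nu|].
    replace (3 * mx) with (3 / (kappa * kappa) / r ^ 2 * (r * (kappa * kappa * mx * r))) by (field; lra).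
    apply Rmult_le_compat_l.
    + apply Rdiv_le_0_compat; [apply Rdiv_le_0_compat; lra|apply pow_lt; lra].
    + apply Rmult_le_compat_l; lra.
  - intros eta He; destruct (pow_small (3 / 4) (eta / 8)) as [n0 Hn0]; [lra|lra|].
    exists n0; intros n q Hn Hq; specialize (Hn0 n Hn).
    assert (L := Cmod_1_sub_half q Hq).
    assert (N : (1 - q)%C <> 0%C) by (apply Cmod_gt_0; lra).
    replace (Csum (fun m => RtoC (INR m) * q ^ m)%C n - q / ((1 - q) * (1 - q)))%C with
      (- (q ^ n * (RtoC (INR n) * (1 - q) + q)) / ((1 - q) * (1 - q)))%C.
    2: { assert (E := Csum_arith_geom q n).
         transitivity ((Csum (fun m => RtoC (INR m) * q ^ m) n * (1 - q) * (1 - q) - q) / ((1 - q) * (1 - q)))%C;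
         [rewrite E; field; auto|field; auto]. }
    rewrite Cmod_div, Cmod_opp, !Cmod_mult, Cmod_pow by (apply Cmult_neq_0; auto).
    set (d := Cmod (1 - q)%C) in *.
    apply Rmult_le_reg_r with (d * d); [nra|].
    unfold Rdiv; rewrite Rmult_assoc, Rinv_l, Rmult_1_r by nra.
    assert (Q : Cmod q ^ n <= (/ 2) ^ n) by (apply pow_incr; split; [apply Cmod_ge_0|exact Hq]).
    assert (T : Cmod (RtoC (INR n) * (1 - q) + q)%C <= (INR n + 1) * d).
    { eapply Rle_trans; [apply Cmod_triangle|]; rewrite Cmod_mult, Cmod_R, Rabs_pos_eq by apply pos_INR; fold d.
      lra. }
    assert (W := INR_pow_half_le n); assert (0 <= (/ 2) ^ n) by (apply pow_le; lra).
    apply Rle_trans with ((/ 2) ^ n * ((INR n + 1) * d)).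
    + apply Rmult_le_compat; auto using Cmod_ge_0; apply pow_le, Cmod_ge_0.
    + replace ((/ 2) ^ n * ((INR n + 1) * d)) with ((INR n + 1) * (/ 2) ^ n * d) by ring.
      rewrite <- Rmult_assoc; apply Rmult_le_compat_r; [lra|]; nra.
Qed.

(** * Uniform convergence of the sums on bounded sets *)

Lemma ml_coef_bound (alpha rho : R) : 0 < alpha -> 0 < rho -> exists B, 0 < B /\ forall m,
  rho ^ m / Gamma (alpha * INR m + 1) <= B * (/ 4) ^ m.
Proof.
  intros Ha Hr.
  (* c^alpha = 4 rho, so the lower bound [Gamma_ge] grows as (4 rho)^m. Of the resulting (1/4)^m,
     one factor (1/2)^m is kept in reserve for coefficients up to 2^m. *)
  set (c := Rpower (4 * rho) (/ alpha)).
  assert (c0 : 0 < c) by apply exp_pos.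
  exists (/ (c * exp (- (2 * c)))).
  assert (P : 0 < c * exp (- (2 * c))) by (apply Rmult_lt_0_compat; [exact c0|apply exp_pos]).
  split; [apply Rinv_0_lt_compat, P|]; intros m.
  assert (H1 := INR_alpha_pos alpha m Ha).
  assert (G := Gamma_ge (alpha * INR m + 1) c H1 c0).
  assert (E : Rpower c (alpha * INR m + 1 - 1) = (4 * rho) ^ m).
  { replace (alpha * INR m + 1 - 1) with (alpha * INR m) by ring; unfold c.
    rewrite Rpower_mult; replace (/ alpha * (alpha * INR m)) with (INR m) by (field; lra).
    apply Rpower_pow; lra. }
  rewrite E in G.
  assert (Pg := Gamma_pos (alpha * INR m + 1) ltac:(lra)).
  apply Rmult_le_reg_r with (Gamma (alpha * INR m + 1)); [exact Pg|].
  unfold Rdiv; rewrite Rmult_assoc, Rinv_l, Rmult_1_r by lra.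
  apply Rle_trans with (/ (c * exp (- (2 * c))) * (/ 4) ^ m * (c * ((4 * rho) ^ m * exp (- (2 * c))))).
  - right; rewrite Rpow_mult_distr, pow_inv; field.
    repeat split; [apply Rgt_not_eq, pow_lt; lra|apply Rgt_not_eq, exp_pos|lra].
  - apply Rmult_le_compat_l; [|exact G].
    apply Rmult_le_pos; [apply Rlt_le, Rinv_0_lt_compat, P|apply pow_le; lra].
Qed.

(** Subtracting the tail beyond n + p makes the induction on p close. *)
Lemma Csum_tail_le (f : nat -> C) (B : R) (n p : nat) : (forall m, Cmod (f m) <= B * (/ 2) ^ m) ->
  Cmod (Csum f (n + p) - Csum f n)%C <= 2 * B * (/ 2) ^ n - 2 * B * (/ 2) ^ (n + p).
Proof.
  intros H; induction p as [|p IH].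
  - rewrite Nat.add_0_r; replace (Csum f n - Csum f n)%C with (0 : C) by ring; rewrite Cmod_0; lra.
  - rewrite Nat.add_succ_r; simpl Csum.
    replace (Csum f (n + p) + f (n + p)%nat - Csum f n)%C with
      ((Csum f (n + p) - Csum f n) + f (n + p)%nat)%C by ring.
    eapply Rle_trans; [apply Cmod_triangle|].
    rewrite <- tech_pow_Rmult; specialize (H (n + p)%nat); lra.
Qed.

(** The threshold precedes [f]: it is common to all sequences under the same geometric majorant,
    hence to all z in a disc. *)
Lemma Csum_cauchy (B eta : R) : 0 < B -> 0 < eta -> exists n0, forall (f : nat -> C),
  (forall m, Cmod (f m) <= B * (/ 2) ^ m) -> forall n n', (n0 <= n)%nat -> (n0 <= n')%nat ->
  Cmod (Csum f n - Csum f n')%C <= eta.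
Proof.
  intros HB He; destruct (pow_small (/ 2) (eta / (4 * B))) as [n0 Hn0]; [lra|apply Rdiv_lt_0_compat; lra|].
  exists n0; intros f Hf.
  specialize (Hn0 n0 (le_n n0)).
  assert (W : forall n, (n0 <= n)%nat -> Cmod (Csum f n - Csum f n0)%C <= eta / 2).
  { intros n Hn; replace n with (n0 + (n - n0))%nat by lia.
    eapply Rle_trans; [apply Csum_tail_le with (B := B), Hf|].
    assert (0 <= (/ 2) ^ (n0 + (n - n0))) by (apply pow_le; lra).
    assert (2 * B * (/ 2) ^ n0 <= 2 * B * (eta / (4 * B))) by (apply Rmult_le_compat_l; lra).
    replace (2 * B * (eta / (4 * B))) with (eta / 2) in * by (field; lra).
    assert (0 <= 2 * B * (/ 2) ^ (n0 + (n - n0))) by (apply Rmult_le_pos; lra).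
    lra. }
  intros n n' Hn Hn'.
  replace (Csum f n - Csum f n')%C with ((Csum f n - Csum f n0) + - (Csum f n' - Csum f n0))%C by ring.
  eapply Rle_trans; [apply Cmod_triangle|]; rewrite Cmod_opp.
  generalize (W n Hn) (W n' Hn'); lra.
Qed.

Lemma ml_term_bound (alpha rho : R) (a : nat -> R) : 0 < alpha -> 0 < rho -> (forall m, Rabs (a m) <= 2 ^ m) ->
  exists B, 0 < B /\ forall z : C, Cmod z <= rho -> forall m,
    Cmod (RtoC (a m / Gamma (alpha * INR m + 1)) * z ^ m)%C <= B * (/ 2) ^ m.
Proof.
  intros Ha Hr Hm; destruct (ml_coef_bound alpha rho Ha Hr) as (B & B0 & HB).
  exists B; split; [exact B0|]; intros z Hz m; specialize (HB m).
  assert (Pg := Gamma_pos (alpha * INR m + 1) ltac:(generalize (INR_alpha_pos alpha m Ha); lra)).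
  rewrite Cmod_mult, Cmod_R, Cmod_pow, Rabs_div, (Rabs_pos_eq (Gamma _)) by lra.
  assert (Q : Cmod z ^ m <= rho ^ m) by (apply pow_incr; split; [apply Cmod_ge_0|exact Hz]).
  apply Rle_trans with (2 ^ m * (rho ^ m / Gamma (alpha * INR m + 1))).
  - replace (2 ^ m * (rho ^ m / Gamma (alpha * INR m + 1))) with (2 ^ m / Gamma (alpha * INR m + 1) * rho ^ m)
      by (unfold Rdiv; ring).
    apply Rmult_le_compat; auto.
    + apply Rdiv_le_0_compat; [apply Rabs_pos|lra].
    + apply pow_le, Cmod_ge_0.
    + apply Rmult_le_compat_r; [apply Rlt_le, Rinv_0_lt_compat, Pg|apply Hm].
  - apply Rle_trans with (2 ^ m * (B * (/ 4) ^ m)); [apply Rmult_le_compat_l; [apply pow_le; lra|exact HB]|].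
    right; replace (/ 2) with (2 * / 4) by field; rewrite Rpow_mult_distr; ring.
Qed.

Lemma ml_sum_bounded (alpha rho : R) (a : nat -> R) : 0 < alpha -> 0 < rho -> (forall m, Rabs (a m) <= 2 ^ m) ->
  exists B, 0 < B /\ forall n z, Cmod z <= rho -> Cmod (ml_sum alpha a n z) <= B.
Proof.
  intros Ha Hr Hm; destruct (ml_term_bound alpha rho a Ha Hr Hm) as (B & B0 & HB).
  exists (2 * B); split; [lra|]; intros n z Hz; specialize (HB z Hz).
  assert (T := Csum_tail_le _ B 0 n HB); simpl Csum in T; simpl pow in T.
  unfold ml_sum; replace (Csum _ n) with (Csum (fun m => RtoC (a m / Gamma (alpha * INR m + 1)) * z ^ m)%C n - 0)%C by ring.
  eapply Rle_trans; [exact T|].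
  assert (0 <= (/ 2) ^ n) by (apply pow_le; lra); nra.
Qed.

(** The threshold depending on z is used only at an auxiliary index p; passing from p to n is
    uniform on |z| <= rho. This is needed because the estimate will be integrated over the arguments
    w z. *)
Theorem ml_sum_asymptotic_uniform (alpha theta sigma : R) (a : nat -> R) (k : C -> C) :
  0 < alpha <= 1 -> PI * alpha / 2 < theta <= PI -> generating a sigma k -> (forall m, Rabs (a m) <= 2 ^ m) ->
  exists K, 0 <= K /\ forall rho eta, 0 < rho -> 0 < eta -> exists n0, forall n, (n0 <= n)%nat ->
    forall z : C, fst z <= Cmod z * cos theta -> 1 <= Cmod z <= rho ->
    Cmod (ml_sum alpha a n z + RtoC (sigma * inv_Gamma (1 - alpha)) / z)%C <= K / Cmod z ^ 2 + eta.
Proof.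
  intros Ha Ht Hg Hm; destruct (ml_sum_asymptotic alpha theta sigma a k Ha Ht Hg) as (K & K0 & HK).
  exists K; split; [exact K0|]; intros rho eta Hr He.
  destruct (ml_term_bound alpha rho a (proj1 Ha) Hr Hm) as (B & B0 & HB).
  destruct (Csum_cauchy B (eta / 2) B0 ltac:(lra)) as [n0 Hn0].
  exists n0; intros n Hn z Hz1 [Hz2 Hz3].
  destruct (HK z Hz1 Hz2 (eta / 2) ltac:(lra)) as [n1 Hn1].
  set (p := max n0 n1).
  assert (X := Hn0 _ (HB z Hz3) n p Hn (Nat.le_max_l _ _)).
  specialize (Hn1 p (Nat.le_max_r _ _)).
  fold (ml_sum alpha a n z) in X; fold (ml_sum alpha a p z) in X.
  replace (ml_sum alpha a n z + RtoC (sigma * inv_Gamma (1 - alpha)) / z)%C with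
    ((ml_sum alpha a n z - ml_sum alpha a p z) + (ml_sum alpha a p z + RtoC (sigma * inv_Gamma (1 - alpha)) / z))%C by ring.
  eapply Rle_trans; [apply Cmod_triangle|]; lra.
Qed.

(** * Integrals of Mittag-Leffler sums along a segment from the origin *)

Lemma continuous_Csum {U : UniformSpace} (f : nat -> U -> C) (n : nat) (x : U) :
  (forall m, continuous (f m) x) -> continuous (fun y => Csum (fun m => f m y) n) x.
Proof.
  intros H; induction n as [|n IH]; cbn [Csum]; [apply continuous_const|].
  exact (continuous_Cplus (fun y => Csum (fun m => f m y) n) (f n) x IH (H n)).
Qed.

Lemma continuous_Cpow {U : UniformSpace} (f : U -> C) (m : nat) (x : U) :
  continuous f x -> continuous (fun y => f y ^ m)%C x.
Proof.
  intros H; induction m as [|m IH]; cbn [Cpow]; [apply continuous_const|].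
  exact (continuous_Cmult f (fun y => f y ^ m)%C x H IH).
Qed.

Lemma continuous_ml_sum (alpha : R) (a : nat -> R) (n : nat) (z : C) (w : R) :
  continuous (fun w : R => ml_sum alpha a n (RtoC w * z)%C) w.
Proof.
  apply (continuous_Csum (fun m w => RtoC (a m / Gamma (alpha * INR m + 1)) * (RtoC w * z) ^ m)%C).
  intros m; apply continuous_Cmult; [apply continuous_const|].
  apply continuous_Cpow, continuous_Cmult; [apply continuous_RtoC, continuous_id|apply continuous_const].
Qed.

Lemma is_RInt_inv (x y : R) : 0 < x -> x <= y -> is_RInt (fun w => / w) x y (ln y - ln x).
Proof.
  intros Hx Hy.
  apply (is_RInt_derive (V := R_CompleteNormedModule) ln).
  - intros t Ht; rewrite Rmin_left in Ht by exact Hy; apply is_derive_ln; lra.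
  - intros t Ht; rewrite Rmin_left in Ht by exact Hy; apply continuous_Rinv; lra.
Qed.

Lemma is_RInt_inv_sq (x y : R) : 0 < x -> x <= y -> is_RInt (fun w => / w ^ 2) x y (/ x - / y).
Proof.
  intros Hx Hy.
  replace (/ x - / y) with (minus (- / y) (- / x)) by (unfold minus, plus, opp; simpl; ring).
  apply (is_RInt_derive (V := R_CompleteNormedModule) (fun w => - / w)).
  - intros t Ht; rewrite Rmin_left in Ht by exact Hy; auto_derive; [lra|field; lra].
  - intros t Ht; rewrite Rmin_left in Ht by exact Hy.
    apply (ex_derive_continuous (V := R_NormedModule)); auto_derive.
    generalize (Rmult_lt_0_compat t t); nra.
Qed.

(* The logarithm comes from integrating the [1 / (w z)] tail of the
   Mittag-Leffler sum over [1 / |z| <= w <= 1]. *)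
Theorem ml_sum_integral (alpha theta sigma G Lam : R) (a : nat -> R) (k : C -> C) :
  0 < alpha <= 1 -> PI * alpha / 2 < theta <= PI -> generating a sigma k -> (forall m, Rabs (a m) <= 2 ^ m) ->
  0 <= G -> 0 <= Lam ->
  exists M, 0 <= M /\ forall rho eta, 0 < rho -> 0 < eta -> exists n0, forall n, (n0 <= n)%nat ->
    forall z : C, fst z <= Cmod z * cos theta -> 1 <= Cmod z <= rho ->
    forall g : R -> R, (forall w, 0 <= w <= 1 -> continuous g w) ->
      (forall w, 0 <= w <= 1 -> Rabs (g w) <= G) ->
      (forall w, 0 <= w <= 1 -> Rabs (g w - g 0) <= Lam * w) ->
    Cmod (CInt (fun w => ml_sum alpha a n (RtoC w * z) * RtoC (g w))%C 0 1
          + RtoC (sigma * inv_Gamma (1 - alpha) * g 0 * ln (Cmod z)) / z)%C <= M / Cmod z + eta.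
Proof.
  intros Ha Ht Hg Hm HG HL.
  destruct (ml_sum_asymptotic_uniform alpha theta sigma a k Ha Ht Hg Hm) as (K & K0 & HK).
  destruct (ml_sum_bounded alpha 1 a (proj1 Ha) Rlt_0_1 Hm) as (B & B0 & HB).
  set (s := sigma * inv_Gamma (1 - alpha)) in *.
  assert (s0 := Rabs_pos s).
  exists (B * G + G * K + Rabs s * Lam); split.
  { repeat apply Rplus_le_le_0_compat; apply Rmult_le_pos; lra. }
  intros rho eta Hr He.
  set (e := eta / (G + 1)).
  assert (e0 : 0 < e) by (apply Rdiv_lt_0_compat; lra).
  destruct (HK rho e Hr e0) as [n0 Hn0]; exists n0; intros n Hn z Hz [z1 z2] g Cg Bg Lg.
  specialize (Hn0 n Hn).
  assert (Nz : z <> 0%C) by (apply Cmod_gt_0; lra).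
  (* Below [w0] the argument w z stays in the unit disc, where the partial sums are bounded by [B];
     a segment of length 1/r contributes O(1/r). *)
  set (r := Cmod z) in *; set (w0 := / r).
  assert (W0 : 0 < w0) by (apply Rinv_0_lt_compat; lra).
  assert (W1 : w0 <= 1) by (unfold w0; rewrite <- Rinv_1; apply Rinv_le_contravar; lra).
  set (Sw := fun w : R => ml_sum alpha a n (RtoC w * z)%C).
  assert (CS : forall w, continuous Sw w) by (intros; apply continuous_ml_sum).
  assert (Cgc : forall w, 0 <= w <= 1 -> continuous (fun w => RtoC (g w)) w) by (intros; apply continuous_RtoC; auto).
  set (F := fun w => (Sw w * RtoC (g w))%C).
  assert (CF : forall w, 0 <= w <= 1 -> continuous F w) by (intros; apply continuous_Cmult; auto).
  assert (IF1 : CIntegrable F 0 w0).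
  { apply CIntegrable_continuous; intros w Hw; rewrite Rmin_left, Rmax_right in Hw by lra; apply CF; lra. }
  assert (IF2 : CIntegrable F w0 1).
  { apply CIntegrable_continuous; intros w Hw; rewrite Rmin_left, Rmax_right in Hw by lra; apply CF; lra. }
  assert (Mw : forall w, 0 <= w -> Cmod (RtoC w * z)%C = w * r).
  { intros w Hw; rewrite Cmod_mult, Cmod_R, Rabs_pos_eq by exact Hw; reflexivity. }
  assert (J1 : Cmod (CInt F 0 w0) <= B * G / r).
  { replace (B * G / r) with ((w0 - 0) * (B * G)) by (unfold w0; field; lra).
    apply Cmod_CInt_le_const; [lra| |exact IF1]; intros w Hw.
    unfold F; rewrite Cmod_mult, Cmod_R.
    apply Rmult_le_compat; [apply Cmod_ge_0|apply Rabs_pos| |apply Bg; lra].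
    apply HB; rewrite Mw by lra.
    apply Rle_trans with (w0 * r); [apply Rmult_le_compat_r; lra|right; unfold w0; field; lra]. }
  (* Above [w0] the integrand is split as (S(w) + s/(wz)) g(w) - (s/z) (g(w) - g(0))/w - (s g(0)/z)
     / w. The first part is small by the asymptotics, the second is bounded by the Lipschitz
     hypothesis, and the third integrates to the logarithm. *)
  set (F1 := fun w => ((Sw w + RtoC s / (RtoC w * z)) * RtoC (g w))%C).
  set (h := fun w => (g w - g 0) * / w).
  assert (Ch : forall w, w0 <= w <= 1 -> continuous h w).
  { intros w Hw; apply (continuous_mult (K := R_AbsRing) (fun w => g w - g 0) Rinv).
    - apply (continuous_minus (V := R_NormedModule)); [apply Cg; lra|apply continuous_const].
    - apply continuous_Rinv; lra. }
  assert (Ih : ex_RInt h w0 1).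
  { apply (ex_RInt_continuous (V := R_CompleteNormedModule)); intros w Hw.
    rewrite Rmin_left, Rmax_right in Hw by lra; apply Ch, Hw. }
  assert (CI : forall w, w0 <= w <= 1 -> continuous (fun w => RtoC s / (RtoC w * z))%C w).
  { intros w Hw.
    apply (continuous_ext_loc _ (fun w => RtoC (/ w) * (RtoC s / z))%C).
    - exists (mkposreal w0 W0); intros y Hy; change (Rabs (y - w) < w0) in Hy.
      change R in y; apply Rabs_def2 in Hy.
      assert (y <> 0) by lra.
      rewrite RtoC_inv by assumption.
      eqC; field; split; [exact Nz|].
      intros E; apply (f_equal fst) in E; simpl in E; lra.
    - apply continuous_Cmult; [|apply continuous_const].
      apply continuous_RtoC, continuous_Rinv; lra. }
  assert (IF3 : CIntegrable F1 w0 1).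
  { apply CIntegrable_continuous; intros w Hw; rewrite Rmin_left, Rmax_right in Hw by lra.
    apply continuous_Cmult; [|apply Cgc; lra].
    exact (continuous_Cplus Sw (fun w => RtoC s / (RtoC w * z))%C w (CS w) (CI w Hw)). }
  assert (J2 : Cmod (CInt F1 w0 1) <= G * K / r + eta).
  { assert (I1 := is_RInt_plus (V := R_NormedModule) _ _ _ _ _ _
      (is_RInt_scal (V := R_NormedModule) _ _ _ (G * K / r ^ 2) _ (is_RInt_inv_sq w0 1 W0 W1))
      (is_RInt_const (V := R_NormedModule) w0 1 (G * e))).
    eapply Rle_trans; [apply (Cmod_CInt_le F1 (fun w => G * K / r ^ 2 * / w ^ 2 + G * e)); [exact W1| |exact IF3|eexists; exact I1]|].
    - intros w Hw; unfold F1; rewrite Cmod_mult, Cmod_R.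
      assert (w * r >= 1).
      { apply Rle_ge, Rle_trans with (w0 * r); [right; unfold w0; field; lra|apply Rmult_le_compat_r; lra]. }
      assert (X : Cmod (Sw w + RtoC s / (RtoC w * z))%C <= K / (w * r) ^ 2 + e).
      { rewrite <- Mw by lra; apply Hn0; rewrite Mw by lra.
        - simpl; rewrite Rmult_0_l, Rminus_0_r, Rmult_assoc; apply Rmult_le_compat_l; [lra|exact Hz].
        - split; [lra|]; apply Rle_trans with r; [|exact z2]; rewrite <- (Rmult_1_l r) at 2; apply Rmult_le_compat_r; lra. }
      apply Rle_trans with ((K / (w * r) ^ 2 + e) * G).
      + apply Rmult_le_compat; auto using Cmod_ge_0, Rabs_pos; apply Bg; lra.
      + right; field; lra.
    - eapply Rle_trans; [right; exact (is_RInt_unique _ _ _ _ I1)|].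
      change (G * K / r ^ 2 * (/ w0 - / 1) + (1 - w0) * (G * e) <= G * K / r + eta).
      apply Rplus_le_compat.
      + apply Rle_trans with (G * K / r ^ 2 * r); [|right; field; lra].
        apply Rmult_le_compat_l; [apply Rdiv_le_0_compat; [nra|apply pow_lt; lra]|].
        unfold w0; rewrite Rinv_inv; lra.
      + apply Rle_trans with ((G + 1) * e); [|right; unfold e; field; lra].
        apply Rle_trans with (1 * (G * e)); [apply Rmult_le_compat_r; nra|nra]. }
  assert (J3 : Rabs (RInt h w0 1) <= Lam).
  { apply Rle_trans with ((1 - w0) * Lam).
    - apply abs_RInt_le_const; [exact W1|exact Ih|]; intros w Hw; unfold h.
      rewrite Rabs_mult, (Rabs_pos_eq (/ w)) by (apply Rlt_le, Rinv_0_lt_compat; lra).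
      apply Rmult_le_reg_r with w; [lra|]; rewrite Rmult_assoc, Rinv_l by lra; rewrite Rmult_1_r.
      apply Lg; lra.
    - rewrite <- (Rmult_1_l Lam) at 2; apply Rmult_le_compat_r; lra. }
  assert (I4 := CInt_RtoC _ _ _ _ (RInt_correct (V := R_CompleteNormedModule) h w0 1 Ih)).
  assert (I5 := CInt_RtoC _ _ _ _ (is_RInt_inv w0 1 W0 W1)).
  assert (I6 := is_RInt_Cmult (RtoC s / z)%C _ _ _ _ I4).
  assert (I7 := is_RInt_Cmult (RtoC s * RtoC (g 0%R) / z)%C _ _ _ _ I5).
  assert (I8 := is_RInt_minus (V := C_R_NormedModule) _ _ _ _ _ _
    (is_RInt_minus (V := C_R_NormedModule) _ _ _ _ _ _ (CInt_correct _ _ _ IF3) I6) I7).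
  assert (E2 : CInt F w0 1 = (CInt F1 w0 1 - RtoC s / z * RtoC (RInt h w0 1)
     - RtoC s * RtoC (g 0%R) / z * RtoC (ln 1 - ln w0))%C).
  { transitivity (CInt (fun w => F1 w - RtoC s / z * RtoC (h w) - RtoC s * RtoC (g 0%R) / z * RtoC (/ w))%C w0 1);
      [|exact (CInt_unique _ _ _ _ I8)].
    apply CInt_ext; intros w Hw.
    rewrite Rmin_left, Rmax_right in Hw by lra.
    change (F w = F1 w - RtoC s / z * RtoC (h w) - RtoC s * RtoC (g 0%R) / z * RtoC (/ w))%C.
    unfold F, F1, h; rewrite RtoC_mult, RtoC_minus, RtoC_inv by lra; field; split; [|exact Nz].
    intros E; apply (f_equal fst) in E; simpl in E; lra. }
  change (fun w => (ml_sum alpha a n (RtoC w * z) * RtoC (g w))%C) with F.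
  rewrite <- (CInt_Chasles F 0 w0 1 IF1 IF2), E2.
  replace (ln 1 - ln w0) with (ln r) by (unfold w0; rewrite ln_1, ln_Rinv by lra; ring).
  replace (CInt F 0 w0 + (CInt F1 w0 1 - RtoC s / z * RtoC (RInt h w0 1) - RtoC s * RtoC (g 0%R) / z * RtoC (ln r))
    + RtoC (s * g 0 * ln r) / z)%C with
    (CInt F 0 w0 + CInt F1 w0 1 + - (RtoC s / z * RtoC (RInt h w0 1)))%C
    by (rewrite !RtoC_mult; field; exact Nz).
  eapply Rle_trans; [apply Cmod_triangle|].
  rewrite Cmod_opp, Cmod_mult, Cmod_div, !Cmod_R by exact Nz; fold r.
  assert (J4 : Rabs s / r * Rabs (RInt h w0 1) <= Rabs s / r * Lam).
  { apply Rmult_le_compat_l; [apply Rdiv_le_0_compat; lra|exact J3]. }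
  generalize (Cmod_triangle (CInt F 0 w0) (CInt F1 w0 1)).
  replace ((B * G + G * K + Rabs s * Lam) / r) with (B * G / r + G * K / r + Rabs s / r * Lam) by (field; lra).
  lra.
Qed.

(** * Bessel functions *)

Definition bessel_coef (m l : nat) : R :=
  (-1) ^ l * INR (fact m) / (INR (fact l) * INR (fact (m + l))).

(* [q_bessel m (t^2 / 4) = Jhat m t], an entire function of [X = t^2 / 4]. *)
Definition q_bessel (m : nat) (X : R) : R := PSeries (bessel_coef m) X.

Lemma INR_fact_pos (n : nat) : 0 < INR (fact n).
Proof. apply INR_fact_lt_0. Qed.

Lemma fact_S_R (n : nat) : INR (fact (S n)) = (INR n + 1) * INR (fact n).
Proof. rewrite fact_simpl, mult_INR, S_INR; reflexivity. Qed.

Lemma bessel_coef_neq_0 (m l : nat) : bessel_coef m l <> 0.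
Proof.
  unfold bessel_coef, Rdiv; repeat apply Rmult_integral_contrapositive_currified.
  - apply pow_nonzero; lra.
  - apply Rgt_not_eq, INR_fact_pos.
  - apply Rinv_neq_0_compat, Rmult_integral_contrapositive_currified; apply Rgt_not_eq, INR_fact_pos.
Qed.

Lemma bessel_coef_ratio (m l : nat) :
  bessel_coef m (S l) = bessel_coef m l * (- / ((INR l + 1) * (INR m + INR l + 1))).
Proof.
  unfold bessel_coef; rewrite Nat.add_succ_r, !fact_S_R, plus_INR; simpl pow.
  generalize (INR_fact_pos m) (INR_fact_pos l) (INR_fact_pos (m + l)) (pos_INR l) (pos_INR m); intros.
  field; repeat split; lra.
Qed.

Lemma CV_radius_bessel (m : nat) : CV_radius (bessel_coef m) = p_infty.
Proof.
  apply CV_radius_infinite_DAlembert; [apply bessel_coef_neq_0|].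
  apply (is_lim_seq_le_le (fun _ => 0) _ (fun n => / (INR n + 1))).
  - intros n; rewrite bessel_coef_ratio.
    replace (bessel_coef m n * - / ((INR n + 1) * (INR m + INR n + 1)) / bessel_coef m n)
      with (- / ((INR n + 1) * (INR m + INR n + 1)))
      by (generalize (pos_INR n) (pos_INR m); intros; field; repeat split; try lra; apply bessel_coef_neq_0).
    rewrite Rabs_Ropp, Rabs_pos_eq.
    + generalize (pos_INR n) (pos_INR m); intros; split.
      * apply Rlt_le, Rinv_0_lt_compat; nra.
      * apply Rinv_le_contravar; nra.
    + generalize (pos_INR n) (pos_INR m); intros; apply Rlt_le, Rinv_0_lt_compat; nra.
  - apply is_lim_seq_const.
  - apply (is_lim_seq_ext (fun n => / INR (S n))); [intros; rewrite S_INR; reflexivity|].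
    apply (is_lim_seq_incr_1 (fun n => / INR n)).
    apply (is_lim_seq_inv INR p_infty); [apply is_lim_seq_INR|discriminate].
Qed.

Lemma ex_pseries_bessel (m : nat) (X : R) : ex_pseries (bessel_coef m) X.
Proof. apply CV_radius_inside; rewrite CV_radius_bessel; exact I. Qed.

Lemma is_derive_q_bessel (m : nat) (X : R) :
  is_derive (q_bessel m) X (- q_bessel (S m) X / (INR m + 1)).
Proof.
  assert (E : PSeries (PS_derive (bessel_coef m)) X = - q_bessel (S m) X / (INR m + 1)).
  { unfold q_bessel; rewrite (PSeries_ext _ (PS_scal (- / (INR m + 1)) (bessel_coef (S m)))).
    - rewrite PSeries_scal; change (- / (INR m + 1) * PSeries (bessel_coef (S m)) X = - PSeries (bessel_coef (S m)) X / (INR m + 1)).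
      generalize (pos_INR m); intros; field; lra.
    - intros l; unfold PS_derive, PS_scal; rewrite bessel_coef_ratio, S_INR.
      change (scal (- / (INR m + 1)) (bessel_coef (S m) l)) with (- / (INR m + 1) * bessel_coef (S m) l).
      unfold bessel_coef; simpl (S m + l)%nat; rewrite !fact_S_R, plus_INR.
      generalize (INR_fact_pos m) (INR_fact_pos l) (INR_fact_pos (m + l)) (pos_INR l) (pos_INR m); intros.
      field; repeat split; lra. }
  rewrite <- E; apply is_derive_PSeries; rewrite CV_radius_bessel; exact I.
Qed.

Lemma q_bessel_0 (m : nat) : q_bessel m 0 = 1.
Proof.
  unfold q_bessel; rewrite PSeries_0; unfold bessel_coef; rewrite Nat.add_0_r; simpl.
  generalize (INR_fact_pos m); intros; field; lra.
Qed.

Lemma bessel_coef_le (m l : nat) : Rabs (bessel_coef m l) <= / INR (fact l).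
Proof.
  unfold bessel_coef.
  generalize (INR_fact_pos m) (INR_fact_pos l) (INR_fact_pos (m + l)); intros.
  unfold Rdiv; rewrite !Rabs_mult, pow_1_abs, Rmult_1_l, Rabs_inv, !Rabs_pos_eq; try nra.
  apply Rmult_le_reg_r with (INR (fact l) * INR (fact (m + l))); [nra|].
  rewrite Rmult_assoc, Rinv_l, Rmult_1_r by nra.
  replace (/ INR (fact l) * (INR (fact l) * INR (fact (m + l)))) with (INR (fact (m + l))) by (field; lra).
  apply le_INR, fact_le; lia.
Qed.

Lemma q_bessel_le (m : nat) (X : R) : 0 <= X -> Rabs (q_bessel m X) <= exp X.
Proof.
  intros HX; unfold q_bessel, PSeries.
  assert (Ex : is_series (fun n => / INR (fact n) * X ^ n) (exp X)).
  { apply (is_series_ext (fun n => scal (pow_n X n) (/ INR (fact n)))).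
    - intros n; rewrite pow_n_pow; apply Rmult_comm.
    - apply is_exp_Reals. }
  assert (Le : forall n, 0 <= Rabs (bessel_coef m n * X ^ n) <= / INR (fact n) * X ^ n).
  { intros n; split; [apply Rabs_pos|]; rewrite Rabs_mult, (Rabs_pos_eq (X ^ n)) by (apply pow_le, HX).
    apply Rmult_le_compat_r; [apply pow_le, HX|apply bessel_coef_le]. }
  rewrite <- (is_series_unique _ _ Ex).
  eapply Rle_trans; [apply Series_Rabs|].
  - apply (ex_series_le (V := R_CompleteNormedModule) _ (fun n => / INR (fact n) * X ^ n)); [|eexists; exact Ex].
    intros n; change (Rabs (Rabs (bessel_coef m n * X ^ n)) <= / INR (fact n) * X ^ n).
    rewrite Rabs_Rabsolu; apply Le.
  - apply Series_le; [exact Le|eexists; exact Ex].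
Qed.

(** The recurrence J_j + J_(j+2) = (2 (j+1) / t) J_(j+1) in normalised form, with X = t^2 / 4. *)
Lemma q_bessel_rec (j : nat) (X : R) :
  q_bessel j X = q_bessel (S j) X - X * q_bessel (S (S j)) X / ((INR j + 1) * (INR j + 2)).
Proof.
  unfold q_bessel.
  assert (E : PSeries (bessel_coef j) X = PSeries (PS_plus (bessel_coef (S j))
     (PS_scal (- / ((INR j + 1) * (INR j + 2))) (PS_incr_1 (bessel_coef (S (S j)))))) X).
  { apply PSeries_ext; intros [|l]; unfold PS_plus, PS_scal, PS_incr_1.
    - change (bessel_coef j 0 = bessel_coef (S j) 0 + - / ((INR j + 1) * (INR j + 2)) * 0).
      unfold bessel_coef; rewrite !Nat.add_0_r; simpl pow.
      generalize (INR_fact_pos j) (INR_fact_pos (S j)) (INR_fact_pos 0) (pos_INR j); intros; field; repeat split; lra.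
    - change (bessel_coef j (S l) = bessel_coef (S j) (S l) + - / ((INR j + 1) * (INR j + 2)) * bessel_coef (S (S j)) l).
      unfold bessel_coef.
      replace (j + S l)%nat with (S (j + l)) by lia; replace (S j + S l)%nat with (S (S (j + l))) by lia.
      replace (S (S j) + l)%nat with (S (S (j + l))) by lia.
      rewrite !fact_S_R, !S_INR, plus_INR; simpl pow.
      generalize (INR_fact_pos j) (INR_fact_pos l) (INR_fact_pos (j + l)) (pos_INR l) (pos_INR j); intros.
      field; repeat split; lra. }
  rewrite E, PSeries_plus, PSeries_scal, PSeries_incr_1.
  - change (PSeries (bessel_coef (S j)) X + - / ((INR j + 1) * (INR j + 2)) * (X * PSeries (bessel_coef (S (S j))) X) =
      PSeries (bessel_coef (S j)) X - X * PSeries (bessel_coef (S (S j))) X / ((INR j + 1) * (INR j + 2))).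
    generalize (pos_INR j); intros; field; split; lra.
  - apply ex_pseries_bessel.
  - apply ex_pseries_scal; [apply Rmult_comm|apply ex_pseries_incr_1, ex_pseries_bessel].
Qed.

(** * Finite integrals of Bessel functions *)

Lemma is_derive_q_line (j : nat) (X w : R) :
  is_derive (fun w => q_bessel j (X * (1 - w))) w (X * q_bessel (S j) (X * (1 - w)) / (INR j + 1)).
Proof.
  replace (X * q_bessel (S j) (X * (1 - w)) / (INR j + 1)) with
    (scal (- X) (- q_bessel (S j) (X * (1 - w)) / (INR j + 1)))
    by (change (- X * (- q_bessel (S j) (X * (1 - w)) / (INR j + 1)) = X * q_bessel (S j) (X * (1 - w)) / (INR j + 1));
        generalize (pos_INR j); intros; field; lra).
  apply (is_derive_comp (V := R_NormedModule) (q_bessel j) (fun w => X * (1 - w))); [apply is_derive_q_bessel|].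
  auto_derive; [exact I|ring].
Qed.

Lemma continuous_q_line (j : nat) (X w : R) : continuous (fun w => q_bessel j (X * (1 - w))) w.
Proof. apply (ex_derive_continuous (V := R_NormedModule)); eexists; apply is_derive_q_line. Qed.

Lemma continuous_pow_comp (f : R -> R) (n : nat) (w : R) : continuous f w -> continuous (fun w => f w ^ n) w.
Proof.
  intros H; induction n as [|n IH]; [apply continuous_const|].
  exact (continuous_mult (K := R_AbsRing) f (fun w => f w ^ n) w H IH).
Qed.

Lemma continuous_beta_q (m j i : nat) (X w : R) :
  continuous (fun w => w ^ m * (1 - w) ^ j * q_bessel i (X * (1 - w))) w.
Proof.
  apply (continuous_mult (K := R_AbsRing) (fun w => w ^ m * (1 - w) ^ j)); [|apply continuous_q_line].
  apply (continuous_mult (K := R_AbsRing) (fun w => w ^ m)); apply continuous_pow_comp; [apply continuous_id|].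
  apply (continuous_minus (V := R_NormedModule)); [apply continuous_const|apply continuous_id].
Qed.

(* The factor [(1 - w)^j] makes [(1 - w)^(j+1) q_(j+1)] a primitive of
   [- (j+1) (1 - w)^j q_j], so integration by parts raises the order. *)
Lemma is_derive_beta_q (j : nat) (X w : R) :
  is_derive (fun w => (1 - w) ^ S j * q_bessel (S j) (X * (1 - w))) w
    (- (INR j + 1) * ((1 - w) ^ j * q_bessel j (X * (1 - w)))).
Proof.
  assert (D1 : is_derive (fun w => (1 - w) ^ S j) w (- (INR j + 1) * (1 - w) ^ j)).
  { replace (- (INR j + 1) * (1 - w) ^ j) with (INR (S j) * (-1) * (1 - w) ^ Init.Nat.pred (S j))
      by (rewrite S_INR; simpl Init.Nat.pred; ring).
    apply (is_derive_pow (fun w => 1 - w)); auto_derive; [exact I|ring]. }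
  assert (D := is_derive_mult (K := R_AbsRing) _ _ w _ _ D1 (is_derive_q_line (S j) X w) Rmult_comm).
  replace (- (INR j + 1) * ((1 - w) ^ j * q_bessel j (X * (1 - w)))) with
    (plus (mult (- (INR j + 1) * (1 - w) ^ j) (q_bessel (S j) (X * (1 - w))))
      (mult ((1 - w) ^ S j) (X * q_bessel (S (S j)) (X * (1 - w)) / (INR (S j) + 1)))); [exact D|].
  change (- (INR j + 1) * (1 - w) ^ j * q_bessel (S j) (X * (1 - w)) +
    (1 - w) ^ S j * (X * q_bessel (S (S j)) (X * (1 - w)) / (INR (S j) + 1)) =
    - (INR j + 1) * ((1 - w) ^ j * q_bessel j (X * (1 - w)))).
  rewrite (q_bessel_rec j), S_INR; simpl pow; generalize (pos_INR j); intros; field; lra.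
Qed.

(** Sonine's finite integral; at X = 0 it is the Beta integral B(m + 1, j + 1). Integration by parts
    trades one power of w for one step of j, so the induction on m keeps j general. *)
Lemma is_RInt_beta_q (m j : nat) (X : R) :
  is_RInt (fun w => w ^ m * (1 - w) ^ j * q_bessel j (X * (1 - w))) 0 1
    (INR (fact m) * INR (fact j) / INR (fact (m + j + 1)) * q_bessel (m + j + 1) X).
Proof.
  revert j; induction m as [|m IH]; intros j.
  - assert (H := is_RInt_derive (V := R_CompleteNormedModule)
      (fun w => (1 - w) ^ S j * q_bessel (S j) (X * (1 - w)))
      (fun w => - (INR j + 1) * ((1 - w) ^ j * q_bessel j (X * (1 - w)))) 0 1
      (fun w _ => is_derive_beta_q j X w)).
    assert (C : forall w, Rmin 0 1 <= w <= Rmax 0 1 ->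
      continuous (fun w => - (INR j + 1) * ((1 - w) ^ j * q_bessel j (X * (1 - w)))) w).
    { intros w _; apply (continuous_mult (K := R_AbsRing) (fun _ => - (INR j + 1))); [apply continuous_const|].
      apply (continuous_ext (fun w => w ^ 0 * (1 - w) ^ j * q_bessel j (X * (1 - w)))); [intros; simpl; apply f_equal2; ring|].
      apply continuous_beta_q. }
    specialize (H C); apply (is_RInt_scal (V := R_NormedModule) _ _ _ (- / (INR j + 1))) in H.
    generalize (pos_INR j); intros J.
    replace (INR (fact 0) * INR (fact j) / INR (fact (0 + j + 1)) * q_bessel (0 + j + 1) X) with
      (scal (- / (INR j + 1)) (minus ((1 - 1) ^ S j * q_bessel (S j) (X * (1 - 1))) ((1 - 0) ^ S j * q_bessel (S j) (X * (1 - 0))))).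
    + apply (is_RInt_ext (V := R_NormedModule)) with (2 := H); intros w _.
      change (- / (INR j + 1) * (- (INR j + 1) * ((1 - w) ^ j * q_bessel j (X * (1 - w)))) =
        w ^ 0 * (1 - w) ^ j * q_bessel j (X * (1 - w))).
      simpl; field; lra.
    + change (- / (INR j + 1) * ((1 - 1) ^ S j * q_bessel (S j) (X * (1 - 1)) - (1 - 0) ^ S j * q_bessel (S j) (X * (1 - 0))) =
        INR (fact 0) * INR (fact j) / INR (fact (0 + j + 1)) * q_bessel (0 + j + 1) X).
      replace (0 + j + 1)%nat with (S j) by lia.
      rewrite fact_S_R; simpl (fact 0); simpl (INR 1).
      replace (1 - 1) with 0 by ring; rewrite Rminus_0_r, pow1, Rmult_1_r, pow_i by lia.
      generalize (INR_fact_pos j); intros; field; lra.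
  - generalize (pos_INR j) (pos_INR m); intros J M.
    assert (D : forall w, is_derive (fun w => w ^ S m * ((1 - w) ^ S j * q_bessel (S j) (X * (1 - w)))) w
      ((INR m + 1) * w ^ m * ((1 - w) ^ S j * q_bessel (S j) (X * (1 - w))) +
       w ^ S m * (- (INR j + 1) * ((1 - w) ^ j * q_bessel j (X * (1 - w)))))).
    { intros w; assert (D1 : is_derive (fun w => w ^ S m) w ((INR m + 1) * w ^ m)).
      { replace ((INR m + 1) * w ^ m) with (INR (S m) * 1 * w ^ Init.Nat.pred (S m))
          by (rewrite S_INR; simpl Init.Nat.pred; ring).
        apply (is_derive_pow (fun w => w)); auto_derive; [exact I|ring]. }
      exact (is_derive_mult (K := R_AbsRing) _ _ w _ _ D1 (is_derive_beta_q j X w) Rmult_comm). }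
    assert (H := is_RInt_derive (V := R_CompleteNormedModule) _ _ 0 1 (fun w _ => D w)).
    assert (H' := H (fun w _ => ltac:(
      apply (continuous_plus (V := R_NormedModule)
        (fun w => (INR m + 1) * w ^ m * ((1 - w) ^ S j * q_bessel (S j) (X * (1 - w))))
        (fun w => w ^ S m * (- (INR j + 1) * ((1 - w) ^ j * q_bessel j (X * (1 - w))))));
      [apply (continuous_ext (fun w => (INR m + 1) * (w ^ m * (1 - w) ^ S j * q_bessel (S j) (X * (1 - w)))));
        [intros; eqR; ring|apply (continuous_mult (K := R_AbsRing) (fun _ => INR m + 1)); [apply continuous_const|apply continuous_beta_q]]
      |apply (continuous_ext (fun w => (- (INR j + 1)) * (w ^ S m * (1 - w) ^ j * q_bessel j (X * (1 - w)))));
        [intros; eqR; ring|apply (continuous_mult (K := R_AbsRing) (fun _ => - (INR j + 1))); [apply continuous_const|apply continuous_beta_q]]]))).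
    assert (I1 := is_RInt_scal (V := R_NormedModule) _ _ _ (INR m + 1) _ (IH (S j))).
    assert (I2 := is_RInt_minus (V := R_NormedModule) _ _ _ _ _ _ I1 H').
    assert (I3 := is_RInt_scal (V := R_NormedModule) _ _ _ (/ (INR j + 1)) _ I2).
    refine (eq_ind _ (fun v => is_RInt _ 0 1 v) (is_RInt_ext (V := R_NormedModule) _ _ _ _ _ _ I3) _ _).
    + intros w _.
      change (/ (INR j + 1) * ((INR m + 1) * (w ^ m * (1 - w) ^ S j * q_bessel (S j) (X * (1 - w))) -
        ((INR m + 1) * w ^ m * ((1 - w) ^ S j * q_bessel (S j) (X * (1 - w))) +
         w ^ S m * (- (INR j + 1) * ((1 - w) ^ j * q_bessel j (X * (1 - w)))))) =
        w ^ S m * (1 - w) ^ j * q_bessel j (X * (1 - w))); field; lra.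
    + change (/ (INR j + 1) * ((INR m + 1) * (INR (fact m) * INR (fact (S j)) / INR (fact (m + S j + 1)) * q_bessel (m + S j + 1) X) -
        (1 ^ S m * ((1 - 1) ^ S j * q_bessel (S j) (X * (1 - 1))) - 0 ^ S m * ((1 - 0) ^ S j * q_bessel (S j) (X * (1 - 0))))) =
        INR (fact (S m)) * INR (fact j) / INR (fact (S m + j + 1)) * q_bessel (S m + j + 1) X).
      replace (m + S j + 1)%nat with (S m + j + 1)%nat by lia.
      rewrite !fact_S_R; replace (1 - 1) with 0 by ring; rewrite (pow_i (S j)), (pow_i (S m)) by lia.
      generalize (INR_fact_pos (S m + j + 1)); intros; field; lra.
Qed.

(** The case j = 0. Its moments are the factors that appear when the Bessel function in a term of
    the series is differentiated. *)
Lemma is_RInt_q0 (m : nat) (X : R) :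
  is_RInt (fun w => w ^ m * q_bessel 0 (X * (1 - w))) 0 1 (q_bessel (S m) X / (INR m + 1)).
Proof.
  assert (H := is_RInt_beta_q m 0 X).
  replace (q_bessel (S m) X / (INR m + 1)) with
    (INR (fact m) * INR (fact 0) / INR (fact (m + 0 + 1)) * q_bessel (m + 0 + 1) X).
  - apply (is_RInt_ext (V := R_NormedModule)) with (2 := H); intros; simpl; apply f_equal2; ring.
  - replace (m + 0 + 1)%nat with (S m) by lia; rewrite fact_S_R; simpl (fact 0); simpl (INR 1).
    generalize (pos_INR m) (INR_fact_pos m); intros; field; lra.
Qed.

(** X q_1(X (1 - w)) is the w-derivative of q_0(X (1 - w)), so this is an integration by parts; the
    boundary term at w = 1 is q_0(0) = 1. *)
Lemma is_RInt_q1 (m : nat) (X : R) :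
  is_RInt (fun w => X * (w ^ m * q_bessel 1 (X * (1 - w)))) 0 1 (1 - q_bessel m X).
Proof.
  assert (Cq : forall n i w, continuous (fun w => w ^ n * q_bessel i (X * (1 - w))) w).
  { intros n i w; apply (continuous_ext (fun w => w ^ n * (1 - w) ^ 0 * q_bessel i (X * (1 - w))));
      [intros; simpl; apply f_equal2; ring|apply continuous_beta_q]. }
  assert (D0 : forall w, is_derive (fun w => q_bessel 0 (X * (1 - w))) w (X * q_bessel 1 (X * (1 - w)))).
  { intros w; assert (D := is_derive_q_line 0 X w).
    replace (X * q_bessel 1 (X * (1 - w))) with (X * q_bessel 1 (X * (1 - w)) / (INR 0 + 1)); [exact D|].
    simpl; field. }
  (* For m = 0 the boundary term at w = 0 survives and gives - q_0(X). For larger m it vanishes, and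
     the Bessel term comes from [is_RInt_q0]. *)
  destruct m as [|m].
  - assert (H := is_RInt_derive (V := R_CompleteNormedModule) _ _ 0 1 (fun w _ => D0 w)).
    assert (H' := H (fun w _ => continuous_mult (K := R_AbsRing) (fun _ => X) _ w (continuous_const X w) (continuous_q_line 1 X w))).
    refine (eq_ind _ (fun v => is_RInt _ 0 1 v) (is_RInt_ext (V := R_NormedModule) _ _ _ _ _ _ H') _ _).
    + intros w _; simpl; ring.
    + change (q_bessel 0 (X * (1 - 1)) - q_bessel 0 (X * (1 - 0)) = 1 - q_bessel 0 X).
      replace (X * (1 - 1)) with 0 by ring; rewrite q_bessel_0, Rminus_0_r, Rmult_1_r; reflexivity.
  - generalize (pos_INR m); intros M.
    assert (D : forall w, is_derive (fun w => w ^ S m * q_bessel 0 (X * (1 - w))) w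
       ((INR m + 1) * w ^ m * q_bessel 0 (X * (1 - w)) + w ^ S m * (X * q_bessel 1 (X * (1 - w))))).
    { intros w; assert (D1 : is_derive (fun w => w ^ S m) w ((INR m + 1) * w ^ m)).
      { replace ((INR m + 1) * w ^ m) with (INR (S m) * 1 * w ^ Init.Nat.pred (S m))
          by (rewrite S_INR; simpl Init.Nat.pred; ring).
        apply (is_derive_pow (fun w => w)); auto_derive; [exact I|ring]. }
      exact (is_derive_mult (K := R_AbsRing) _ _ w _ _ D1 (D0 w) Rmult_comm). }
    assert (H := is_RInt_derive (V := R_CompleteNormedModule) _ _ 0 1 (fun w _ => D w)).
    assert (H' := H (fun w _ => ltac:(
      apply (continuous_plus (V := R_NormedModule)
        (fun w => (INR m + 1) * w ^ m * q_bessel 0 (X * (1 - w))) (fun w => w ^ S m * (X * q_bessel 1 (X * (1 - w)))));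
      [apply (continuous_ext (fun w => (INR m + 1) * (w ^ m * q_bessel 0 (X * (1 - w)))));
        [intros; eqR; ring|apply (continuous_mult (K := R_AbsRing) (fun _ => INR m + 1)); [apply continuous_const|apply Cq]]
      |apply (continuous_ext (fun w => X * (w ^ S m * q_bessel 1 (X * (1 - w)))));
        [intros; eqR; ring|apply (continuous_mult (K := R_AbsRing) (fun _ => X)); [apply continuous_const|apply Cq]]]))).
    assert (I1 := is_RInt_scal (V := R_NormedModule) _ _ _ (INR m + 1) _ (is_RInt_q0 m X)).
    assert (I2 := is_RInt_minus (V := R_NormedModule) _ _ _ _ _ _ H' I1).
    refine (eq_ind _ (fun v => is_RInt _ 0 1 v) (is_RInt_ext (V := R_NormedModule) _ _ _ _ _ _ I2) _ _).
    + intros w _.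
      change ((INR m + 1) * w ^ m * q_bessel 0 (X * (1 - w)) + w ^ S m * (X * q_bessel 1 (X * (1 - w))) -
        (INR m + 1) * (w ^ m * q_bessel 0 (X * (1 - w))) = X * (w ^ S m * q_bessel 1 (X * (1 - w)))); ring.
    + change (1 ^ S m * q_bessel 0 (X * (1 - 1)) - 0 ^ S m * q_bessel 0 (X * (1 - 0)) -
        (INR m + 1) * (q_bessel (S m) X / (INR m + 1)) = 1 - q_bessel (S m) X).
      replace (X * (1 - 1)) with 0 by ring; rewrite q_bessel_0, pow1, pow_i by lia; field; lra.
Qed.

Lemma Jhat_q_bessel (m : nat) (t : R) : Jhat m t = q_bessel m (t ^ 2 / 4).
Proof.
  unfold Jhat; destruct Req_EM_T as [E|E].
  - subst t; replace (0 ^ 2 / 4) with 0 by (simpl; field); rewrite q_bessel_0; reflexivity.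
  - unfold BesselJ, q_bessel, PSeries.
    rewrite <- Series_scal_l; apply Series_ext; intros l; unfold bessel_coef.
    assert (T : (2 / t) ^ m * (t / 2) ^ m = 1).
    { rewrite <- Rpow_mult_distr; replace (2 / t * (t / 2)) with 1 by (field; exact E); apply pow1. }
    replace ((t ^ 2 / 4) ^ l) with ((t / 2) ^ (2 * l)) by (rewrite pow_mult; f_equal; field).
    rewrite pow_add; generalize (INR_fact_pos l) (INR_fact_pos (m + l)); intros.
    transitivity ((2 / t) ^ m * (t / 2) ^ m * ((-1) ^ l * INR (fact m) / (INR (fact l) * INR (fact (m + l))) * (t / 2) ^ (2 * l)));
      [unfold Rdiv; ring|rewrite T; ring].
Qed.

(** * Termwise differentiation *)

Lemma Csum_RtoC (u : nat -> R) (n : nat) : Csum (fun m => RtoC (u m)) (S n) = RtoC (sum_n u n).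
Proof.
  induction n as [|n IH]; [rewrite sum_O; simpl; ring|].
  rewrite sum_Sn; change (RtoC (plus (sum_n u n) (u (S n)))) with (RtoC (sum_n u n + u (S n))).
  rewrite RtoC_plus, <- IH; reflexivity.
Qed.

Lemma Re_Csum (a : nat -> C) (n : nat) : Re (Csum a (S n)) = sum_n (fun m => Re (a m)) n.
Proof.
  induction n as [|n IH]; [rewrite sum_O; apply Rplus_0_l|].
  rewrite sum_Sn, <- IH; reflexivity.
Qed.

Lemma Im_Csum (a : nat -> C) (n : nat) : Im (Csum a (S n)) = sum_n (fun m => Im (a m)) n.
Proof.
  induction n as [|n IH]; [rewrite sum_O; apply Rplus_0_l|].
  rewrite sum_Sn, <- IH; reflexivity.
Qed.

(** The majorants B / 2^m make both the series and the series of derivatives converge uniformly on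
    the unit interval around t0. [Csum_cauchy] is applied to the real terms seen as complex
    numbers. *)
Lemma is_derive_Series (u u' : nat -> R -> R) (t0 B : R) : 0 < B ->
  (forall m t, Rabs (t - t0) < 1 -> is_derive (u m) t (u' m t)) ->
  (forall m t, Rabs (t - t0) < 1 -> continuous (u' m) t) ->
  (forall m t, Rabs (t - t0) < 1 -> Rabs (u m t) <= B * (/ 2) ^ m) ->
  (forall m t, Rabs (t - t0) < 1 -> Rabs (u' m t) <= B * (/ 2) ^ m) ->
  is_derive (fun t => Series (fun m => u m t)) t0 (Series (fun m => u' m t0)).
Proof.
  intros HB Hd Hc Hu Hu'.
  set (D := fun t => Rabs (t - t0) < 1).
  set (fn := fun n t => sum_n (fun m => u m t) n).
  assert (OD : open D).
  { intros t Ht; assert (P : 0 < 1 - Rabs (t - t0)) by (unfold D in Ht; lra).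
    exists (mkposreal _ P); intros y Hy; change (Rabs (y - t) < 1 - Rabs (t - t0)) in Hy; unfold D.
    replace (y - t0) with ((y - t) + (t - t0)) by ring.
    eapply Rle_lt_trans; [apply Rabs_triang|]; lra. }
  assert (CD : is_connected D).
  { intros a b x Ha Hb Hx; unfold D in *; apply Rabs_def2 in Ha; apply Rabs_def2 in Hb; apply Rabs_def1; lra. }
  assert (Cau : forall v : nat -> R -> R, (forall m t, D t -> Rabs (v m t) <= B * (/ 2) ^ m) ->
     CVU_dom (fun n t => sum_n (fun m => v m t) n) D).
  { intros v Hv; apply CVU_dom_cauchy; intros eps.
    destruct (Csum_cauchy B (eps / 2) HB ltac:(generalize (cond_pos eps); lra)) as [n0 Hn0].
    exists n0; intros n m t Ht Hn Hm.
    assert (Bm : forall m, Cmod (RtoC (v m t)) <= B * (/ 2) ^ m) by (intros; rewrite Cmod_R; apply Hv, Ht).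
    assert (X := Hn0 (fun m => RtoC (v m t)) Bm (S n) (S m) ltac:(lia) ltac:(lia)).
    rewrite !Csum_RtoC, <- RtoC_minus, Cmod_R in X; generalize (cond_pos eps); lra. }
  assert (Df : forall n t, D t -> is_derive (fn n) t (sum_n (fun m => u' m t) n)).
  { intros n t Ht; apply (is_derive_sum_n (K := R_AbsRing) (V := R_NormedModule) u n t (fun m => u' m t)).
    intros m _; apply Hd, Ht. }
  assert (D0 : D t0) by (unfold D; rewrite Rminus_diag, Rabs_R0; lra).
  assert (H := CVU_Derive fn D OD CD (Cau u Hu)).
  assert (E : forall n t, D t -> Derive (fn n) t = sum_n (fun m => u' m t) n).
  { intros n t Ht; apply is_derive_unique, Df, Ht. }
  assert (H1 : forall n t, D t -> ex_derive (fn n) t) by (intros n t Ht; eexists; apply Df, Ht).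
  specialize (H H1).
  assert (H2 : forall n t, D t -> continuity_pt (Derive (fn n)) t).
  { intros n t Ht; apply (continuity_pt_ext_loc (fun t => sum_n (fun m => u' m t) n)).
    - generalize (OD t Ht); apply filter_imp; intros y Hy; symmetry; apply E, Hy.
    - apply continuity_pt_filterlim; induction n as [|n IH].
      + apply (continuous_ext (u' O)); [intros; rewrite sum_O; reflexivity|apply Hc, Ht].
      + apply (continuous_ext (fun t => plus (sum_n (fun m => u' m t) n) (u' (S n) t)));
          [intros; rewrite sum_Sn; reflexivity|].
        apply (continuous_plus (V := R_NormedModule)); [exact IH|apply Hc, Ht]. }
  specialize (H H2).
  assert (H3 : CVU_dom (fun n t => Derive (fn n) t) D).
  { apply CVU_dom_cauchy; intros eps; destruct (proj1 (CVU_dom_cauchy _ _) (Cau u' Hu') eps) as [n0 Hn0].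
    exists n0; intros n m t Ht Hn Hm; rewrite !E by exact Ht; apply Hn0; assumption. }
  specialize (H H3 t0 D0).
  replace (Series (fun m => u' m t0)) with (real (Lim_seq (fun n => Derive (fn n) t0))); [exact H|].
  unfold Series; f_equal; apply Lim_seq_ext; intros n; apply E, D0.
Qed.

Lemma Series_approx (u : nat -> R) (B eta : R) : 0 < B -> 0 < eta -> (forall m, Rabs (u m) <= B * (/ 2) ^ m) ->
  exists n0, forall n, (n0 <= n)%nat -> Rabs (sum_n u n - Series u) <= eta.
Proof.
  intros HB He Hu.
  assert (Ex : ex_series u).
  { apply (ex_series_le (V := R_CompleteNormedModule) u (fun n => B * (/ 2) ^ n)); [exact Hu|].
    apply (ex_series_scal (V := R_NormedModule) B); apply ex_series_geom; rewrite Rabs_pos_eq; lra. }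
  assert (L : is_lim_seq (sum_n u) (Series u)) by exact (Series_correct u Ex).
  apply is_lim_seq_spec in L; destruct (L (mkposreal eta He)) as [n0 Hn0].
  exists n0; intros n Hn; left; exact (Hn0 n Hn).
Qed.

Lemma CSeries_approx (a : nat -> C) (B eta : R) : 0 < B -> 0 < eta -> (forall m, Cmod (a m) <= B * (/ 2) ^ m) ->
  exists n0, forall n, (n0 <= n)%nat -> Cmod (Csum a n - CSeries a)%C <= eta.
Proof.
  intros HB He Ha.
  assert (e2 : 0 < eta / 2) by lra.
  destruct (Series_approx (fun m => Re (a m)) B (eta / 2) HB e2) as [n1 Hn1].
  { intros m; eapply Rle_trans; [apply re_le_Cmod|apply Ha]. }
  destruct (Series_approx (fun m => Im (a m)) B (eta / 2) HB e2) as [n2 Hn2].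
  { intros m; eapply Rle_trans; [|apply (Ha m)]; eapply Rle_trans; [|apply Rmax_Cmod]; apply Rmax_r. }
  exists (S (max n1 n2)); intros n Hn; destruct n as [|n]; [lia|].
  eapply Rle_trans; [apply Cmod_le_abs|].
  change (Rabs (Re (Csum a (S n)) - Series (fun m => Re (a m))) + Rabs (Im (Csum a (S n)) - Series (fun m => Im (a m))) <= eta).
  rewrite Re_Csum, Im_Csum; generalize (Hn1 n ltac:(lia)) (Hn2 n ltac:(lia)); lra.
Qed.

(** Componentwise, to agree with [partial] and [CSeries], which treat the real and imaginary parts
    separately. *)
Definition cderive (f : R -> C) (t : R) (l : C) : Prop :=
  is_derive (fun s => Re (f s)) t (Re l) /\ is_derive (fun s => Im (f s)) t (Im l).

Lemma cderive_of_is_derive (f : R -> C) (t : R) (l : C) :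
  is_derive (K := R_AbsRing) (V := C_R_NormedModule) f t l -> cderive f t l.
Proof.
  intros [_ H]; split; (split; [apply is_linear_scal_l|]); intros y Hy eps;
  assert (E0 : t = y) by exact (is_filter_lim_locally_unique (V := R_NormedModule) t y Hy); subst y;
  generalize (H t (fun P HP => HP) eps); apply filter_imp; intros y Hd; change R in y;
  change (norm (V := prod_NormedModule R_AbsRing R_NormedModule R_NormedModule)
      (f y - f t - scal (V := C_R_ModuleSpace) (y - t)%R l)%C <= eps * Rabs (y - t)) in Hd;
  rewrite scal_R_Cmult, <- Cmod_norm in Hd.
  - change (Rabs (Re (f y) - Re (f t) - (y - t) * Re l) <= eps * Rabs (y - t)).
    eapply Rle_trans; [|exact Hd]; eapply Rle_trans; [|apply re_le_Cmod]; right; f_equal.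
    unfold Cminus, Re; simpl; ring.
  - change (Rabs (Im (f y) - Im (f t) - (y - t) * Im l) <= eps * Rabs (y - t)).
    eapply Rle_trans; [|exact Hd]; eapply Rle_trans; [|apply Rmax_Cmod].
    eapply Rle_trans; [|apply Rmax_r]; right; f_equal.
    unfold Cminus, Im; simpl; ring.
Qed.

Lemma cderive_mult (f g : R -> C) (t : R) (l m : C) : cderive f t l -> cderive g t m ->
  cderive (fun s => f s * g s)%C t (l * g t + f t * m)%C.
Proof.
  intros [f1 f2] [g1 g2].
  assert (M : forall (a b : R -> R) a' b', is_derive a t a' -> is_derive b t b' ->
    is_derive (fun s => a s * b s) t (a' * b t + a t * b')).
  { intros a b a' b' Ha Hb; exact (is_derive_mult (K := R_AbsRing) a b t a' b' Ha Hb Rmult_comm). }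
  split.
  - replace (Re (l * g t + f t * m)%C) with
      ((Re l * Re (g t) + Re (f t) * Re m) - (Im l * Im (g t) + Im (f t) * Im m))
      by (unfold Re, Im; simpl; ring).
    exact (is_derive_minus (V := R_NormedModule) _ _ _ _ _ (M _ _ _ _ f1 g1) (M _ _ _ _ f2 g2)).
  - replace (Im (l * g t + f t * m)%C) with
      ((Re l * Im (g t) + Re (f t) * Im m) + (Im l * Re (g t) + Im (f t) * Re m))
      by (unfold Re, Im; simpl; ring).
    exact (is_derive_plus (V := R_NormedModule) _ _ _ _ _ (M _ _ _ _ f1 g2) (M _ _ _ _ f2 g1)).
Qed.

Lemma cderive_const (c : C) (t : R) : cderive (fun _ => c) t 0%C.
Proof. split; apply (is_derive_const (V := R_NormedModule)). Qed.

Lemma cderive_RtoC (f : R -> R) (t l : R) : is_derive f t l -> cderive (fun s => RtoC (f s)) t (RtoC l).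
Proof. intros H; split; [exact H|exact (is_derive_const (K := R_AbsRing) (V := R_NormedModule) 0 t)]. Qed.

Lemma cderive_pow (f : R -> C) (t : R) (l : C) (m : nat) : cderive f t l ->
  cderive (fun s => f s ^ m)%C t (RtoC (INR m) * l * f t ^ pred m)%C.
Proof.
  intros H; induction m as [|m IH].
  - assert (E : (RtoC (INR 0) * l * f t ^ pred 0)%C = 0%C) by (change (INR 0) with 0; rewrite !Cmult_0_l; reflexivity).
    rewrite E; cbn [Cpow]; exact (cderive_const 1%C t).
  - replace (RtoC (INR (S m)) * l * f t ^ pred (S m))%C with (l * f t ^ m + f t * (RtoC (INR m) * l * f t ^ pred m))%C.
    + exact (cderive_mult f (fun s => f s ^ m)%C t _ _ H IH).
    + rewrite S_INR, RtoC_plus; cbn [Init.Nat.pred]; destruct m as [|m].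
      * change (INR 0) with 0; cbn [Cpow Init.Nat.pred]; ring.
      * cbn [Init.Nat.pred]; rewrite (Cpow_S _ m); ring.
Qed.

Lemma cderive_continuous (f : R -> C) (t : R) (l : C) : cderive f t l -> continuous f t.
Proof.
  intros [H1 H2]; apply continuous_C_of_comp; apply (ex_derive_continuous (V := R_NormedModule)); eexists; eassumption.
Qed.

(** * The series of E and of its partial derivatives *)

Definition bessel_arg (k : R) (x : R * R) : R := k ^ 2 * (fst x ^ 2 + snd x ^ 2) / 4.

Definition E_term (k alpha tau : R) (m : nat) (x : R * R) : C :=
  (RtoC (/ Gamma (alpha * INR m + 1)) * ((RtoC tau * x) ^ m * RtoC (q_bessel m (bessel_arg k x))))%C.

Definition unit_vec (j : nat) : C := if Nat.eqb j 1 then 1%C else Ci.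

(** The product rule, with q_m' = - q_(m+1) / (m + 1). At m = 0 the exponent [pred m] is 0 and the
    factor [INR m] removes the term. *)
Definition E_dterm (k alpha tau : R) (j m : nat) (x : R * R) : C :=
  (RtoC (/ Gamma (alpha * INR m + 1)) *
   (RtoC (INR m) * (RtoC tau * unit_vec j) * (RtoC tau * x) ^ pred m * RtoC (q_bessel m (bessel_arg k x))
    + (RtoC tau * x) ^ m
      * RtoC (k ^ 2 * coord x j / 2 * (- q_bessel (S m) (bessel_arg k x) / (INR m + 1)))))%C.

Lemma cplx_eq (x : R * R) : cplx x = x.
Proof. destruct x; unfold cplx, Cplus, Cmult, Ci, RtoC; simpl; f_equal; ring. Qed.

Lemma bessel_arg_Cmod (k : R) (x : R * R) : bessel_arg k x = k ^ 2 * Cmod x ^ 2 / 4.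
Proof. unfold bessel_arg; rewrite Cmod2_alt; reflexivity. Qed.

Lemma bessel_arg_enorm (k : R) (x : R * R) : bessel_arg k x = (k * enorm x) ^ 2 / 4.
Proof. rewrite bessel_arg_Cmod; change (enorm x) with (Cmod x); field. Qed.

Lemma bessel_arg_pos (k : R) (x : R * R) : 0 <= bessel_arg k x.
Proof.
  rewrite bessel_arg_Cmod; apply Rdiv_le_0_compat; [|lra].
  apply Rmult_le_pos; apply pow2_ge_0.
Qed.

Lemma E_CSeries (k alpha tau : R) (x : R * R) : 0 < alpha ->
  E k alpha tau x = CSeries (fun m => E_term k alpha tau m x).
Proof.
  intros Ha.
  assert (T : forall m, ((RtoC tau * cplx x) ^ m / RtoC (Gamma (alpha * INR m + 1)) * RtoC (Jhat m (k * enorm x)))%C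
    = E_term k alpha tau m x).
  { intros m; assert (G := Gamma_pos (alpha * INR m + 1) ltac:(generalize (INR_alpha_pos alpha m Ha); lra)).
    unfold E_term; rewrite cplx_eq, Jhat_q_bessel, bessel_arg_enorm, RtoC_inv by lra; unfold Cdiv; ring. }
  unfold E, CSeries; f_equal; apply Series_ext; intros m; rewrite T; reflexivity.
Qed.

Lemma cderive_path (x : R * R) (j : nat) (t : R) :
  cderive (fun t => set_coord x j t) t (unit_vec j).
Proof.
  unfold set_coord, unit_vec; destruct (Nat.eqb j 1); split; simpl.
  - exact (is_derive_id (K := R_AbsRing) t).
  - exact (is_derive_const (K := R_AbsRing) (V := R_NormedModule) (snd x) t).
  - exact (is_derive_const (K := R_AbsRing) (V := R_NormedModule) (fst x) t).
  - exact (is_derive_id (K := R_AbsRing) t).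
Qed.

Lemma coord_set_coord (x : R * R) (j : nat) (t : R) : coord (set_coord x j t) j = t.
Proof. unfold coord, set_coord; destruct (Nat.eqb j 1); reflexivity. Qed.

Lemma set_coord_coord (x : R * R) (j : nat) : set_coord x j (coord x j) = x.
Proof. unfold coord, set_coord; destruct x, (Nat.eqb j 1); reflexivity. Qed.

Lemma is_derive_bessel_arg (k : R) (x : R * R) (j : nat) (t : R) :
  is_derive (fun t => bessel_arg k (set_coord x j t)) t (k ^ 2 * t / 2).
Proof.
  unfold bessel_arg, set_coord; destruct (Nat.eqb j 1); simpl fst; simpl snd; auto_derive; auto; field.
Qed.

Lemma is_derive_q_path (k : R) (m : nat) (x : R * R) (j : nat) (t : R) :
  is_derive (fun t => q_bessel m (bessel_arg k (set_coord x j t))) t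
    (k ^ 2 * t / 2 * (- q_bessel (S m) (bessel_arg k (set_coord x j t)) / (INR m + 1))).
Proof.
  exact (is_derive_comp (V := R_NormedModule) (q_bessel m) (fun t => bessel_arg k (set_coord x j t)) t _ _
    (is_derive_q_bessel m _) (is_derive_bessel_arg k x j t)).
Qed.

Lemma cderive_E_term (k alpha tau : R) (m : nat) (x : R * R) (j : nat) (t : R) :
  cderive (fun t => E_term k alpha tau m (set_coord x j t)) t (E_dterm k alpha tau j m (set_coord x j t)).
Proof.
  unfold E_term, E_dterm; rewrite coord_set_coord.
  set (z := fun t => set_coord x j t : C).
  set (c := RtoC (/ Gamma (alpha * INR m + 1))).
  set (q := fun t => RtoC (q_bessel m (bessel_arg k (set_coord x j t)))).
  set (q' := RtoC (k ^ 2 * t / 2 * (- q_bessel (S m) (bessel_arg k (set_coord x j t)) / (INR m + 1)))).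
  assert (D1 : cderive (fun t => RtoC tau * z t)%C t (RtoC tau * unit_vec j)%C).
  { assert (D := cderive_mult _ _ _ _ _ (cderive_const (RtoC tau) t) (cderive_path x j t)).
    replace (RtoC tau * unit_vec j)%C with (0 * z t + RtoC tau * unit_vec j)%C by ring; exact D. }
  assert (D2 := cderive_pow _ _ _ m D1).
  assert (D3 : cderive q t q') by (apply cderive_RtoC, is_derive_q_path).
  assert (D4 := cderive_mult _ _ _ _ _ (cderive_const c t) (cderive_mult _ _ _ _ _ D2 D3)).
  match type of D4 with cderive _ _ ?l =>
    match goal with |- cderive _ _ ?r => replace r with l; [exact D4|] end end.
  unfold q, z; cbv beta; fold q'.
  generalize ((RtoC tau * set_coord x j t) ^ m)%C ((RtoC tau * set_coord x j t) ^ pred m)%C; intros p p'.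
  eqC; ring.
Qed.

Lemma continuous_E_dterm (k alpha tau : R) (m : nat) (x : R * R) (j : nat) (t : R) :
  continuous (fun t => E_dterm k alpha tau j m (set_coord x j t)) t.
Proof.
  apply (continuous_ext (fun t => RtoC (/ Gamma (alpha * INR m + 1)) *
   (RtoC (INR m) * (RtoC tau * unit_vec j) * (RtoC tau * set_coord x j t) ^ pred m * RtoC (q_bessel m (bessel_arg k (set_coord x j t)))
    + (RtoC tau * set_coord x j t) ^ m
      * RtoC (k ^ 2 * t / 2 * (- q_bessel (S m) (bessel_arg k (set_coord x j t)) / (INR m + 1)))))%C).
  { intros s; unfold E_dterm; rewrite coord_set_coord; reflexivity. }
  assert (Cz : continuous (fun t => RtoC tau * set_coord x j t)%C t).
  { apply continuous_Cmult; [apply continuous_const|exact (cderive_continuous _ _ _ (cderive_path x j t))]. }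
  assert (Cq : forall m, continuous (fun t => q_bessel m (bessel_arg k (set_coord x j t))) t).
  { intros n; apply (ex_derive_continuous (V := R_NormedModule)); eexists; apply is_derive_q_path. }
  apply continuous_Cmult; [apply continuous_const|apply continuous_Cplus].
  - apply continuous_Cmult; [|apply continuous_RtoC, Cq].
    apply continuous_Cmult; [apply continuous_const|].
    exact (continuous_Cpow _ _ _ Cz).
  - apply continuous_Cmult; [exact (continuous_Cpow _ _ _ Cz)|].
    apply continuous_RtoC.
    apply (continuous_ext (fun t => k ^ 2 / 2 * (- / (INR m + 1)) * (t * q_bessel (S m) (bessel_arg k (set_coord x j t))))).
    { intros s; eqR; generalize (pos_INR m); intros; field; lra. }
    apply (continuous_mult (K := R_AbsRing) (fun _ => _)); [apply continuous_const|].
    apply (continuous_mult (K := R_AbsRing) (fun t => t)); [apply continuous_id|apply Cq].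
Qed.

(** These bounds justify convergence and termwise differentiation at fixed tau; their constant
    depends on tau and x and does not enter the asymptotics. *)
Lemma E_term_bounds (k alpha tau : R) (x : R * R) (j : nat) : 0 < alpha -> 0 < tau ->
  exists B, 0 < B /\ forall m t, Rabs (t - coord x j) < 1 ->
    Cmod (E_term k alpha tau m (set_coord x j t)) <= B * (/ 2) ^ m /\
    Cmod (E_dterm k alpha tau j m (set_coord x j t)) <= B * (/ 2) ^ m.
Proof.
  intros Ha Ht.
  set (rho := 1 + (Rabs (fst x) + Rabs (snd x))).
  assert (rho1 : 1 <= rho) by (unfold rho; generalize (Rabs_pos (fst x)) (Rabs_pos (snd x)); lra).
  (* [rho] bounds the modulus when one coordinate moves by less than 1. P bounds |tau y|, and P >= 1
     lets P^m dominate the power with exponent [pred m]. *)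
  set (P := 1 + tau * rho).
  assert (P1 : 1 <= P) by (unfold P; nra).
  destruct (ml_coef_bound alpha P Ha ltac:(lra)) as (B & B0 & HB).
  set (Y := k ^ 2 * rho ^ 2 / 4); set (kr := k ^ 2 * rho / 2).
  assert (kr0 : 0 <= kr) by (unfold kr; generalize (pow2_ge_0 k); nra).
  exists (B * exp Y * (1 + tau + kr)).
  generalize (exp_pos Y); intros eY.
  assert (BY : 0 < B * exp Y) by (apply Rmult_lt_0_compat; assumption).
  split; [apply Rmult_lt_0_compat; lra|]; intros m t Htt.
  assert (G := Gamma_pos (alpha * INR m + 1) ltac:(generalize (INR_alpha_pos alpha m Ha); lra)).
  assert (Tt : Rabs t <= Rabs (coord x j) + 1).
  { replace t with ((t - coord x j) + coord x j) by ring; eapply Rle_trans; [apply Rabs_triang|]; lra. }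
  assert (T1 : Rabs t <= rho).
  { unfold rho, coord in *; destruct (Nat.eqb j 1);
    generalize (Rabs_pos (fst x)) (Rabs_pos (snd x)); lra. }
  assert (T2 : Cmod (set_coord x j t) <= rho).
  { eapply Rle_trans; [apply Cmod_le_abs|]; unfold rho, coord, set_coord in *; destruct (Nat.eqb j 1); simpl; lra. }
  set (y := set_coord x j t) in *.
  assert (HY : bessel_arg k y <= Y).
  { rewrite bessel_arg_Cmod; unfold Y.
    assert (Cmod y ^ 2 <= rho ^ 2) by (apply pow_incr; split; [apply Cmod_ge_0|exact T2]).
    generalize (pow2_ge_0 k); nra. }
  assert (HX := bessel_arg_pos k y).
  assert (Q : forall i, Rabs (q_bessel i (bessel_arg k y)) <= exp Y).
  { intros i; eapply Rle_trans; [apply q_bessel_le, HX|apply exp_le, HY]. }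
  assert (Z : Cmod (RtoC tau * y)%C <= P).
  { rewrite Cmod_mult, Cmod_R, Rabs_pos_eq by lra; unfold P; nra. }
  assert (Zp : forall i, Cmod ((RtoC tau * y) ^ i)%C <= P ^ i).
  { intros i; rewrite Cmod_pow; apply pow_incr; split; [apply Cmod_ge_0|exact Z]. }
  specialize (HB m).
  assert (Gi : 0 < / Gamma (alpha * INR m + 1)) by (apply Rinv_0_lt_compat, G).
  assert (Pm : 0 < P ^ m) by (apply pow_lt; lra).
  assert (q4 : 0 <= (/ 4) ^ m) by (apply pow_le; lra).
  assert (q2 : 0 <= (/ 2) ^ m) by (apply pow_le; lra).
  assert (q42 : (/ 4) ^ m <= (/ 2) ^ m) by (apply pow_incr; lra).
  assert (q24 : 2 ^ m * (/ 4) ^ m = (/ 2) ^ m) by (rewrite <- Rpow_mult_distr; f_equal; field).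
  assert (m2 : INR m <= 2 ^ m) by (generalize (INR_le_pow2 m); lra).
  assert (m0 := pos_INR m).
  unfold E_term, E_dterm; rewrite !Cmod_mult, !Cmod_R, !(Rabs_pos_eq (/ Gamma _)) by lra.
  assert (cy : coord y j = t) by apply coord_set_coord.
  split.
  - apply Rle_trans with (/ Gamma (alpha * INR m + 1) * (P ^ m * exp Y)).
    + apply Rmult_le_compat_l; [lra|].
      apply Rmult_le_compat; [apply Cmod_ge_0|apply Rabs_pos|apply Zp|apply Q].
    + apply Rle_trans with (B * (/ 4) ^ m * exp Y).
      * replace (/ Gamma (alpha * INR m + 1) * (P ^ m * exp Y)) with (P ^ m / Gamma (alpha * INR m + 1) * exp Y) by (unfold Rdiv; ring).
        apply Rmult_le_compat_r; lra.
      * replace (B * (/ 4) ^ m * exp Y) with (B * exp Y * (/ 4) ^ m) by ring.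
        apply Rle_trans with (B * exp Y * (/ 2) ^ m); [apply Rmult_le_compat_l; lra|].
        apply Rmult_le_compat_r; [exact q2|]; rewrite <- (Rmult_1_r (B * exp Y)) at 1; apply Rmult_le_compat_l; lra.
  - assert (Ue : Cmod (unit_vec j) = 1).
    { unfold unit_vec; destruct (Nat.eqb j 1); [apply Cmod_1|apply Cmod_Ci]. }
    assert (Pp : P ^ pred m <= P ^ m) by (apply Rle_pow; [lra|lia]).
    assert (S1 : Cmod (RtoC (INR m) * (RtoC tau * unit_vec j) * (RtoC tau * y) ^ pred m * RtoC (q_bessel m (bessel_arg k y)))%C
      <= 2 ^ m * tau * P ^ m * exp Y).
    { rewrite !Cmod_mult, !Cmod_R, Ue, Rmult_1_r, (Rabs_pos_eq (INR m)), (Rabs_pos_eq tau) by lra.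
      apply Rmult_le_compat; [|apply Rabs_pos| |apply Q].
      - apply Rmult_le_pos; [apply Rmult_le_pos; lra|apply Cmod_ge_0].
      - apply Rmult_le_compat; [apply Rmult_le_pos; lra|apply Cmod_ge_0|apply Rmult_le_compat_r; lra|].
        eapply Rle_trans; [apply Zp|exact Pp]. }
    assert (S2 : Cmod ((RtoC tau * y) ^ m * RtoC (k ^ 2 * coord y j / 2 * (- q_bessel (S m) (bessel_arg k y) / (INR m + 1))))%C
      <= P ^ m * (kr * exp Y)).
    { rewrite Cmod_mult, Cmod_R, cy; apply Rmult_le_compat; [apply Cmod_ge_0|apply Rabs_pos|apply Zp|].
      rewrite Rabs_mult; apply Rmult_le_compat; try apply Rabs_pos.
      - unfold kr, Rdiv; rewrite !Rabs_mult, (Rabs_pos_eq (k ^ 2)), (Rabs_pos_eq (/ 2)) by (try lra; apply pow2_ge_0).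
        apply Rmult_le_compat_r; [lra|apply Rmult_le_compat_l; [apply pow2_ge_0|exact T1]].
      - unfold Rdiv; rewrite Rabs_mult, Rabs_Ropp, (Rabs_pos_eq (/ _)) by (apply Rlt_le, Rinv_0_lt_compat; lra).
        rewrite <- (Rmult_1_r (exp Y)); apply Rmult_le_compat; [apply Rabs_pos|apply Rlt_le, Rinv_0_lt_compat; lra|apply Q|].
        rewrite <- Rinv_1; apply Rinv_le_contravar; lra. }
    apply Rle_trans with (/ Gamma (alpha * INR m + 1) * (2 ^ m * tau * P ^ m * exp Y + P ^ m * (kr * exp Y))).
    + apply Rmult_le_compat_l; [lra|]; eapply Rle_trans; [apply Cmod_triangle|]; lra.
    + replace (/ Gamma (alpha * INR m + 1) * (2 ^ m * tau * P ^ m * exp Y + P ^ m * (kr * exp Y))) with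
        (P ^ m / Gamma (alpha * INR m + 1) * (exp Y * (2 ^ m * tau + kr))) by (unfold Rdiv; ring).
      assert (two : 0 <= 2 ^ m) by (apply pow_le; lra).
      apply Rle_trans with (B * (/ 4) ^ m * (exp Y * (2 ^ m * tau + kr))).
      * apply Rmult_le_compat_r; [|exact HB]; apply Rmult_le_pos; [lra|]; nra.
      * replace (B * (/ 4) ^ m * (exp Y * (2 ^ m * tau + kr))) with
          (B * exp Y * (tau * (2 ^ m * (/ 4) ^ m) + kr * (/ 4) ^ m)) by ring.
        rewrite q24; replace (B * exp Y * (1 + tau + kr) * (/ 2) ^ m) with (B * exp Y * ((1 + tau + kr) * (/ 2) ^ m)) by ring.
        apply Rmult_le_compat_l; [lra|].
        assert (kr * (/ 4) ^ m <= kr * (/ 2) ^ m) by (apply Rmult_le_compat_l; assumption).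
        nra.
Qed.

Lemma cderive_E (k alpha tau : R) (x : R * R) (j : nat) : 0 < alpha -> 0 < tau ->
  cderive (fun t => E k alpha tau (set_coord x j t)) (coord x j)
    (CSeries (fun m => E_dterm k alpha tau j m x)).
Proof.
  intros Ha Ht; destruct (E_term_bounds k alpha tau x j Ha Ht) as (B & B0 & HB).
  assert (Im_le : forall c : C, Rabs (Im c) <= Cmod c).
  { intros c; eapply Rle_trans; [|apply Rmax_Cmod]; apply Rmax_r. }
  split.
  - apply (is_derive_ext (fun t => Series (fun m => Re (E_term k alpha tau m (set_coord x j t))))).
    { intros t; rewrite (E_CSeries k alpha tau (set_coord x j t) Ha); reflexivity. }
    assert (H := is_derive_Series (fun m t => Re (E_term k alpha tau m (set_coord x j t)))
      (fun m t => Re (E_dterm k alpha tau j m (set_coord x j t))) (coord x j) B B0).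
    cbv beta in H; rewrite set_coord_coord in H; apply H.
    + intros m t _; apply (cderive_E_term k alpha tau m x j t).
    + intros m t _; apply (continuous_Re (fun t => E_dterm k alpha tau j m (set_coord x j t))), continuous_E_dterm.
    + intros m t Htt; eapply Rle_trans; [apply re_le_Cmod|apply HB, Htt].
    + intros m t Htt; eapply Rle_trans; [apply re_le_Cmod|apply HB, Htt].
  - apply (is_derive_ext (fun t => Series (fun m => Im (E_term k alpha tau m (set_coord x j t))))).
    { intros t; rewrite (E_CSeries k alpha tau (set_coord x j t) Ha); reflexivity. }
    assert (H := is_derive_Series (fun m t => Im (E_term k alpha tau m (set_coord x j t)))
      (fun m t => Im (E_dterm k alpha tau j m (set_coord x j t))) (coord x j) B B0).
    cbv beta in H; rewrite set_coord_coord in H; apply H.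
    + intros m t _; apply (cderive_E_term k alpha tau m x j t).
    + intros m t _; apply (continuous_Im (fun t => E_dterm k alpha tau j m (set_coord x j t))), continuous_E_dterm.
    + intros m t Htt; eapply Rle_trans; [apply Im_le|apply HB, Htt].
    + intros m t Htt; eapply Rle_trans; [apply Im_le|apply HB, Htt].
Qed.

Lemma cderive_partial (j : nat) (f : R * R -> C) (x : R * R) (l : C) :
  cderive (fun t => f (set_coord x j t)) (coord x j) l -> ex_partial j f x /\ partial j f x = l.
Proof.
  intros [H1 H2]; split.
  - exists l; apply is_derive_C_of_comp; assumption.
  - apply injective_projections; [exact (is_derive_unique _ _ _ H1)|exact (is_derive_unique _ _ _ H2)].
Qed.

(** The leading coefficient is X q_1(X) / (x1 + i x2). The first term differentiates X q_1(X), whose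
    X-derivative is q_0(X); the second differentiates the reciprocal. *)
Definition leading_derivative (k : R) (j : nat) (x : R * R) : C :=
  (RtoC (k ^ 2 * coord x j / 2 * q_bessel 0 (bessel_arg k x)) / x
   - RtoC (bessel_arg k x * q_bessel 1 (bessel_arg k x)) * unit_vec j / ((x : C) * x))%C.

Lemma leading_coef_eq (k : R) (x : R * R) :
  leading_coef k x = (RtoC (bessel_arg k x * q_bessel 1 (bessel_arg k x)) * / (x : C))%C.
Proof.
  unfold leading_coef; rewrite cplx_eq, Jhat_q_bessel, <- bessel_arg_enorm.
  replace ((k * enorm x / 2) ^ 2) with (bessel_arg k x) by (rewrite bessel_arg_enorm; field).
  rewrite RtoC_mult; unfold Cdiv; ring.
Qed.

Lemma cderive_inv_path (x : R * R) (j : nat) : (x : C) <> 0%C ->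
  cderive (fun t => / (set_coord x j t : C))%C (coord x j) (- unit_vec j / ((x : C) * x))%C.
Proof.
  intros Nx; destruct x as [a b].
  destruct (is_derive_line Cinv a b _ (is_derive_Cinv (a, b) Nx)) as [H1 H2].
  unfold set_coord, coord, unit_vec; destruct (Nat.eqb j 1); simpl fst; simpl snd.
  - apply cderive_of_is_derive; replace (- (1) / ((a, b) * (a, b)))%C with (- / ((a, b) * (a, b)))%C by (unfold Cdiv; ring); exact H1.
  - apply cderive_of_is_derive; replace (- Ci / ((a, b) * (a, b)))%C with (Ci * - / ((a, b) * (a, b)))%C by (unfold Cdiv; ring); exact H2.
Qed.

Lemma cderive_leading_coef (k : R) (x : R * R) (j : nat) : (x : C) <> 0%C ->
  cderive (fun t => leading_coef k (set_coord x j t)) (coord x j) (leading_derivative k j x).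
Proof.
  intros Nx.
  (* The derivative q_1 - X q_2 / 2 is q_0 by the recurrence with j = 0. *)
  assert (D0 : is_derive (fun X => X * q_bessel 1 X) (bessel_arg k x) (q_bessel 0 (bessel_arg k x))).
  { set (X := bessel_arg k x).
    assert (D := is_derive_mult (K := R_AbsRing) (fun X => X) (q_bessel 1) X _ _ (is_derive_id X) (is_derive_q_bessel 1 X) Rmult_comm).
    replace (q_bessel 0 X) with (plus (mult one (q_bessel 1 X)) (mult X (- q_bessel 2 X / (INR 1 + 1)))); [exact D|].
    change (1 * q_bessel 1 X + X * (- q_bessel 2 X / (INR 1 + 1)) = q_bessel 0 X).
    rewrite (q_bessel_rec 0 X); simpl INR; field. }
  assert (D1 : is_derive (fun t => bessel_arg k (set_coord x j t) * q_bessel 1 (bessel_arg k (set_coord x j t))) (coord x j)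
     (k ^ 2 * coord x j / 2 * q_bessel 0 (bessel_arg k x))).
  { rewrite <- (set_coord_coord x j) in D0 at 1.
    exact (is_derive_comp (V := R_NormedModule) (fun X => X * q_bessel 1 X) (fun t => bessel_arg k (set_coord x j t)) (coord x j) _ _
      D0 (is_derive_bessel_arg k x j (coord x j))). }
  assert (D2 := cderive_mult _ _ _ _ _ (cderive_RtoC _ _ _ D1) (cderive_inv_path x j Nx)).
  cbv beta in D2; rewrite set_coord_coord in D2.
  destruct D2 as [D2 D3].
  match type of D2 with is_derive _ _ (Re ?l) => assert (El : leading_derivative k j x = l) end.
  { unfold leading_derivative, Cdiv; ring. }
  rewrite El; split.
  - apply (is_derive_ext (fun t => Re (RtoC (bessel_arg k (set_coord x j t) * q_bessel 1 (bessel_arg k (set_coord x j t))) * / (set_coord x j t : C))%C)); [|exact D2].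
    intros t; rewrite leading_coef_eq; reflexivity.
  - apply (is_derive_ext (fun t => Im (RtoC (bessel_arg k (set_coord x j t) * q_bessel 1 (bessel_arg k (set_coord x j t))) * / (set_coord x j t : C))%C)); [|exact D3].
    intros t; rewrite leading_coef_eq; reflexivity.
Qed.

(** * Asymptotics *)

(** The integral of a finite sum is exact: a weight g multiplies the coefficients by its moments,
    which is how the Bessel factors enter. *)
Lemma is_RInt_ml_sum (alpha : R) (a : nat -> R) (z : C) (g : R -> R) (I : nat -> R) (n : nat) :
  (forall m, is_RInt (fun w => w ^ m * g w) 0 1 (I m)) ->
  is_RInt (V := C_R_NormedModule) (fun w => ml_sum alpha a n (RtoC w * z) * RtoC (g w))%C 0 1
    (Csum (fun m => RtoC (a m / Gamma (alpha * INR m + 1)) * z ^ m * RtoC (I m))%C n).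
Proof.
  intros HI; unfold ml_sum; induction n as [|n IH]; cbn [Csum].
  - assert (H := is_RInt_Cmult 0%C _ _ _ _ (CInt_RtoC _ _ _ _ (HI O))); rewrite Cmult_0_l in H.
    apply (is_RInt_ext (V := C_R_NormedModule)) with (2 := H); intros w _.
    eqC; ring.
  - assert (H := is_RInt_Cmult (RtoC (a n / Gamma (alpha * INR n + 1)) * z ^ n)%C _ _ _ _ (CInt_RtoC _ _ _ _ (HI n))).
    assert (H2 := is_RInt_plus (V := C_R_NormedModule) _ _ _ _ _ _ IH H).
    apply (is_RInt_ext (V := C_R_NormedModule)) with (2 := H2); intros w _.
    match goal with |- ?l = _ => change l with
      (Csum (fun m => RtoC (a m / Gamma (alpha * INR m + 1)) * (RtoC w * z) ^ m) n * RtoC (g w)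
       + RtoC (a n / Gamma (alpha * INR n + 1)) * z ^ n * RtoC (w ^ n * g w))%C end.
    eqC.
    rewrite RtoC_mult, RtoC_pow, Cpow_mult_l; ring.
Qed.

(** The mean value theorem with |q_(j+1)| <= e^X. It supplies the Lipschitz hypothesis at w = 0,
    uniformly for bounded X. *)
Lemma q_line_lipschitz (j : nat) (X w : R) : 0 <= X -> 0 <= w <= 1 ->
  Rabs (q_bessel j (X * (1 - w)) - q_bessel j X) <= X * exp X * w.
Proof.
  intros HX Hw.
  destruct (MVT_gen (fun w => q_bessel j (X * (1 - w))) 0 w
    (fun w => X * q_bessel (S j) (X * (1 - w)) / (INR j + 1))) as (c & Hc & E).
  - intros; apply is_derive_q_line.
  - intros; apply continuity_pt_filterlim, continuous_q_line.
  - rewrite Rmin_left, Rmax_right in Hc by lra.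
    replace (X * (1 - 0)) with X in E by ring; rewrite E, Rminus_0_r.
    rewrite Rabs_mult, (Rabs_pos_eq w) by lra; apply Rmult_le_compat_r; [lra|].
    generalize (pos_INR j); intros J; unfold Rdiv.
    rewrite !Rabs_mult, (Rabs_pos_eq X), (Rabs_pos_eq (/ _)) by (try lra; apply Rlt_le, Rinv_0_lt_compat; lra).
    rewrite <- (Rmult_1_r (X * exp X)); apply Rmult_le_compat.
    + apply Rmult_le_pos; [lra|apply Rabs_pos].
    + apply Rlt_le, Rinv_0_lt_compat; lra.
    + apply Rmult_le_compat_l; [lra|].
      eapply Rle_trans; [apply q_bessel_le; nra|apply exp_le; nra].
    + rewrite <- Rinv_1; apply Rinv_le_contravar; lra.
Qed.

(** The points with |arg x| >= theta in an annulus: a form that covers both a single point off the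
    closed cone and the region of uniformity. *)
Definition sector (theta Rad : R) (x : R * R) : Prop :=
  fst x <= Cmod x * cos theta /\ / Rad < Cmod x < Rad.

(** tau >= Rad forces |tau x| >= 1, the range of the Mittag-Leffler estimates; the sector is
    invariant under positive scaling. *)
Lemma sector_scale (theta Rad tau : R) (x : R * R) : 1 < Rad -> Rad <= tau -> sector theta Rad x ->
  (x : C) <> 0%C /\ Rabs (ln (Cmod x)) <= ln Rad /\ Cmod (RtoC tau * x)%C = tau * Cmod x /\
  1 <= tau * Cmod x <= tau * Rad /\ / (tau * Cmod x) <= Rad / tau /\
  fst (RtoC tau * x)%C <= Cmod (RtoC tau * x)%C * cos theta.
Proof.
  intros HR Ht [S1 [S2 S3]].
  assert (r0 : 0 < / Rad) by (apply Rinv_0_lt_compat; lra).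
  assert (x0 : 0 < Cmod x) by lra.
  assert (E : Cmod (RtoC tau * x)%C = tau * Cmod x) by (rewrite Cmod_mult, Cmod_R, Rabs_pos_eq by lra; reflexivity).
  assert (A : 1 <= tau * Cmod x).
  { apply Rle_trans with (Rad * / Rad); [right; field; lra|apply Rmult_le_compat; lra]. }
  split; [apply Cmod_gt_0, x0|split; [|split; [exact E|split; [|split]]]].
  - apply Rabs_le; split.
    + rewrite <- ln_Rinv by lra; apply Rcomplements.ln_le; lra.
    + apply Rcomplements.ln_le; lra.
  - split; [exact A|apply Rmult_le_compat_l; lra].
  - rewrite Rinv_mult; unfold Rdiv; rewrite Rmult_comm.
    apply Rmult_le_compat_r; [apply Rlt_le, Rinv_0_lt_compat; lra|].
    rewrite <- (Rinv_inv Rad); apply Rinv_le_contravar; lra.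
  - rewrite E; simpl; rewrite Rmult_0_l, Rminus_0_r, Rmult_assoc; apply Rmult_le_compat_l; lra.
Qed.

(** [ml_sum_integral] at z = tau x yields ln (tau |x|) = ln tau + ln |x|. On the annulus |ln |x|| <=
    ln Rad, so the second part joins the O(1/tau). *)
Lemma moment_sum_asymptotic (alpha theta sigma G Lam Rad : R) (a : nat -> R) (kf : C -> C) :
  0 < alpha <= 1 -> PI * alpha / 2 < theta <= PI -> generating a sigma kf -> (forall m, Rabs (a m) <= 2 ^ m) ->
  0 <= G -> 0 <= Lam -> 1 < Rad ->
  exists M, 0 <= M /\ forall (tau : R) (x : R * R) (g : R -> R) (I : nat -> R), Rad <= tau -> sector theta Rad x ->
    (forall w, 0 <= w <= 1 -> continuous g w) -> (forall w, 0 <= w <= 1 -> Rabs (g w) <= G) ->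
    (forall w, 0 <= w <= 1 -> Rabs (g w - g 0) <= Lam * w) ->
    (forall m, is_RInt (fun w => w ^ m * g w) 0 1 (I m)) ->
    forall eta, 0 < eta -> exists n0, forall n, (n0 <= n)%nat ->
    Cmod (Csum (fun m => RtoC (a m / Gamma (alpha * INR m + 1)) * (RtoC tau * x) ^ m * RtoC (I m))%C n
      + RtoC (sigma * inv_Gamma (1 - alpha) * g 0 * (ln tau / tau)) / x)%C <= M / tau + eta.
Proof.
  intros Ha Ht Hg Hm HG HL HR.
  destruct (ml_sum_integral alpha theta sigma G Lam a kf Ha Ht Hg Hm HG HL) as (M & M0 & HM).
  set (s := sigma * inv_Gamma (1 - alpha)) in *.
  assert (s0 := Rabs_pos s).
  assert (lR : 0 < ln Rad) by (rewrite <- ln_1; apply ln_increasing; lra).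
  assert (sG : 0 <= Rabs s * G * ln Rad) by (apply Rmult_le_pos; [apply Rmult_le_pos|]; lra).
  exists ((M + Rabs s * G * ln Rad) * Rad); split; [apply Rmult_le_pos; lra|].
  intros tau x g I Htau Hx Cg Bg Lg HI eta He.
  destruct (sector_scale theta Rad tau x HR Htau Hx) as (Nx & Lx & Ez & [z1 z2] & Iz & Hz).
  destruct (HM (tau * Rad) eta) as [n0 Hn0]; [apply Rmult_lt_0_compat; lra|exact He|].
  exists n0; intros n Hn.
  assert (X := Hn0 n Hn (RtoC tau * x)%C Hz ltac:(rewrite Ez; lra) g Cg Bg Lg).
  rewrite (CInt_unique _ _ _ _ (is_RInt_ml_sum alpha a (RtoC tau * x)%C g I n HI)), Ez in X.
  assert (x0 : 0 < Cmod x) by (apply Cmod_gt_0, Nx).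
  rewrite ln_mult in X by lra.
  set (Sm := Csum _ n) in *.
  assert (Nt : RtoC tau <> 0%C) by (intros E; apply (f_equal fst) in E; simpl in E; lra).
  replace (Sm + RtoC (s * g 0%R * (ln tau / tau)) / x)%C with
    ((Sm + RtoC (s * g 0%R * (ln tau + ln (Cmod x))) / (RtoC tau * x))
      + - (RtoC (s * g 0%R * ln (Cmod x)) / (RtoC tau * x)))%C.
  2: { rewrite !RtoC_mult, RtoC_plus, RtoC_div by lra; field; auto. }
  eapply Rle_trans; [apply Cmod_triangle|].
  rewrite Cmod_opp, Cmod_div, Cmod_R, Ez by (apply Cmult_neq_0; assumption).
  assert (B1 : Rabs (s * g 0 * ln (Cmod x)) <= Rabs s * G * ln Rad).
  { rewrite !Rabs_mult; apply Rmult_le_compat; [apply Rmult_le_pos; apply Rabs_pos|apply Rabs_pos| |exact Lx].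
    apply Rmult_le_compat_l; [exact s0|apply Bg; lra]. }
  assert (B2 : Rabs (s * g 0 * ln (Cmod x)) / (tau * Cmod x) <= Rabs s * G * ln Rad * (Rad / tau)).
  { apply Rmult_le_compat; [apply Rabs_pos|apply Rlt_le, Rinv_0_lt_compat; lra|exact B1|exact Iz]. }
  assert (B3 : M / (tau * Cmod x) <= M * (Rad / tau)) by (apply Rmult_le_compat_l; assumption).
  replace ((M + Rabs s * G * ln Rad) * Rad / tau) with (M * (Rad / tau) + Rabs s * G * ln Rad * (Rad / tau)) by (field; lra).
  lra.
Qed.

Lemma bessel_arg_sector (k theta Rad : R) (x : R * R) : sector theta Rad x -> bessel_arg k x <= k ^ 2 * Rad ^ 2 / 4.
Proof.
  intros [_ [S1 S2]]; rewrite bessel_arg_Cmod.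
  assert (Cmod x ^ 2 <= Rad ^ 2) by (apply pow_incr; split; [apply Cmod_ge_0|lra]).
  generalize (pow2_ge_0 k); nra.
Qed.

(** q_m(X) is 1 minus a moment of the weight X q_1(X (1 - w)), so the sum is a plain Mittag-Leffler
    sum minus a moment sum. The former is O(1/tau); the latter carries the logarithm, with the sign
    reversed. *)
Lemma q1_sum_asymptotic (k alpha theta sigma Rad : R) (a : nat -> R) (kf : C -> C) :
  0 < alpha <= 1 -> PI * alpha / 2 < theta <= PI -> generating a sigma kf -> (forall m, Rabs (a m) <= 2 ^ m) ->
  1 < Rad ->
  exists M, 0 <= M /\ forall (tau : R) (x : R * R), Rad <= tau -> sector theta Rad x ->
    forall eta, 0 < eta -> exists n0, forall n, (n0 <= n)%nat ->
    Cmod (Csum (fun m => RtoC (a m / Gamma (alpha * INR m + 1)) * (RtoC tau * x) ^ m * RtoC (q_bessel m (bessel_arg k x)))%C n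
      - RtoC (sigma * inv_Gamma (1 - alpha) * (bessel_arg k x * q_bessel 1 (bessel_arg k x)) * (ln tau / tau)) / x)%C
     <= M / tau + eta.
Proof.
  intros Ha Ht Hg Hm HR.
  set (Y := k ^ 2 * Rad ^ 2 / 4).
  assert (Y0 : 0 <= Y) by (unfold Y; apply Rdiv_le_0_compat; [apply Rmult_le_pos; apply pow2_ge_0|lra]).
  generalize (exp_pos Y); intros eY.
  destruct (moment_sum_asymptotic alpha theta sigma (Y * exp Y) (Y * (Y * exp Y)) Rad a kf Ha Ht Hg Hm) as (M & M0 & HM);
    [apply Rmult_le_pos; lra|apply Rmult_le_pos; [lra|apply Rmult_le_pos; lra]|exact HR|].
  destruct (ml_sum_asymptotic_uniform alpha theta sigma a kf Ha Ht Hg Hm) as (K & K0 & HK).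
  set (s := sigma * inv_Gamma (1 - alpha)) in *.
  assert (s0 := Rabs_pos s).
  exists (M + (Rabs s + K) * Rad); split; [assert (0 <= (Rabs s + K) * Rad) by (apply Rmult_le_pos; lra); lra|].
  intros tau x Htau Hx eta He.
  destruct (sector_scale theta Rad tau x HR Htau Hx) as (Nx & Lx & Ez & [z1 z2] & Iz & Hz).
  set (X := bessel_arg k x).
  assert (X0 : 0 <= X) by apply bessel_arg_pos.
  assert (XY : X <= Y) by (apply (bessel_arg_sector k theta Rad x Hx)).
  assert (eXY : exp X <= exp Y) by (apply exp_le, XY).
  destruct (HM tau x (fun w => X * q_bessel 1 (X * (1 - w))) (fun m => 1 - q_bessel m X) Htau Hx) with (eta := eta / 2)
    as [n1 Hn1]; [| | | |lra|].
  - intros w _; apply (continuous_mult (K := R_AbsRing) (fun _ => X)); [apply continuous_const|apply continuous_q_line].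
  - intros w Hw; rewrite Rabs_mult, (Rabs_pos_eq X) by exact X0.
    apply Rmult_le_compat; [exact X0|apply Rabs_pos|exact XY|].
    eapply Rle_trans; [apply q_bessel_le; nra|apply exp_le; nra].
  - intros w Hw; replace (X * (1 - 0)) with X by ring.
    rewrite <- Rmult_minus_distr_l, Rabs_mult, (Rabs_pos_eq X) by exact X0.
    rewrite (Rmult_assoc Y); apply Rmult_le_compat; [exact X0|apply Rabs_pos|exact XY|].
    eapply Rle_trans; [apply q_line_lipschitz; assumption|].
    apply Rmult_le_compat_r; [lra|]; apply Rmult_le_compat; try assumption; apply Rlt_le, exp_pos.
  - intros m; apply (is_RInt_ext (V := R_NormedModule)) with (2 := is_RInt_q1 m X); intros w _.
    eqR; ring.
  - destruct (HK (tau * Rad) (eta / 2)) as [n2 Hn2]; [apply Rmult_lt_0_compat; lra|lra|].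
    exists (max n1 n2); intros n Hn.
    specialize (Hn1 n ltac:(lia)); specialize (Hn2 n ltac:(lia) (RtoC tau * x)%C Hz ltac:(rewrite Ez; lra)).
    rewrite Ez in Hn2; cbv beta in Hn1; replace (X * (1 - 0)) with X in Hn1 by ring.
    set (S1 := Csum (fun m => RtoC (a m / Gamma (alpha * INR m + 1)) * (RtoC tau * x) ^ m * RtoC (1 - q_bessel m X))%C n) in *.
    set (L := (RtoC (s * (X * q_bessel 1 X) * (ln tau / tau)) / x)%C) in *.
    assert (E : Csum (fun m => RtoC (a m / Gamma (alpha * INR m + 1)) * (RtoC tau * x) ^ m * RtoC (q_bessel m X))%C n
      = (ml_sum alpha a n (RtoC tau * x) - S1)%C).
    { unfold S1, ml_sum; rewrite Csum_minus; apply Csum_ext; intros m _; rewrite RtoC_minus; ring. }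
    rewrite E.
    assert (Nt : (RtoC tau * x)%C <> 0%C) by (apply Cmod_gt_0; rewrite Ez; lra).
    replace (ml_sum alpha a n (RtoC tau * x) - S1 - L)%C with
      ((ml_sum alpha a n (RtoC tau * x) + RtoC s / (RtoC tau * x)) + - (RtoC s / (RtoC tau * x)) + - (S1 + L))%C by ring.
    eapply Rle_trans; [apply Cmod_triangle|]; rewrite Cmod_opp.
    assert (T := Cmod_triangle (ml_sum alpha a n (RtoC tau * x) + RtoC s / (RtoC tau * x)) (- (RtoC s / (RtoC tau * x)))).
    rewrite Cmod_opp, Cmod_div, Cmod_R, Ez in T by exact Nt.
    assert (B1 : Rabs s / (tau * Cmod x) <= Rabs s * (Rad / tau)) by (apply Rmult_le_compat_l; assumption).
    assert (B2 : K / (tau * Cmod x) ^ 2 <= K * (Rad / tau)).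
    { apply Rmult_le_compat_l; [exact K0|]; eapply Rle_trans; [|exact Iz].
      apply Rinv_le_contravar; [lra|]; simpl; rewrite Rmult_1_r.
      rewrite <- (Rmult_1_r (tau * Cmod x)) at 1; apply Rmult_le_compat_l; lra. }
    replace ((M + (Rabs s + K) * Rad) / tau) with (M / tau + Rabs s * (Rad / tau) + K * (Rad / tau)) by (field; lra).
    lra.
Qed.

(** The weight is q_0(X (1 - w)), whose moments are q_(m+1)(X) / (m + 1). No plain sum has to be
    split off, and the logarithm keeps its sign. *)
Lemma q0_sum_asymptotic (k alpha theta Rad : R) :
  0 < alpha <= 1 -> PI * alpha / 2 < theta <= PI -> 1 < Rad ->
  exists M, 0 <= M /\ forall (tau : R) (x : R * R), Rad <= tau -> sector theta Rad x ->
    forall eta, 0 < eta -> exists n0, forall n, (n0 <= n)%nat ->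
    Cmod (Csum (fun m => RtoC (1 / Gamma (alpha * INR m + 1)) * (RtoC tau * x) ^ m
        * RtoC (q_bessel (S m) (bessel_arg k x) / (INR m + 1)))%C n
      + RtoC (1 * inv_Gamma (1 - alpha) * q_bessel 0 (bessel_arg k x) * (ln tau / tau)) / x)%C
     <= M / tau + eta.
Proof.
  intros Ha Ht HR.
  set (Y := k ^ 2 * Rad ^ 2 / 4).
  assert (Y0 : 0 <= Y) by (unfold Y; apply Rdiv_le_0_compat; [apply Rmult_le_pos; apply pow2_ge_0|lra]).
  generalize (exp_pos Y); intros eY.
  destruct (moment_sum_asymptotic alpha theta 1 (exp Y) (Y * exp Y) Rad (fun _ => 1) _ Ha Ht generating_geom)
    as (M & M0 & HM); [|lra|apply Rmult_le_pos; lra|exact HR|].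
  { intros m; rewrite Rabs_R1; apply pow_R1_Rle; lra. }
  exists M; split; [exact M0|]; intros tau x Htau Hx eta He.
  set (X := bessel_arg k x).
  assert (X0 : 0 <= X) by apply bessel_arg_pos.
  assert (XY : X <= Y) by (apply (bessel_arg_sector k theta Rad x Hx)).
  assert (eXY : exp X <= exp Y) by (apply exp_le, XY).
  destruct (HM tau x (fun w => q_bessel 0 (X * (1 - w))) (fun m => q_bessel (S m) X / (INR m + 1)) Htau Hx) with (eta := eta)
    as [n1 Hn1]; [| | | |exact He|].
  - intros w _; apply continuous_q_line.
  - intros w Hw; eapply Rle_trans; [apply q_bessel_le; nra|apply exp_le; nra].
  - intros w Hw; replace (X * (1 - 0)) with X by ring.
    eapply Rle_trans; [apply q_line_lipschitz; assumption|].
    apply Rmult_le_compat_r; [lra|]; apply Rmult_le_compat; try assumption; apply Rlt_le, exp_pos.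
  - intros m; apply is_RInt_q0.
  - exists n1; intros n Hn; specialize (Hn1 n Hn).
    cbv beta in Hn1; replace (X * (1 - 0)) with X in Hn1 by ring; exact Hn1.
Qed.

Lemma unit_vec_Cmod (j : nat) : Cmod (unit_vec j) = 1.
Proof. unfold unit_vec; destruct (Nat.eqb j 1); [apply Cmod_1|apply Cmod_Ci]. Qed.

(** The number of terms depends on tau, x and eta, but the bound does not; letting eta -> 0 at fixed
    tau and x passes from finite sums to the series. *)
Theorem uniform_asymptotics (k alpha theta Rad : R) :
  0 < alpha <= 1 -> PI * alpha / 2 < theta <= PI -> 1 < Rad ->
  exists M, forall (tau : R) (x : R * R), Rad <= tau -> sector theta Rad x ->
    Cmod (E k alpha tau x - leading_coef k x * RtoC (inv_Gamma (1 - alpha) * (ln tau / tau)))%C <= M / tau /\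
    forall j, Cmod (CSeries (fun m => E_dterm k alpha tau j m x)
      - leading_derivative k j x * RtoC (inv_Gamma (1 - alpha) * (ln tau / tau)))%C <= M / tau.
Proof.
  intros Ha Ht HR.
  assert (B1 : forall m : nat, Rabs 1 <= 2 ^ m) by (intros m; rewrite Rabs_R1; apply pow_R1_Rle; lra).
  assert (B2 : forall m : nat, Rabs (INR m) <= 2 ^ m).
  { intros m; rewrite Rabs_pos_eq by apply pos_INR; generalize (INR_le_pow2 m); lra. }
  destruct (q1_sum_asymptotic k alpha theta 1 Rad (fun _ => 1) _ Ha Ht generating_geom B1 HR) as (M1 & M10 & HM1).
  destruct (q1_sum_asymptotic k alpha theta (-1) Rad INR _ Ha Ht generating_arith_geom B2 HR) as (M2 & M20 & HM2).
  destruct (q0_sum_asymptotic k alpha theta Rad Ha Ht HR) as (M3 & M30 & HM3).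
  set (kr := k ^ 2 * Rad / 2).
  assert (kr0 : 0 <= kr) by (unfold kr; generalize (pow2_ge_0 k); nra).
  exists (M1 + (Rad * M2 + kr * M3)); intros tau x Htau Hx.
  assert (tau0 : 0 < tau) by lra.
  assert (Q0 : 0 <= (Rad * M2 + kr * M3) / tau).
  { apply Rdiv_le_0_compat; [|lra]; apply Rplus_le_le_0_compat; apply Rmult_le_pos; lra. }
  assert (Q1 : 0 <= M1 / tau) by (apply Rdiv_le_0_compat; lra).
  replace ((M1 + (Rad * M2 + kr * M3)) / tau) with (M1 / tau + (Rad * M2 + kr * M3) / tau) by (field; lra).
  destruct (sector_scale theta Rad tau x HR Htau Hx) as (Nx & _).
  assert (Hx' := Hx); destruct Hx' as [_ [x1 x2]].
  set (c := inv_Gamma (1 - alpha)) in *; set (X := bessel_arg k x) in *; set (lt := ln tau / tau) in *.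
  assert (Bd : forall j, exists B, 0 < B /\ (forall m, Cmod (E_term k alpha tau m x) <= B * (/ 2) ^ m) /\
     forall m, Cmod (E_dterm k alpha tau j m x) <= B * (/ 2) ^ m).
  { intros j; destruct (E_term_bounds k alpha tau x j (proj1 Ha) tau0) as (B & B0 & HB).
    exists B; split; [exact B0|].
    assert (Z : Rabs (coord x j - coord x j) < 1) by (rewrite Rminus_diag, Rabs_R0; lra).
    split; intros m; generalize (HB m (coord x j) Z); rewrite set_coord_coord; intros [HB1 HB2]; assumption. }
  assert (Gp : forall m, 0 < Gamma (alpha * INR m + 1)).
  { intros m; apply Gamma_pos; generalize (INR_alpha_pos alpha m (proj1 Ha)); lra. }
  split.
  - rewrite E_CSeries by lra.
    apply (Rle_of_forall_eta _ _ 2); [lra|]; intros eta He.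
    destruct (Bd 1%nat) as (B & B0 & HB & _).
    destruct (CSeries_approx _ B eta B0 He HB) as [n1 Hn1].
    destruct (HM1 tau x Htau Hx eta He) as [n2 Hn2].
    specialize (Hn1 (max n1 n2) ltac:(lia)); specialize (Hn2 (max n1 n2) ltac:(lia)).
    set (n := max n1 n2) in *.
    assert (Es : Csum (fun m => E_term k alpha tau m x) n =
      Csum (fun m => RtoC (1 / Gamma (alpha * INR m + 1)) * (RtoC tau * x) ^ m * RtoC (q_bessel m X))%C n).
    { apply Csum_ext; intros m _; unfold E_term, X, Rdiv; rewrite Rmult_1_l; ring. }
    cbv beta in Hn2; fold X c lt in Hn2; rewrite <- Es in Hn2.
    set (S := Csum (fun m => E_term k alpha tau m x) n) in *; set (F := CSeries _) in *.
    replace (leading_coef k x * RtoC (c * lt))%C with (RtoC (1 * c * (X * q_bessel 1 X) * lt) / x)%C.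
    2: { rewrite leading_coef_eq; fold X; rewrite !RtoC_mult; unfold Cdiv; ring. }
    set (L := (RtoC (1 * c * (X * q_bessel 1 X) * lt) / x)%C) in *.
    replace (F - L)%C with ((S - L) + - (S - F))%C by ring.
    eapply Rle_trans; [apply Cmod_triangle|]; rewrite Cmod_opp; lra.
  - intros j.
    assert (Hcj : Rabs (k ^ 2 * coord x j / 2) <= kr).
    { unfold kr, Rdiv; rewrite !Rabs_mult, (Rabs_pos_eq (k ^ 2)), (Rabs_pos_eq (/ 2)) by (try lra; apply pow2_ge_0).
      apply Rmult_le_compat_r; [lra|apply Rmult_le_compat_l; [apply pow2_ge_0|]].
      apply Rle_trans with (Cmod x); [|lra]; eapply Rle_trans; [|apply Rmax_Cmod].
      unfold coord; destruct (Nat.eqb j 1); [apply Rmax_l|apply Rmax_r]. }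
    assert (Hex : Cmod (unit_vec j / x)%C <= Rad).
    { rewrite Cmod_div, unit_vec_Cmod by exact Nx.
      unfold Rdiv; rewrite Rmult_1_l, <- (Rinv_inv Rad); apply Rinv_le_contravar; [apply Rinv_0_lt_compat|]; lra. }
    apply (Rle_of_forall_eta _ _ (1 + Rad + kr)); [lra|]; intros eta He.
    destruct (Bd j) as (B & B0 & _ & HB).
    destruct (CSeries_approx _ B eta B0 He HB) as [n1 Hn1].
    destruct (HM2 tau x Htau Hx eta He) as [n2 Hn2].
    destruct (HM3 tau x Htau Hx eta He) as [n3 Hn3].
    set (n := max n1 (max n2 n3)).
    specialize (Hn1 n ltac:(unfold n; lia)); specialize (Hn2 n ltac:(unfold n; lia)); specialize (Hn3 n ltac:(unfold n; lia)).
    fold X c lt in Hn2, Hn3.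
    set (S1 := Csum (fun m => RtoC (INR m / Gamma (alpha * INR m + 1)) * (RtoC tau * x) ^ m * RtoC (q_bessel m X))%C n) in *.
    set (S0 := Csum (fun m => RtoC (1 / Gamma (alpha * INR m + 1)) * (RtoC tau * x) ^ m * RtoC (q_bessel (S m) X / (INR m + 1)))%C n) in *.
    (* Writing m z^(m-1) as m z^m / z reduces the derivative to the sum with coefficients m and the
       sum with moments q_(m+1) / (m + 1). *)
    assert (Es : Csum (fun m => E_dterm k alpha tau j m x) n =
      (unit_vec j / x * S1 - RtoC (k ^ 2 * coord x j / 2) * S0)%C).
    { unfold S1, S0; rewrite !Csum_Cmult, Csum_minus; apply Csum_ext; intros m _.
      unfold E_dterm; fold X.
      assert (P : (RtoC (INR m) * (RtoC tau * unit_vec j) * (RtoC tau * x) ^ pred m = unit_vec j / x * (RtoC (INR m) * (RtoC tau * x) ^ m))%C).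
      { destruct m as [|m]; [change (INR 0) with 0; unfold Cdiv; rewrite !Cmult_0_l, Cmult_0_r; reflexivity|].
        cbn [Init.Nat.pred]; rewrite (Cpow_S _ m); field; exact Nx. }
      rewrite P; unfold Rdiv; rewrite Rmult_1_l.
      replace (- q_bessel (S m) X * / (INR m + 1)) with (- (q_bessel (S m) X * / (INR m + 1))) by ring.
      rewrite !(RtoC_mult (INR m)), !(RtoC_mult (k ^ 2 * coord x j * / 2)), RtoC_opp; ring. }
    rewrite Es in Hn1.
    set (F := CSeries _) in *; set (cj := k ^ 2 * coord x j / 2) in *.
    set (L1 := (RtoC (-1 * c * (X * q_bessel 1 X) * lt) / x)%C) in *.
    set (L0 := (RtoC (1 * c * q_bessel 0 X * lt) / x)%C) in *.
    (* The signs agree because sigma = -1 in [L1], while the moment sum tends to - [L0] and enters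
       with a minus sign. *)
    replace (leading_derivative k j x * RtoC (c * lt))%C with (unit_vec j / x * L1 + RtoC cj * L0)%C.
    2: { unfold leading_derivative, L1, L0; fold X cj; rewrite !RtoC_mult.
         replace (RtoC (-1)) with (- RtoC 1)%C by (rewrite <- RtoC_opp; f_equal; lra).
         field; exact Nx. }
    replace (F - (unit_vec j / x * L1 + RtoC cj * L0))%C with
      (- (unit_vec j / x * S1 - RtoC cj * S0 - F) + unit_vec j / x * (S1 - L1) + - (RtoC cj * (S0 + L0)))%C by ring.
    eapply Rle_trans; [apply Cmod_triangle|]; rewrite Cmod_opp.
    assert (T := Cmod_triangle (- (unit_vec j / x * S1 - RtoC cj * S0 - F)) (unit_vec j / x * (S1 - L1))).
    rewrite Cmod_opp in T.
    assert (T1 : Cmod (unit_vec j / x * (S1 - L1))%C <= Rad * (M2 / tau + eta)).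
    { rewrite Cmod_mult; apply Rmult_le_compat; auto using Cmod_ge_0. }
    assert (T2 : Cmod (RtoC cj * (S0 + L0))%C <= kr * (M3 / tau + eta)).
    { rewrite Cmod_mult, Cmod_R; apply Rmult_le_compat; auto using Cmod_ge_0, Rabs_pos. }
    replace ((Rad * M2 + kr * M3) / tau) with (Rad * (M2 / tau) + kr * (M3 / tau)) by (field; lra).
    lra.
Qed.

(** If x1 >= |x| cos theta, moving right by d > 0 raises x1 by d and |x| cos theta by less than d.
    The moved point lies in the open cone, and d is arbitrarily small. *)
Lemma not_closure_cone (theta : R) (x : R * R) : 0 < theta < PI ->
  ~ closure (cone theta) x -> fst x < Cmod x * cos theta.
Proof.
  intros Ht N; apply Rnot_le_lt; intros H; apply N; intros P [eps HP].
  set (d := eps / 2).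
  assert (d0 : 0 < d) by (unfold d; generalize (cond_pos eps); lra).
  exists ((fst x + d)%R, snd x); split.
  - apply HP; split; simpl.
    + change (Rabs (fst x + d - fst x) < eps); replace (fst x + d - fst x) with d by ring.
      rewrite Rabs_pos_eq by lra; unfold d; generalize (cond_pos eps); lra.
    + apply ball_center.
  - unfold cone; change (enorm ((fst x + d)%R, snd x)) with (Cmod ((fst x + d)%R, snd x)); simpl fst.
    assert (E1 : (((fst x + d)%R, snd x) : C) = (x + RtoC d)%C).
    { destruct x; unfold Cplus, RtoC; simpl; f_equal; ring. }
    rewrite E1; set (y := (x + RtoC d)%C).
    assert (A1 : Cmod y <= Cmod x + d).
    { unfold y; eapply Rle_trans; [apply Cmod_triangle|]; rewrite Cmod_R, Rabs_pos_eq; lra. }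
    assert (A2 : Cmod x <= Cmod y + d).
    { generalize (Cmod_triangle y (- RtoC d)%C).
      assert (Z : (y + - RtoC d)%C = x) by (change (@eq C ((x + RtoC d) + - RtoC d)%C x); ring); rewrite Z.
      rewrite Cmod_opp, Cmod_R, Rabs_pos_eq; lra. }
    assert (c1 : cos theta < 1) by (rewrite <- cos_0; apply cos_decreasing_1; lra).
    assert (c2 : -1 < cos theta) by (rewrite <- cos_PI; apply cos_decreasing_1; lra).
    (* A non-negative cosine needs the upper bound on |y|, a negative one the lower bound. *)
    destruct (Rle_or_lt 0 (cos theta)); nra.
Qed.

Lemma bigO_unif_of_bound (D : R * R -> Prop) (f : R -> R * R -> C) (M T : R) : 0 < T ->
  (forall tau x, T <= tau -> D x -> Cmod (f tau x) <= M / tau) -> bigO_unif D f (fun tau => 1 / tau).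
Proof.
  intros HT H; exists M, T; intros tau Ht x Hx.
  eapply Rle_trans; [apply H; [lra|exact Hx]|]; right.
  rewrite Rabs_pos_eq; [unfold Rdiv; ring|].
  apply Rlt_le, Rdiv_lt_0_compat; lra.
Qed.

(** theta can be taken as the absolute value of the argument of x itself, and |x| + 1/|x| + 1
    exceeds 1, |x| and 1/|x|. Asymptotics at a single point thus become an instance of the uniform
    ones. *)
Lemma sector_of_point (beta : R) (x : R * R) : 0 < beta < PI -> fst x < Cmod x * cos beta ->
  exists theta Rad, beta < theta <= PI /\ 1 < Rad /\ sector theta Rad x.
Proof.
  intros Hb Hx.
  assert (Nx : 0 < Cmod x).
  { generalize (Cmod_ge_0 x); intros [P|P]; [exact P|].
    symmetry in P; apply Cmod_eq_0 in P; rewrite P, Cmod_0 in Hx; simpl in Hx; lra. }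
  set (c := fst x / Cmod x).
  assert (Ec : fst x = Cmod x * c) by (unfold c; field; lra).
  assert (C1 : -1 <= c <= 1).
  { generalize (Rle_trans _ _ _ (Rmax_l _ _) (Rmax_Cmod x)); rewrite Ec, Rabs_mult, (Rabs_pos_eq (Cmod x)) by lra.
    intros H; assert (H' : Rabs c <= 1) by (apply Rmult_le_reg_l with (Cmod x); lra).
    apply Rabs_le_between in H'; lra. }
  assert (Bc := acos_bound c); assert (Cc := cos_acos c C1).
  exists (acos c), (Cmod x + / Cmod x + 1).
  assert (Ix : 0 < / Cmod x) by (apply Rinv_0_lt_compat, Nx).
  split; [split; [|lra]|split; [lra|split; [rewrite Cc; lra|split; [|lra]]]].
  - apply Rnot_le_lt; intros L.
    assert (cos beta <= cos (acos c)).
    { destruct (Req_dec (acos c) beta) as [->|Ne]; [lra|]; left; apply cos_decreasing_1; lra. }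
    rewrite Cc in *; rewrite Ec in Hx; apply Rmult_lt_reg_l in Hx; lra.
  - apply Rlt_le_trans with (/ / Cmod x); [|rewrite Rinv_inv; lra].
    apply Rinv_lt_contravar; [apply Rmult_lt_0_compat; lra|lra].
Qed.

Theorem proposition2p1 (k alpha : R)
    (hk : 0 <= k) (halpha0 : 0 < alpha) (halpha1 : alpha <= 1) :
  (forall x : R * R, ~ closure (cone (PI * alpha / 2)) x ->
     bigO_unif (fun y => y = x)
       (fun tau y =>
          (E k alpha tau y
           - leading_coef k y
             * RtoC (inv_Gamma (1 - alpha) * (ln tau / tau)))%C)
       (fun tau => 1 / tau)
     /\ forall j : nat, (1 <= j <= 2)%nat ->
          (forall tau : R, 0 < tau -> ex_partial j (E k alpha tau) x)
          /\ ex_partial j (leading_coef k) x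
          /\ bigO_unif (fun y => y = x)
               (fun tau y =>
                  (partial j (E k alpha tau) y
                   - partial j (leading_coef k) y
                     * RtoC (inv_Gamma (1 - alpha) * (ln tau / tau)))%C)
               (fun tau => 1 / tau))
  /\
  (forall eps Rad : R, 0 < eps < PI - PI * alpha / 2 -> 0 < Rad ->
     let region := fun x : R * R =>
       ~ closure (cone (PI * alpha / 2 + eps)) x /\ / Rad < enorm x < Rad in
     bigO_unif region
       (fun tau x =>
          (E k alpha tau x
           - leading_coef k x
             * RtoC (inv_Gamma (1 - alpha) * (ln tau / tau)))%C)
       (fun tau => 1 / tau)
     /\ forall j : nat, (1 <= j <= 2)%nat ->
          bigO_unif region
            (fun tau x =>
               (partial j (E k alpha tau) x
                - partial j (leading_coef k) x
                  * RtoC (inv_Gamma (1 - alpha) * (ln tau / tau)))%C)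
            (fun tau => 1 / tau)).
Proof.
  assert (Ha : 0 < alpha <= 1) by lra.
  assert (Pi0 := PI_RGT_0).
  assert (Hb : 0 < PI * alpha / 2 < PI) by nra.
  assert (Ep : forall j tau x, 0 < tau ->
    ex_partial j (E k alpha tau) x /\ partial j (E k alpha tau) x = CSeries (fun m => E_dterm k alpha tau j m x)).
  { intros j tau x Ht; apply cderive_partial, cderive_E; assumption. }
  assert (Lp : forall j (x : R * R), (x : C) <> 0%C ->
    ex_partial j (leading_coef k) x /\ partial j (leading_coef k) x = leading_derivative k j x).
  { intros j x Nx; apply cderive_partial, cderive_leading_coef, Nx. }
  (* Both halves of the statement are instances of this claim: D is a single point in the first and
     the given region in the second. *)
  assert (Main : forall theta Rad (D : R * R -> Prop), PI * alpha / 2 < theta <= PI -> 1 < Rad ->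
    (forall x, D x -> sector theta Rad x) ->
    bigO_unif D (fun tau x => (E k alpha tau x - leading_coef k x * RtoC (inv_Gamma (1 - alpha) * (ln tau / tau)))%C)
      (fun tau => 1 / tau) /\
    forall j, bigO_unif D (fun tau x => (partial j (E k alpha tau) x
      - partial j (leading_coef k) x * RtoC (inv_Gamma (1 - alpha) * (ln tau / tau)))%C) (fun tau => 1 / tau)).
  { intros theta Rad D Ht HR HD.
    destruct (uniform_asymptotics k alpha theta Rad Ha Ht HR) as [M HM].
    split; [|intros j]; apply (bigO_unif_of_bound D _ M Rad); try lra; intros tau x Htau Hx.
    - exact (proj1 (HM tau x Htau (HD x Hx))).
    - destruct (sector_scale theta Rad tau x HR Htau (HD x Hx)) as [Nx _].
      rewrite (proj2 (Ep j tau x ltac:(lra))), (proj2 (Lp j x Nx)); exact (proj2 (HM tau x Htau (HD x Hx)) j). }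
  split.
  - intros x Hx; apply not_closure_cone in Hx; [|exact Hb].
    destruct (sector_of_point _ x Hb Hx) as (theta & Rad & Ht & HR & Hs).
    destruct (Main theta Rad (fun y => y = x) Ht HR) as [M1 M2]; [intros y ->; exact Hs|].
    split; [exact M1|]; intros j _.
    destruct (sector_scale theta Rad Rad x HR (Rle_refl _) Hs) as [Nx _].
    split; [intros tau Htau; apply Ep, Htau|split; [apply Lp, Nx|apply M2]].
  - intros eps Rad He HR region.
    (* For Rad <= 1 the region is empty; replacing Rad by a number that is at least 2 only widens
       the annulus. *)
    assert (R2 : 1 < Rmax Rad 2) by (generalize (Rmax_r Rad 2); lra).
    destruct (Main (PI * alpha / 2 + eps) (Rmax Rad 2) region) as [M1 M2]; [lra|exact R2| |].
    + intros x [Hx [H1 H2]]; apply not_closure_cone in Hx; [|lra].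
      change (/ Rad < Cmod x) in H1; change (Cmod x < Rad) in H2.
      split; [lra|split].
      * eapply Rle_lt_trans; [|exact H1]; apply Rinv_le_contravar; [exact HR|apply Rmax_l].
      * eapply Rlt_le_trans; [exact H2|apply Rmax_l].
    + split; [exact M1|intros j _; apply M2].
Qed.
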